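(* Let $0<s<1$. Let $U\ge0$ be a random variable with $\mathbb E U=1$, and assume that there exist $r>1$ and $\delta>0$ such that $$\mathbb E[U^r]<\infty\qquad\text{and}\qquad 2^{1-r}\,\mathbb E[U^r]\le2^{-r(s+\delta)}.$$ Let $\widetilde\nu$ denote the almost sure weak limit of the dyadic scalar Mandelbrot cascade on $[0,1]$ generated by $U$. Let $\gamma:[0,1]\to\mathbb R^2$ be a fixed nondegenerate $C^2$ embedded arc, and set $\nu_\gamma=\gamma_\#\widetilde\nu$. Then there exist constants $C_\gamma<\infty$, $c_\gamma>0$ and $\eta>0$, depending only on $s,r,\delta$, the law of $U$, and the arc $\gamma$, such that for every integer $n\ge1$, $$\mathbb P\Big(\sup_{2^n\le|\xi|\le2^{n+1}}|\widehat{\nu_\gamma}(\xi)|>C_\gamma2^{-sn/2}\Big)\le C_\gamma\exp(-c_\gamma2^{\eta n})+C_\gamma2^{-c_\gamma n}.$$ Consequently, almost surely, $|\widehat{\nu_\gamma}(\xi)|=O(|\xi|^{-s/2})$ as $|\xi|\to\infty$.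
   Context: Dyadic scalar cascade on $[0,1]$: for $v=(v_1,\dots,v_n)\in\{0,1\}^n$ let $a_v=\sum_{j=1}^nv_j2^{-j}$ and let $I_v=[a_v,a_v+2^{-n})$, except that $I_v=[a_v,1]$ if $v=(1,\dots,1)$, and $I_\varnothing=[0,1]$. Attach i.i.d. copies $U_v$ of $U$ to all nonempty finite binary words $v$; put $Q_v=\prod_{j=1}^nU_{v|j}$, where $v|j=(v_1,\dots,v_j)$, and $Q_\varnothing=1$. Let $d\widetilde\nu_n(t)=\sum_{|v|=n}Q_v\mathbf 1_{I_v}(t)\,dt$. Under the stated hypotheses, almost surely $\widetilde\nu_n$ converges weakly to a finite random Borel measure $\widetilde\nu$. A fixed nondegenerate $C^2$ embedded arc is a $C^2$ embedding $\gamma:[0,1]\to\mathbb R^2$ (deterministic) with $\inf_{[0,1]}|\gamma'|>0$ and $\inf_{[0,1]}|\det(\gamma',\gamma'')|>0$. For a finite Borel measure $\eta$ on $\mathbb R^2$, $\widehat\eta(\xi)=\int e^{-2\pi ix\cdot\xi}\,d\eta(x)$, $\xi\in\mathbb R^2$. *)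

(* Defs.v *)
From HB Require Import structures.
From mathcomp Require Import all_boot all_order all_algebra.
From mathcomp Require Import all_classical all_reals all_analysis.
From mathcomp Require Import complex.

Set Implicit Arguments.
Unset Strict Implicit.
Unset Printing Implicit Defensive.
Import Order.TTheory GRing.Theory Num.Theory.
Import numFieldNormedType.Exports.

Local Open Scope classical_set_scope.
Local Open Scope ring_scope.

Section probability_notions.
Context d (T : measurableType d) (R : realType) (P : probability T R).

(* Mutual independence of the subfamily of X indexed by D. *)
Definition independent_RVs (I : choiceType) (D : set I)
    (X : I -> {RV P >-> R}) : Prop :=
  forall (J : seq I) (B : I -> set R), uniq J -> [set` J] `<=` D ->
    (forall i, measurable (B i)) ->
    P (\bigcap_(i in [set` J]) (X i @^-1` B i)) =
    (\prod_(i <- J) P (X i @^-1` B i))%E.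

(* The family of weights of the cascade is indexed by all binary words, but
   only its restriction to nonempty words is constrained (or ever used). *)
Definition iid_copies d0 (T0 : measurableType d0) (P0 : probability T0 R)
    (U : {RV P0 >-> R}) (W : seq bool -> {RV P >-> R}) : Prop :=
  independent_RVs [set v | v != [::]] W /\
  forall v, v != [::] -> forall A : set R, measurable A ->
    distribution P (W v) A = distribution P0 U A.

End probability_notions.

(* Set functions are allowed, as for the integral itself. *)
Definition weak_cvg (R : realType) (mu_ : nat -> set R -> \bar R)
    (mu : set R -> \bar R) : Prop :=
  forall f : R -> R, continuous f -> (exists M, forall x, `|f x| <= M) ->
    (\int[mu_ n]_x (f x)%:E)%E @[n --> \oo] --> (\int[mu]_x (f x)%:E)%E.

Section cascade.
Variable R : realType.

Definition word_point (v : seq bool) : R :=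
  \sum_(j < size v) (nth false v j : nat)%:R / 2 ^+ j.+1.

(* For v = [::] the first branch applies and gives I_[::] = [0, 1]. *)
Definition word_itv (v : seq bool) : set R :=
  if v == nseq (size v) true then `[word_point v, 1]%classic
  else `[word_point v, word_point v + 2 ^- size v[%classic.

Context d (T : measurableType d) (P : probability T R).
Variable W : seq bool -> {RV P >-> R}.

Definition cascade_weight (v : seq bool) (w : T) : R :=
  \prod_(1 <= j < (size v).+1) W (take j v) w.

Definition cascade_density (n : nat) (w : T) (t : R) : R :=
  \sum_(v : n.-tuple bool) cascade_weight v w * \1_(word_itv v) t.

Definition cascade_measure (n : nat) (w : T) : set R -> \bar R :=
  fun A => (\int[lebesgue_measure]_(t in A) (cascade_density n w t)%:E)%E.

(* nu is a finite random Borel measure on the line. The test functions live on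
   the whole line; as every cascade_measure n w is carried by [0, 1], almost
   surely so is the weak limit. *)
Definition cascade_limit (nu : R.-ker T ~> R) : Prop :=
  (forall w, fin_num_fun (nu w)) /\
  {ae P, forall w, weak_cvg (cascade_measure ^~ w) (nu w)}.

End cascade.

Section plane.
Variable R : realType.

(* The canonical norm of R * R is the sup norm. *)
Definition enorm (x : R * R) : R := Num.sqrt (x.1 ^+ 2 + x.2 ^+ 2).

Definition dotp (x y : R * R) : R := x.1 * y.1 + x.2 * y.2.

Definition det2 (x y : R * R) : R := x.1 * y.2 - x.2 * y.1.

(* g' is the derivative of g on [0, 1], one-sided at the endpoints. *)
Definition derivative01 (g g' : R -> R * R) : Prop :=
  forall x, x \in `[0, 1] ->
    (y - x)^-1 *: (g y - g x) @[y --> within `[0, 1] x^'] --> g' x.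

(* Only the values of g on [0, 1] matter. An injective C^2 immersion of the
   compact interval [0, 1] is an embedding. *)
Definition nondegenerate_C2_arc (g : R -> R * R) : Prop :=
  {in `[0, 1] &, injective g} /\
  exists g' g'' : R -> R * R,
    [/\ derivative01 g g', derivative01 g' g'',
        {within `[0, 1], continuous g''},
        0 < inf [set enorm (g' t) | t in `[0, 1]] &
        0 < inf [set `|det2 (g' t) (g'' t)| | t in `[0, 1]]].

(* Image under g : [0, 1] -> R^2. On Borel sets this is a measure as soon as g
   is continuous on [0, 1], whatever its values outside [0, 1] are. *)
Definition arc_image (g : R -> R * R) (nu : set R -> \bar R) :
    set (R * R) -> \bar R :=
  pushforward (mrestr nu (measurable_itv `[0, 1])) g.

(* exp(-2 i pi x.xi) is integrated through its real and imaginary parts. *)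
Definition fourier (eta : set (R * R) -> \bar R) (xi : R * R) : R[i] :=
  Complex (fine (\int[eta]_x (cos (- 2 * pi * dotp x xi))%:E)%E)
          (fine (\int[eta]_x (sin (- 2 * pi * dotp x xi))%:E)%E).

Definition fourier_abs (eta : set (R * R) -> \bar R) (xi : R * R) : R :=
  complex.Re `|fourier eta xi|.

Definition fourier_sup (eta : set (R * R) -> \bar R) (n : nat) : \bar R :=
  ereal_sup [set (fourier_abs eta xi)%:E |
             xi in [set xi | 2 ^+ n <= enorm xi <= 2 ^+ n.+1]].

End plane.

(* Main.v *)
From HB Require Import structures.
Require Import Defs.
From mathcomp Require Import all_boot all_order all_algebra.
From mathcomp Require Import all_classical all_reals all_analysis.
From mathcomp Require Import complex measurable_realfun ring lra zify.
Import Order.TTheory GRing.Theory Num.Theory.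
Import numFieldNormedType.Exports.
Local Open Scope classical_set_scope.
Local Open Scope ring_scope.
Set Implicit Arguments.
Unset Strict Implicit.
Unset Printing Implicit Defensive.

(* Given the first [m] generations, a linear functional of the cell masses
   [2^-(m+1) Q_v], [|v| = m + 1], is a sum of independent variables. Cap the cell
   masses of level [m] at [2^-(m (s + 5 e))], where [10 e = min delta 1]: the moment
   hypothesis makes both the event that a cap is exceeded and the bias of the
   truncation geometrically small, and the exponential Markov inequality bounds the
   increment of the functional outside an event of probability [exp(- 2^(e m))].

   For the indicator of the descendants of a word [u] this bounds the mass of [I_u]
   by a multiple of [2^-(s |u|)]. For the cell averages of
   [cos (- 2 pi gamma . xi + theta)], [|xi| ~ 2^n], nondegeneracy provides boundedly
   many points [tau_i], depending on [xi], such that the averages over cells of length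
   [2^-m] are at most a multiple of [2^(m - n) / |t - tau_i|]. Splitting the cells
   dyadically around the [tau_i] and using the mass bound, the conditional variance of
   level [m] is at most [2^(s (m - n))] up to factors absorbed by the caps, so that the
   increments over the levels [m >= n / 2] sum to [O(2^-(s n / 2))], and level [n / 2]
   itself is bounded by its largest cell. A union bound over a net of mesh [4^-n] of
   the annulus, the Lipschitz continuity of the Fourier transform and the passage to
   the weak limit conclude. *)

(** * Exponential bounds for independent weights *)

(** Only an [r]-th moment is available, with [r] possibly close to 1, so two kinds of failure are
    kept apart. Exceeding a cap has merely geometrically small probability, while the fluctuation of
    a truncated sum has a tail [exp(- 2^(e m))] that survives union bounds over [2^m] words or about
    [2^(12 m)] frequencies. Of the margin [10 e] in the moment hypothesis, half makes the cap events
    rare and half is built into the caps, where it pays for the losses: the deviation parameter, the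
    number of dyadic layers, the constant of the mass bound and the summation over levels.

    The mass bound closes on itself because an indicator equals its square: the variance of the mass
    of [I_u] is governed by that mass. For the failure probability to be geometric in [n], the caps
    can be imposed only from a level [k] proportional to [n]. This costs a factor [4^k] in the mass
    bound, and [k] is taken to be so small a fraction of [n / 2] that the decay [2^(- e n / 2)]
    absorbs it.

    All estimates off the exceptional event are deterministic, with constants chosen before the
    probability space. *)

Section independence.
Context d (T : measurableType d) (R : realType) (P : probability T R).
Context (I : choiceType) (D : set I) (W : I -> {RV P >-> R}).
Hypothesis indW : independent_RVs D W.

(** A pi-system generating the sigma-algebra of the variables indexed by [J]. The type [sigma_of J]
    is [T] with this smaller sigma-algebra, so a measurable function on it is one that depends on
    these variables only. *)
Definition cylinders (J : seq I) : set (set T) :=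
  [set A | exists2 B : I -> set R, (forall i, measurable (B i)) &
           A = \bigcap_(i in [set` J]) (W i @^-1` B i)].

Local Notation sigma_of J := (g_sigma_algebraType (cylinders J)).

Lemma measurable_RV_preimage (X : {RV P >-> R}) (B : set R) :
  measurable B -> measurable (X @^-1` B).
Proof. by move=> mB; rewrite -[_ @^-1` _]setTI; exact: measurable_funP. Qed.

Lemma measurable_cylinders J : cylinders J `<=` measurable.
Proof.
move=> _ [B mB ->]; apply: fin_bigcap_measurable => [|i _]; first exact: finite_seq.
exact: measurable_RV_preimage.
Qed.

Lemma setI_closed_cylinders J : setI_closed (cylinders J).
Proof.
move=> _ _ [B mB ->] [C mC ->]; exists (fun i => B i `&` C i).
  by move=> i; exact: measurableI.
by rewrite -bigcapI; apply: eq_bigcapr => i _; rewrite preimage_setI.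
Qed.

Lemma sigma_of_measurable J (A : set T) :
  <<s cylinders J >> A -> measurable A.
Proof.
by apply: smallest_sub; [exact: sigma_algebra_measurable|exact: measurable_cylinders].
Qed.

Lemma measurable_sigma_of J i : i \in J ->
  measurable_fun [set: sigma_of J] (W i : sigma_of J -> R).
Proof.
move=> iJ _ B mB; rewrite setTI; apply: sub_sigma_algebra.
exists (fun j => if j == i then B else setT) => [j|]; first by case: ifP.
apply/seteqP; split => [x /= Bx j _ /=|x /(_ i iJ)/=]; last by rewrite eqxx.
by case: eqP => // ->.
Qed.

Lemma cylinders_indep J v (A : set T) (C : set R) :
  uniq (v :: J) -> [set` v :: J] `<=` D -> cylinders J A -> measurable C ->
  P (A `&` W v @^-1` C) = (P A * P (W v @^-1` C))%E.
Proof.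
move=> uvJ JD [B mB ->] mC; have /=/andP[vJ uJ] := uvJ.
(* The constraint on [v] is merged into the family on [J]; as [v] is not in [J], nothing is
   overwritten. *)
pose B' i := if i == v then C else B i.
have B'J i : i \in J -> B' i = B i.
  by rewrite /B'; case: eqP => // -> iJ; rewrite iJ in vJ.
have := @indW (v :: J) B' uvJ JD.
have B'v : B' v = C by rewrite /B' eqxx.
rewrite big_cons bigcap_seq big_cons B'v -bigcap_seq => H.
have EB : \bigcap_(i in [set` J]) W i @^-1` B' i =
          \bigcap_(i in [set` J]) W i @^-1` B i.
  by apply: eq_bigcapr => i /= /B'J ->.
rewrite setIC -EB H; last by move=> i; rewrite /B'; case: ifP.
rewrite muleC; congr (_ * _)%E; rewrite EB indW //; last first.
  by move=> i iJ; apply: JD; rewrite /= inE iJ orbT.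
by rewrite [RHS]big_seq big_seq; apply: eq_bigr => i /B'J ->.
Qed.

(** For fixed [C] both sides are finite measures in [A], a restriction of [P] and a multiple of [P],
    and they agree on the pi-system of cylinders. *)
Lemma sigma_of_indep J v (A : set T) (C : set R) :
  uniq (v :: J) -> [set` v :: J] `<=` D -> <<s cylinders J >> A ->
  measurable C -> P (A `&` W v @^-1` C) = (P A * P (W v @^-1` C))%E.
Proof.
move=> uvJ JD sA mC; have mE := measurable_RV_preimage (W v) mC.
have fE : P (W v @^-1` C) \is a fin_num by rewrite fin_num_measure.
have E0 : 0 <= fine (P (W v @^-1` C)) by rewrite fine_ge0.
have scE X : mscale (NngNum E0) P X = (P (W v @^-1` C) * P X)%E.
  by rewrite /mscale/= fineK.
rewrite muleC -scE; apply: (@g_sigma_algebra_measure_unique _ _ _ (cylinders J)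
  (@measurable_cylinders J) (fun=> setT) _ _ (mrestr P mE)
  (mscale (NngNum E0) P) (@setI_closed_cylinders J)) => //.
- by move=> _; exists (fun=> setT) => //; apply/seteqP; split => // x _ i _.
- by apply/seteqP; split => // x _; exists 0%N.
- move=> X cX; apply: etrans (esym (scE X)); rewrite muleC.
  exact: (cylinders_indep uvJ JD cX mC).
- by move=> _; rewrite /= /mrestr setTI ltey_eq fin_num_measure.
Qed.

Section step.
Variables (J : seq I) (v : I).
Hypotheses (uvJ : uniq (v :: J)) (JD : [set` v :: J] `<=` D).

Lemma measurable_to_sigma_of : measurable_fun [set: T] (idfun : T -> sigma_of J).
Proof. by move=> _ A mA; rewrite setTI; exact: sigma_of_measurable mA. Qed.

Let idJ : {mfun T >-> sigma_of J} :=
  HB.pack (idfun : T -> sigma_of J)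
    (isMeasurableFun.Build _ _ _ _ _ measurable_to_sigma_of).

Let PJ : probability (sigma_of J) R := distribution P idJ.

Let pairJ (w : T) : sigma_of J * R := (idJ w, W v w).

Let mpairJ : measurable_fun [set: T] pairJ.
Proof. by apply/measurable_fun_pair; apply/measurable_funP. Qed.

Let pairJf : {mfun T >-> (sigma_of J * R)%type} :=
  HB.pack pairJ (isMeasurableFun.Build _ _ _ _ _ mpairJ).

Local Open Scope ereal_scope.

(** The joint law of the past (the identity into [sigma_of J]) and of [W v] is a product, by
    [sigma_of_indep] and uniqueness of product measures; Tonelli then integrates [W v] first. *)
Lemma integral_indep (f : (sigma_of J * R)%type -> \bar R) :
  measurable_fun setT f -> (forall z, 0 <= f z) ->
  \int[P]_w f (w, W v w) = \int[P]_w \int[distribution P (W v)]_y f (w, y).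
Proof.
move=> mf f0.
have := @fubini_tonelli1 _ _ _ _ _ PJ (distribution P (W v)) f mf f0.
rewrite (ge0_integral_distribution idJ)/=; last 2 first.
- exact: measurable_fun_fubini_tonelli_F.
- by move=> y; exact: integral_ge0.
rewrite /fubini_F /= => <-.
rewrite -[LHS](ge0_integral_distribution pairJf)//.
apply: eq_measure_integral => A mA _; symmetry.
apply: (product_measure_unique (m' := distribution P pairJf)) => // B C mB mC.
exact: (sigma_of_indep uvJ JD mB mC).
Qed.

(** This stands in for conditioning on the past: a factor whose integral over the new weight is at
    most [k], whatever the past, can be traded for [k]. *)
Lemma integral_indep_le (k : R) (h : sigma_of J -> \bar R)
    (f : (sigma_of J * R)%type -> \bar R) : (0 <= k)%R ->
  measurable_fun [set: sigma_of J] h -> (forall z, 0 <= h z) ->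
  measurable_fun setT f -> (forall z, 0 <= f z) ->
  (forall w, \int[distribution P (W v)]_y f (w, y) <= k%:E) ->
  \int[P]_w (h w * f (w, W v w)) <= k%:E * \int[P]_w h w.
Proof.
move=> k0 mh h0 mf f0 fk.
have mh' : measurable_fun [set: T] (h : T -> \bar R).
  exact: (measurableT_comp mh measurable_to_sigma_of).
rewrite (integral_indep (f := fun z => h z.1 * f z)); last 2 first.
- by apply: emeasurable_funM => //; exact: measurableT_comp.
- by move=> z; exact: mule_ge0.
rewrite -ge0_integralZl//.
have mF : measurable_fun [set: sigma_of J]
    (fun w => \int[distribution P (W v)]_y f (w, y)).
  exact: (@measurable_fun_fubini_tonelli_F _ _ _ _ _ (distribution P (W v)) f mf f0).
apply: ge0_le_integral => //.
- by move=> w _; apply: integral_ge0 => y _; exact: mule_ge0.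
- apply: (measurableT_comp _ measurable_to_sigma_of (f := fun w : sigma_of J =>
    \int[distribution P (W v)]_y (h w * f (w, y)))).
  apply: (@measurable_fun_fubini_tonelli_F _ _ _ _ _ (distribution P (W v))
    (fun z => h z.1 * f z)).
  + by apply: emeasurable_funM => //; exact: measurableT_comp.
  + by move=> z; exact: mule_ge0.
- by apply: emeasurable_funM.
move=> w _ /=; rewrite (ge0_integralZl _ measurableT (f := fun y => f (w, y)))//.
- by rewrite muleC lee_wpmul2r.
exact: measurable_fun_pair2 mf.
Qed.

End step.

End independence.

(** * Binary words of a given length *)

Section words.

(** The newest letter comes last, so the children of [v] are [rcons v b] and its ancestors are the
    prefixes [take j v]. *)
Fixpoint words (m : nat) : seq (seq bool) :=
  if m is m'.+1 then [seq rcons v b | v <- words m', b <- [:: false; true]]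
  else [:: [::]].

Lemma wordsS m :
  words m.+1 = [seq rcons v b | v <- words m, b <- [:: false; true]].
Proof. by []. Qed.

Lemma mem_words m v : (v \in words m) = (size v == m).
Proof.
elim: m v => [|m IH] v; [by rewrite inE size_eq0|rewrite wordsS].
apply/allpairsPdep/eqP => [[u [b [+ _ ->]]]|].
  by rewrite IH size_rcons => /eqP ->.
case/lastP: v => // v b; rewrite size_rcons => -[sv]; exists v, b.
by rewrite IH sv eqxx; split=> //; case: b.
Qed.

Lemma size_word m v : v \in words m -> size v = m.
Proof. by rewrite mem_words => /eqP. Qed.

Lemma uniq_words m : uniq (words m).
Proof.
elim: m => // m IH; rewrite wordsS; apply: allpairs_uniq => //.
by move=> [u b] [v c] _ _ /= /rcons_inj[-> ->].
Qed.

Lemma size_words m : size (words m) = (2 ^ m)%N.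
Proof. by elim: m => // m IH; rewrite wordsS size_allpairs IH expnS mulnC. Qed.

Lemma sum_words_S (V : nmodType) m (F : seq bool -> V) :
  \sum_(v <- words m.+1) F v =
  \sum_(v <- words m) (F (rcons v false) + F (rcons v true)).
Proof.
rewrite wordsS big_allpairs_dep; apply: eq_bigr => v _.
by rewrite big_cons big_seq1.
Qed.

Lemma sum_words_tuple (V : nmodType) m (F : seq bool -> V) :
  \sum_(v : m.-tuple bool) F v = \sum_(v <- words m) F v.
Proof.
rewrite -(big_map (@tval m bool) xpredT); apply: perm_big.
apply: uniq_perm => [||v]; last rewrite mem_words.
- by rewrite map_inj_uniq ?index_enum_uniq//; exact: val_inj.
- exact: uniq_words.
apply/mapP/idP => [[t _ ->]|sv]; first by rewrite size_tuple.
by exists (Tuple sv); rewrite ?mem_index_enum.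
Qed.

End words.

(** * Exponential moment of one truncated weight *)

Section exponential_moment.
Context (R : realType).
Implicit Types (c l M r q u x : R).

(** Since [expR (- x) >= 1 - x], it suffices that [(1 + x + 2 x^2) (1 - x) = 1 + x^2 (1 - 2 x)] be
    at least 1, which is where [x <= 1/2] enters. *)
Lemma expR_le_quadratic x : x <= 2^-1 -> expR x <= 1 + x + 2 * x ^+ 2.
Proof.
move=> x2; have x1 : 0 < 1 - x by lra.
have h : 1 - x <= expR (- x) by rewrite expR_ge1Dx.
rewrite -(ler_pM2r (expR_gt0 (- x))) expRxMexpNx_1.
apply: (@le_trans _ _ ((1 + x + 2 * x ^+ 2) * (1 - x))); last first.
  rewrite ler_wpM2l//; nra.
have -> : (1 + x + 2 * x ^+ 2) * (1 - x) = 1 + x ^+ 2 * (1 - 2 * x) by ring.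
rewrite lerDl mulr_ge0 ?sqr_ge0//; lra.
Qed.

(** Values above [M] are sent to 0 and not to [M], so that the exponential of the truncated variable
    is 1 there. *)
Definition trunc M x : R := if x <= M then x else 0.

(** With [z = q u]: below the cap the quadratic bound applies and [z^2 <= M z]; above it the left
    side is 1, and the last term outweighs a negative [c z] because [z <= z^r M^(1-r)]. The right
    side involves only [u] and [u^r], whose means are known. *)
Lemma expR_trunc_le c l M r q u : `|c| <= 1 -> 0 < l -> 0 < M -> l * M <= 2^-1 ->
  1 < r -> 0 <= q -> 0 <= u ->
  expR (l * c * trunc M (q * u)) <=
  1 + (l * c * q + 2 * l ^+ 2 * c ^+ 2 * M * q) * u +
  l * q `^ r * M `^ (1 - r) * u `^ r.
Proof.
move=> c1 l0 M0 lM r1 q0 u0.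
have z0 : 0 <= q * u by rewrite mulr_ge0.
have -> : l * q `^ r * M `^ (1 - r) * u `^ r = l * ((q * u) `^ r * M `^ (1 - r)).
  by rewrite powRM//; ring.
have -> : (l * c * q + 2 * l ^+ 2 * c ^+ 2 * M * q) * u =
   l * c * (q * u) + 2 * l ^+ 2 * c ^+ 2 * M * (q * u) by ring.
set z := q * u in z0 *; rewrite /trunc; case: ifPn => [zM|].
- apply: (@le_trans _ _ (1 + l * c * z + 2 * (l * c * z) ^+ 2)).
    apply: expR_le_quadratic; apply: (le_trans _ lM); rewrite -mulrA ler_wpM2l ?(ltW l0)//.
    apply: (le_trans _ zM); apply: (@le_trans _ _ (`|c| * z)).
      by rewrite ler_wpM2r// ler_norm.
    by rewrite ler_piMl.
  have : 0 <= l * (z `^ r * M `^ (1 - r)) by rewrite !mulr_ge0 ?powR_ge0// ltW.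
  have : 0 <= 2 * l ^+ 2 * c ^+ 2 * z * (M - z).
    by rewrite mulr_ge0 ?subr_ge0// mulr_ge0// mulr_ge0 ?sqr_ge0// mulr_ge0 ?sqr_ge0.
  rewrite (_ : 2 * l ^+ 2 * c ^+ 2 * z * (M - z) =
    2 * l ^+ 2 * c ^+ 2 * M * z - 2 * (l * c * z) ^+ 2); last by ring.
  lra.
rewrite -ltNge => Mz; rewrite mulr0 expR0 -addrA lerDl.
have zz : z <= z `^ r * M `^ (1 - r).
  have zp : 0 < z by apply: lt_trans Mz.
  rewrite -(@mulr_powRB1 _ z r) ?(ltW zp)//; last by rewrite (lt_trans _ r1).
  rewrite -mulrA ler_peMr// -(opprB r 1) powRN ler_pdivlMr ?powR_gt0// mul1r.
  by rewrite ge0_ler_powR ?nnegrE ?subr_ge0 ?(ltW r1) ?(ltW M0) ?(ltW zp) ?(ltW Mz).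
have : - z <= c * z.
  have : - 1 <= c by have := ler_norm (- c); rewrite normrN; lra.
  by move=> cm; rewrite -mulN1r ler_wpM2r.
move=> cz; set B := z `^ r * _ in zz *.
have : 0 <= 2 * l ^+ 2 * c ^+ 2 * M * z.
  by rewrite mulr_ge0// mulr_ge0 ?(ltW M0)// mulr_ge0 ?sqr_ge0// mulr_ge0 ?sqr_ge0.
have : 0 <= l * (c * z + B) by rewrite mulr_ge0 ?(ltW l0)//; lra.
rewrite mulrDr mulrA; lra.
Qed.

End exponential_moment.

(** * Cell masses and their exponential bound over one generation *)

Section weights.
Context (R : realType).
Implicit Types (x : seq bool -> R) (v : seq bool).

(** The positive parts make the masses nonnegative at every sample point. The weights have the law
    of [U >= 0], so almost surely this is the cascade weight [Q_v]. *)
Definition weightp x v : R :=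
  \prod_(1 <= j < (size v).+1) Num.max (x (take j v)) 0.

Lemma weightp_ge0 x v : 0 <= weightp x v.
Proof. by apply: prodr_ge0 => j _; rewrite le_max lexx orbT. Qed.

Lemma weightp_rcons x v b :
  weightp x (rcons v b) = weightp x v * Num.max (x (rcons v b)) 0.
Proof.
rewrite /weightp size_rcons big_nat_recr//= [take _.+1 _]take_oversize ?size_rcons//.
congr (_ * _); apply: eq_big_nat => j /andP[_ jv].
by rewrite -cats1 takel_cat.
Qed.

Definition cellw x v : R := 2^-1 ^+ size v * weightp x v.

Lemma cellw_ge0 x v : 0 <= cellw x v.
Proof. by rewrite mulr_ge0 ?weightp_ge0 ?exprn_ge0. Qed.

(** The conditional mean of [cellw x v] given the earlier generations: the last weight is replaced
    by its mean 1. *)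
Definition parentw x v : R :=
  2^-1 ^+ size v * weightp x (take (size v).-1 v).

Lemma parentw_ge0 x v : 0 <= parentw x v.
Proof. by rewrite mulr_ge0 ?weightp_ge0 ?exprn_ge0. Qed.

Lemma take_rcons v b : take (size v) (rcons v b) = v.
Proof. by rewrite -cats1 take_size_cat. Qed.

Lemma parentw_rcons x v b : parentw x (rcons v b) = 2^-1 * cellw x v.
Proof. by rewrite /parentw /cellw size_rcons/= take_rcons exprS mulrA. Qed.

Lemma cellw_rcons x v b :
  cellw x (rcons v b) = parentw x (rcons v b) * Num.max (x (rcons v b)) 0.
Proof.
by rewrite parentw_rcons /cellw size_rcons weightp_rcons exprS !mulrA.
Qed.

End weights.

Section one_weight.
Context (R : realType) (mu : probability R R) (r mur : R).
Hypothesis r1 : 1 < r.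
Hypothesis mu1 : (\int[mu]_y (Num.max y 0)%:E = 1)%E.
Hypothesis mu_r : (\int[mu]_y ((Num.max y 0) `^ r)%:E = mur%:E)%E.

(** The subtracted constant [K] collects the mean [l c q], a bound for the truncation bias and the
    second-order term. The expectation of the exponential before subtraction is at most
    [1 + K <= expR K], so the tilt has integral at most 1. *)
Definition tilt (c l M q y : R) : R :=
  expR (l * c * trunc M (q * Num.max y 0) -
        (l * c * q + l * (q `^ r * M `^ (1 - r) * mur)
         + 2 * l ^+ 2 * c ^+ 2 * M * q)).

Lemma measurable_max0 : measurable_fun setT (fun y : R => Num.max y 0).
Proof. exact: measurable_maxr. Qed.

Lemma measurable_trunc (M : R) : measurable_fun setT (@trunc R M).
Proof.
by apply: measurable_fun_ifT => //; apply: measurable_fun_ler.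
Qed.

Lemma max0_ge0 (y : R) : (0 <= Num.max y 0)%R.
Proof. by rewrite le_max lexx orbT. Qed.

Lemma mur_ge0 : (0 <= mur)%R.
Proof.
by rewrite -lee_fin -mu_r; apply: integral_ge0 => y _; rewrite lee_fin powR_ge0.
Qed.

Lemma integral_tilt_le (c l M q : R) : (`|c| <= 1)%R -> (0 < l)%R -> (0 < M)%R ->
  (l * M <= 2^-1)%R -> (0 <= q)%R -> (\int[mu]_y (tilt c l M q y)%:E <= 1)%E.
Proof.
move=> c1 l0 M0 lM q0.
set K := (l * c * q + l * (q `^ r * M `^ (1 - r) * mur)
         + 2 * l ^+ 2 * c ^+ 2 * M * q)%R.
set a := (l * c * q + 2 * l ^+ 2 * c ^+ 2 * M * q)%R.
set b := (l * q `^ r * M `^ (1 - r))%R.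
pose g (y : R) := (1 + a * Num.max y 0 + b * (Num.max y 0) `^ r)%R.
have mm := measurable_max0.
have mmr : measurable_fun setT (fun y : R => Num.max y 0 `^ r)%R.
  exact: measurableT_comp (measurable_powR r) mm.
have i1 : mu.-integrable setT (fun y => (Num.max y 0)%:E).
  apply/integrableP; split; first exact/measurable_EFinP.
  under eq_integral => y _ do rewrite gee0_abs ?lee_fin ?max0_ge0//.
  by rewrite mu1 ltry.
have ir : mu.-integrable setT (fun y => (Num.max y 0 `^ r)%:E).
  apply/integrableP; split; first exact/measurable_EFinP.
  under eq_integral => y _ do rewrite gee0_abs ?lee_fin ?powR_ge0//.
  by rewrite mu_r ltry.
have ic : mu.-integrable setT (fun _ => 1%:E : \bar R).
  by apply: finite_measure_integrable_cst.
have ig : (\int[mu]_y (g y)%:E = (1 + K)%:E)%E.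
  rewrite /g; under eq_integral => y _ do rewrite !EFinD !EFinM.
  rewrite integralD//=; last 2 first.
  - by apply: integrableD => //; apply: integrableZl.
  - exact: integrableZl.
  rewrite integralD//; last exact: integrableZl.
  rewrite !integralZl// mu1 mu_r integral_cst//.
  rewrite [X in (1 * X)%E](_ : _ = 1%E) ?mule1; last exact: probability_setT.
  by rewrite -!EFinM -!EFinD; congr EFin; rewrite /K /a /b; ring.
have -> : (\int[mu]_y (tilt c l M q y)%:E =
    \int[mu]_y ((expR (- K))%:E * (expR (l * c * trunc M (q * Num.max y 0)))%:E))%E.
  by apply: eq_integral => y _; rewrite /tilt -/K -EFinM -expRD addrC.
have me : measurable_fun [set: R] (fun y : R => (expR (l * c * trunc M (q * Num.max y 0)))%:E).
  apply/measurable_EFinP; apply: measurableT_comp => //.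
  apply: measurable_funM => //; apply: (measurableT_comp (measurable_trunc M)).
  exact: measurable_funM.
rewrite ge0_integralZl ?lee_fin ?expR_ge0//.
apply: (@le_trans _ _ ((expR (- K))%:E * (1 + K)%:E)%E).
  rewrite lee_wpmul2l ?lee_fin ?expR_ge0// -ig.
  apply: ge0_le_integral => //.
  - apply/measurable_EFinP; apply: measurable_funD; last exact: measurable_funM.
    by apply: measurable_funD => //; exact: measurable_funM.
  - by move=> y _; rewrite lee_fin; apply: expR_trunc_le => //; exact: max0_ge0.
rewrite -EFinM lee_fin mulrC -[leRHS](expRxMexpNx_1 K).
by rewrite ler_wpM2r ?expR_ge0 ?expR_ge1Dx.
Qed.

End one_weight.

Section below.

(** Nonempty words only, since the root carries no weight; [undup] provides uniqueness for free. *)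
Definition below (m : nat) : seq (seq bool) :=
  undup (flatten [seq words i | i <- iota 1 m]).

Lemma mem_below m v : (v \in below m) = (0 < size v <= m)%N.
Proof.
rewrite mem_undup; apply/flatten_mapP/idP => [[k]|/andP[v0 vm]].
  by rewrite mem_iota add1n ltnS => km; rewrite mem_words => /eqP ->.
by exists (size v); rewrite ?mem_words// mem_iota add1n ltnS v0.
Qed.

End below.

Lemma measurable_gt_set d (T : measurableType d) (R : realType) (a : R)
    (h : T -> R) : measurable_fun [set: T] h -> measurable [set w | a < h w].
Proof.
move=> /(_ measurableT _ (measurable_itv `]a, +oo[)); rewrite setTI.
by congr measurable; apply/seteqP; split => w /=; rewrite in_itv/= andbT.
Qed.

Lemma markov_real d (T : measurableType d) (R : realType) (P : probability T R)
    (h : T -> R) (k a : R) : measurable_fun [set: T] h -> (forall w, 0 <= h w) ->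
  (\int[P]_w (h w)%:E <= k%:E)%E -> 0 < a ->
  (P [set w | (a < h w)%R] <= (k / a)%:E)%E.
Proof.
move=> mh h0 hk a0.
have mA := measurable_gt_set a mh.
rewrite EFinM lee_pdivlMr// muleC -[P _]/(P _) -[X in P X]setIT.
rewrite -integral_indic// -ge0_integralZl//; last 2 first.
- exact/measurable_EFinP/measurable_indic.
- by rewrite lee_fin ltW.
apply: le_trans hk; apply: ge0_le_integral => //.
- by move=> w _; rewrite -EFinM lee_fin mulr_ge0// ltW.
- by apply: measurable_funeM; exact/measurable_EFinP/measurable_indic.
- exact/measurable_EFinP.
move=> w _; rewrite -EFinM lee_fin indicE.
by case: (boolP (_ \in _)) => [/set_mem/ltW|_]; rewrite ?mulr1 ?mulr0.
Qed.

Section cascade_probability.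
Context d (T : measurableType d) (R : realType) (P : probability T R).
Context (W : seq bool -> {RV P >-> R}) (r mur : R).
Hypothesis indW : independent_RVs [set v | v != [::]] W.
Hypothesis r1 : 1 < r.
Hypothesis law1 : forall v, v != [::] ->
  (\int[distribution P (W v)]_y (Num.max y 0)%:E = 1)%E.
Hypothesis lawr : forall v, v != [::] ->
  (\int[distribution P (W v)]_y (Num.max y 0 `^ r)%:E = mur%:E)%E.

Notation X w := (fun v : seq bool => W v w).
Notation sigma_of J := (g_sigma_algebraType (cylinders W J)).

Lemma measurable_weightp_sigma J v :
  (forall j, (0 < j <= size v)%N -> take j v \in J) ->
  measurable_fun [set: sigma_of J] (fun w : sigma_of J => weightp (X w) v).
Proof.
move=> vJ; apply: measurable_prod => j; rewrite mem_index_iota ltnS => jv.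
apply: measurable_maxr => //.
by apply: measurable_sigma_of; exact: vJ.
Qed.

Lemma measurable_weightp v :
  measurable_fun [set: T] (fun w => weightp (X w) v).
Proof.
apply: measurable_prod => j _.
apply: measurable_maxr => //; exact/measurable_funP.
Qed.

Lemma measurable_cellw v : measurable_fun [set: T] (fun w => cellw (X w) v).
Proof. by apply: measurable_funM => //; exact: measurable_weightp. Qed.

Lemma measurable_parentw v : measurable_fun [set: T] (fun w => parentw (X w) v).
Proof. by apply: measurable_funM => //; exact: measurable_weightp. Qed.

Lemma measurable_tilt2 c l M d' (S : measurableType d') (q y : S -> R) :
  measurable_fun setT q -> measurable_fun setT y ->
  measurable_fun setT (fun z => tilt r mur c l M (q z) (y z)).
Proof.
move=> mq my; apply: measurableT_comp => //; apply: measurable_funB.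
  apply: measurable_funM => //; apply: (measurableT_comp (measurable_trunc M)).
  by apply: measurable_funM => //; exact: measurable_maxr.
apply: measurable_funD; last exact: measurable_funM.
apply: measurable_funD; first exact: measurable_funM.
apply: measurable_funM => //; apply: measurable_funM => //.
by apply: measurable_funM => //; exact: (measurableT_comp (measurable_powR r)).
Qed.

Lemma take_word_size m v j : v \in words m -> (0 < j <= m)%N ->
  size (take j v) = j.
Proof. by move/size_word => sv /andP[_ jm]; rewrite size_takel// sv. Qed.

(** The words of the generation are peeled off one at a time. The parent mass of [v] depends on
    earlier generations only, so its factor involves the new weight [W v] alone, and
    [integral_tilt_le] bounds its integral by 1 for every past. *)
Lemma integral_prod_tilt_le m (c : seq bool -> R) l M vs :
  (forall v, `|c v| <= 1) -> 0 < l -> 0 < M -> l * M <= 2^-1 ->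
  uniq vs -> {subset vs <= words m.+1} ->
  (\int[P]_w (\prod_(v <- vs)
     tilt r mur (c v) l M (parentw (X w) v) (W v w))%:E <= 1)%E.
Proof.
move=> c1 l0 M0 lM; elim: vs => [_ _|v vs IH /= /andP[vvs uvs] vsm].
  under eq_integral do rewrite big_nil.
  by rewrite integral_cst// mul1e probability_le1.
have vm : v \in words m.+1 by apply: vsm; rewrite inE eqxx.
have vsm' : {subset vs <= words m.+1}.
  by move=> u uvs'; apply: vsm; rewrite inE uvs' orbT.
(* The past of [v]: all earlier generations and the words of its own generation still in the
   product. The filter makes the list duplicate-free without further argument. *)
pose J := [seq u <- below m | u \notin vs] ++ vs.
have subJ u : u \in J = (u \in below m) || (u \in vs).
  by rewrite mem_cat mem_filter; case: (u \in vs); rewrite ?orbT ?orbF.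
have sizeJ u : u \in below m -> u \notin words m.+1.
  by rewrite mem_below mem_words => /andP[_ um]; rewrite ltn_eqF.
have uJ : uniq (v :: J).
  rewrite /= subJ negb_or vvs andbT; apply/andP; split.
    by apply: contraL vm => /sizeJ.
  rewrite cat_uniq filter_uniq ?undup_uniq//= uvs andbT.
  by apply/hasPn => u uvs' /=; rewrite mem_filter uvs'.
have JD : [set` v :: J] `<=` [set v | v != [::]].
  move=> u /=; rewrite inE subJ => /or3P[/eqP ->||/vsm']; last first.
  - by rewrite mem_words; case: u.
  - by rewrite mem_below => /andP[]; case: u.
  - by move: vm; rewrite mem_words; case: (v).
have mpar u : u \in words m.+1 ->
    measurable_fun [set: sigma_of J] (fun w : sigma_of J => parentw (X w) u).
  move=> um; apply: measurable_funM => //; apply: measurable_weightp_sigma.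
  have su := size_word um; rewrite su/= size_take su ltnSn => j jm.
  rewrite take_takel; last by case/andP: jm.
  rewrite subJ mem_below (take_word_size um); last first.
    by case/andP: jm => -> /leqW.
  by rewrite jm.
under eq_integral => w _ do rewrite big_cons mulrC EFinM.
apply: le_trans (IH uvs vsm'); rewrite -[leRHS]mul1e.
pose h (w : sigma_of J) := (\prod_(v <- vs)
     tilt r mur (c v) l M (parentw (X w) v) (W v w))%:E.
pose f (z : sigma_of J * R) := (tilt r mur (c v) l M (parentw (X z.1) v) z.2)%:E.
apply: (integral_indep_le indW uJ JD (h := h) (f := f)) => //.
- apply/measurable_EFinP; apply: measurable_prod => u uvs'.
  apply: measurable_tilt2; first by apply: mpar; exact: vsm'.
  by apply: measurable_sigma_of; rewrite subJ uvs' orbT.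
- by move=> z; rewrite lee_fin; apply: prodr_ge0 => u _; exact: expR_ge0.
- apply/measurable_EFinP; apply: measurable_tilt2 => //.
  exact: (measurableT_comp (mpar v vm)).
- by move=> z; rewrite lee_fin expR_ge0.
- move=> w; have v0 : v != [::] by apply: JD; rewrite /= inE eqxx.
  exact: (integral_tilt_le (mu := distribution P (W v)) r1 (law1 v0) (lawr v0)
    (c1 v) l0 M0 lM (parentw_ge0 (X w) v)).
Qed.

End cascade_probability.

Lemma exprV2_powR (R : realType) n (p : R) :
  (2^-1 ^+ n) `^ p = (2 `^ (- p)) ^+ n.
Proof.
have -> : 2^-1 ^+ n = 2 `^ (- n%:R) :> R by rewrite powR_invn// exprVn.
by rewrite -powRrM -(powR_mulrn n (powR_ge0 _ _)) -powRrM mulNr mulrC mulNr.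
Qed.

(** * Increments between consecutive levels and their tails *)

Section increments.
Context (R : realType) (r mur : R).
Implicit Types (x c : seq bool -> R) (M : R).

(** The truncated masses are compensated by the untruncated means, so that as long as no cap is
    exceeded this is exactly the change of the linear functional from level [m] to level [m + 1]. *)
Definition increment M c x m : R :=
  \sum_(v <- words m.+1) c v * (trunc M (cellw x v) - parentw x v).

Definition biasw M x m : R :=
  \sum_(v <- words m.+1) parentw x v `^ r * M `^ (1 - r) * mur.

(** Multiplied by [M] it dominates the conditional second moments of the truncated terms, as
    [z^2 <= M z] below the cap. *)
Definition qvar c x m : R := \sum_(v <- words m.+1) c v ^+ 2 * parentw x v.

Definition moment x m : R := \sum_(v <- words m) cellw x v `^ r.

Lemma cellwE x v : v != [::] ->
  cellw x v = parentw x v * Num.max (x v) 0.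
Proof. by case/lastP: v => // v b _; exact: cellw_rcons. Qed.

Lemma word_neq0 m v : v \in words m.+1 -> v != [::].
Proof. by rewrite mem_words; case: v. Qed.

Lemma prod_tiltE M c x m l :
  \prod_(v <- words m.+1) tilt r mur (c v) l M (parentw x v) (x v) =
  expR (l * increment M c x m - l * biasw M x m - 2 * l ^+ 2 * M * qvar c x m).
Proof.
rewrite -expR_sum /increment /biasw /qvar !mulr_sumr -!sumrB; congr expR.
rewrite big_seq [RHS]big_seq; apply: eq_bigr => v /word_neq0 v0.
by rewrite (cellwE _ v0); ring.
Qed.

(** Each cell has two children whose parent mass is half its own mass, whence the factor
    [2 * 2^-r = 2^(1-r)]. *)
Lemma biaswE M x m :
  biasw M x m = M `^ (1 - r) * (2 `^ (1 - r) * mur) * moment x m.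
Proof.
rewrite /biasw /moment sum_words_S mulr_sumr; apply: eq_bigr => v _.
rewrite !parentw_rcons powRM ?cellw_ge0// (@powRD _ 2) ?pnatr_eq0 ?implybT//.
rewrite powRr1// -[2^-1](@powR_inv1 _ 2)// -powRrM mulN1r.
by ring.
Qed.

End increments.

Section cascade_tails.
Context d (T : measurableType d) (R : realType) (P : probability T R).
Context (W : seq bool -> {RV P >-> R}) (r mur : R).
Hypothesis indW : independent_RVs [set v | v != [::]] W.
Hypothesis r1 : 1 < r.
Hypothesis law1 : forall v, v != [::] ->
  (\int[distribution P (W v)]_y (Num.max y 0)%:E = 1)%E.
Hypothesis lawr : forall v, v != [::] ->
  (\int[distribution P (W v)]_y (Num.max y 0 `^ r)%:E = mur%:E)%E.

Notation X w := (fun v : seq bool => W v w).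
Notation sigma_of J := (g_sigma_algebraType (cylinders W J)).

Lemma measurable_increment M c m :
  measurable_fun [set: T] (fun w => increment M c (X w) m).
Proof.
apply: measurable_sum => v; apply: measurable_funM => //.
apply: measurable_funB; last exact: measurable_parentw.
exact: measurableT_comp (measurable_trunc M) (measurable_cellw W v).
Qed.

Lemma measurable_moment m : measurable_fun [set: T] (fun w => moment r (X w) m).
Proof.
apply: measurable_sum => v.
exact: measurableT_comp (measurable_powR r) (measurable_cellw W v).
Qed.

Lemma measurable_biasw M m :
  measurable_fun [set: T] (fun w => biasw r mur M (X w) m).
Proof.
under eq_fun do rewrite biaswE.
by apply: measurable_funM => //; exact: measurable_moment.
Qed.

Lemma measurable_qvar c m : measurable_fun [set: T] (fun w => qvar c (X w) m).
Proof.
apply: measurable_sum => v; apply: measurable_funM => //.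
exact: measurable_parentw.
Qed.

(** Markov's inequality for the product of the tilts at level [expR t], with the exponent divided by
    [l]. The bias and the variance remain random inside the event; they are estimated later, where
    the caps hold. *)
Lemma increment_tail m (c : seq bool -> R) l M t :
  (forall v, `|c v| <= 1) -> 0 < l -> 0 < M -> l * M <= 2^-1 ->
  (P [set w | (biasw r mur M (X w) m + 2 * l * M * qvar c (X w) m + t / l <
               increment M c (X w) m)%R] <= (expR (- t))%:E)%E.
Proof.
move=> c1 l0 M0 lM.
pose h w := \prod_(v <- words m.+1)
  tilt r mur (c v) l M (parentw (X w) v) (W v w).
have mh : measurable_fun [set: T] h.
  apply: measurable_prod => v _; apply: measurable_tilt2.
    exact: measurable_parentw.
  exact: measurable_funP.
have := @markov_real _ _ _ P h 1 (expR t) mh.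
rewrite div1r -expRN => /(_ _ _ (expR_gt0 t)).
rewrite (_ : [set w | expR t < h w] = [set w | biasw r mur M (X w) m +
    2 * l * M * qvar c (X w) m + t / l < increment M c (X w) m]); last first.
  apply/funext => w /=; rewrite /h prod_tiltE ltr_expR.
  rewrite -(ltr_pM2l l0 (_ + _)) !mulrDr [l * (t / l)]mulrC divfK ?lt0r_neq0//.
  by apply/propeqP; split => ?; lra.
apply; first by move=> w; apply: prodr_ge0 => v _; exact: expR_ge0.
exact: (integral_prod_tilt_le indW r1 law1 lawr c1 l0 M0 lM (uniq_words _) (fun _ => id)).
Qed.

(** By induction on the word: the last weight is independent of those of the strict prefixes and
    costs a factor [k]. It serves for both [p = r] and [p = 1]. *)
Lemma integral_weightp_powR_le p k : 0 <= k ->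
  (forall v, v != [::] ->
    (\int[distribution P (W v)]_y (Num.max y 0 `^ p)%:E <= k%:E)%E) ->
  forall v, (\int[P]_w (weightp (X w) v `^ p)%:E <= (k ^+ size v)%:E)%E.
Proof.
move=> k0 lawp; elim/last_ind => [|v b IH].
  under eq_integral do rewrite /weightp big_geq// powR1.
  by rewrite integral_cst// mul1e probability_le1.
rewrite size_rcons exprS EFinM; apply: le_trans (lee_wpmul2l _ IH); last first.
  by rewrite lee_fin.
have vJ : rcons v b \notin below (size v).
  by rewrite mem_below size_rcons ltnn.
have uJ : uniq (rcons v b :: below (size v)) by rewrite /= vJ undup_uniq.
have JD : [set` rcons v b :: below (size v)] `<=` [set v | v != [::]].
  move=> u /=; rewrite inE mem_below => /orP[/eqP ->|/andP[]].
    by case: (v).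
  by case: u.
under eq_integral => w _.
  rewrite weightp_rcons powRM ?weightp_ge0 ?max0_ge0// EFinM; over.
pose h (w : sigma_of (below (size v))) := (weightp (X w) v `^ p)%:E.
pose f (z : sigma_of (below (size v)) * R) := (Num.max z.2 0 `^ p)%:E.
apply: (integral_indep_le indW uJ JD (h := h) (f := f)) => //.
- apply/measurable_EFinP; apply: (measurableT_comp (measurable_powR p)).
  apply: measurable_weightp_sigma => j jv.
  by rewrite mem_below size_takel//; case/andP: jv.
- by move=> z; rewrite lee_fin powR_ge0.
- apply/measurable_EFinP; apply: (measurableT_comp (measurable_powR p)).
  exact: measurable_maxr.
- by move=> z; rewrite lee_fin powR_ge0.
- by move=> w; apply: lawp; case: (v).
Qed.

Lemma integral_moment_le m :
  (\int[P]_w (moment r (X w) m)%:E <= ((2 `^ (1 - r) * mur) ^+ m)%:E)%E.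
Proof.
rewrite /moment; under eq_integral do rewrite -sumEFin.
rewrite ge0_integral_sum//; last 2 first.
- move=> v; apply/measurable_EFinP.
  exact: measurableT_comp (measurable_powR r) (measurable_cellw W v).
- by move=> v w _; rewrite lee_fin powR_ge0.
have mur0 : 0 <= mur by exact: (mur_ge0 (lawr (v := [:: true]) isT)).
apply: (@le_trans _ _ (\sum_(v <- words m) ((2 `^ (- r) * mur) ^+ m)%:E)%E).
  rewrite big_seq [leRHS]big_seq; apply: lee_sum => v /size_word sv.
  under eq_integral => w _.
    rewrite /cellw powRM ?weightp_ge0 ?exprn_ge0// EFinM; over.
  rewrite ge0_integralZl ?lee_fin ?powR_ge0//; last first.
    by move=> w _; rewrite lee_fin powR_ge0.
    apply/measurable_EFinP.
    exact: measurableT_comp (measurable_powR r) (measurable_weightp W v).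
  rewrite exprMn EFinM -!sv.
  rewrite exprV2_powR.
  rewrite lee_wpmul2l ?lee_fin ?exprn_ge0 ?powR_ge0//.
  apply: integral_weightp_powR_le => // u u0.
  by rewrite lawr.
rewrite sumEFin lee_fin big_const_seq count_predT size_words iter_addr_0.
rewrite -[leLHS]mulr_natl natrX -exprMn mulrA powRD ?pnatr_eq0 ?implybT//.
by rewrite powRr1.
Qed.

Lemma mass_tail m a : 0 < a ->
  (P [set w | (a < \sum_(v <- words m) cellw (X w) v)%R] <= (a^-1)%:E)%E.
Proof.
move=> a0; rewrite -[a^-1]mul1r; apply: markov_real => //.
- by apply: measurable_sum => v; exact: measurable_cellw.
- by move=> w; apply: sumr_ge0 => v _; exact: cellw_ge0.
under eq_integral do rewrite -sumEFin.
rewrite ge0_integral_sum//; last 2 first.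
- by move=> v; apply/measurable_EFinP; exact: measurable_cellw.
- by move=> v w _; rewrite lee_fin cellw_ge0.
apply: (@le_trans _ _ (\sum_(v <- words m) ((2^-1) ^+ m)%:E)%E).
  rewrite big_seq [leRHS]big_seq; apply: lee_sum => v /size_word sv.
  rewrite /cellw; under eq_integral do rewrite EFinM.
  rewrite ge0_integralZl ?lee_fin ?exprn_ge0//; last first.
    by move=> w _; rewrite lee_fin weightp_ge0.
    by apply/measurable_EFinP; exact: measurable_weightp.
  rewrite sv -[leRHS]mule1 lee_wpmul2l ?lee_fin ?exprn_ge0//.
  rewrite (eq_integral (fun w => (weightp (X w) v `^ 1)%:E)); last first.
    by move=> w _; rewrite powRr1 ?weightp_ge0.
  rewrite -[leRHS](congr1 EFin (expr1n _ (size v))).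
  apply: integral_weightp_powR_le => // u u0.
  rewrite (eq_integral (fun y : R => (Num.max y 0)%:E)) ?law1// => y _.
  by rewrite powRr1 ?max0_ge0.
rewrite sumEFin lee_fin big_const_seq count_predT size_words iter_addr_0.
by rewrite -[leLHS]mulr_natl natrX -exprMn divff ?expr1n// pnatr_eq0.
Qed.

(** A single cell above [M] already pushes [moment] above [M^r], so Markov's inequality for [moment]
    handles all words at once. *)
Lemma cellw_tail m M : 0 < M ->
  (P (\bigcup_(v in [set` words m]) [set w | (M < cellw (X w) v)%R]) <=
   ((2 `^ (1 - r) * mur) ^+ m / M `^ r)%:E)%E.
Proof.
move=> M0; have Mr : 0 < M `^ r by exact: powR_gt0.
have m0 w : 0 <= moment r (X w) m by apply: sumr_ge0 => v _; exact: powR_ge0.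
apply: le_trans (markov_real (measurable_moment m) m0 (integral_moment_le m) Mr).
apply: le_measure; rewrite ?inE.
- apply: fin_bigcup_measurable => [|v _]; first exact: finite_seq.
  by apply: measurable_gt_set; exact: measurable_cellw.
- by apply: measurable_gt_set; exact: measurable_moment.
move=> w [v /= vm Mv]; rewrite /moment (big_rem v vm)/=.
apply: (@lt_le_trans _ _ (cellw (X w) v `^ r)).
  by rewrite gt0_ltr_powR ?nnegrE ?cellw_ge0 ?(ltW M0)// (lt_trans _ r1).
by rewrite lerDl sumr_ge0// => u _; exact: powR_ge0.
Qed.

(** The prefactor [M^(1-r)] of the bias divided by [M] is [M^-r], and the prefactor [2^(1-r) mur]
    raises the power by one: the bound has the same form as that of [cellw_tail] at level
    [m + 1]. *)
Lemma biasw_tail m M : 0 < M ->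
  (P [set w | (M < biasw r mur M (X w) m)%R] <=
   ((2 `^ (1 - r) * mur) ^+ m.+1 / M `^ r)%:E)%E.
Proof.
move=> M0.
have mur0 : 0 <= mur by exact: (mur_ge0 (lawr (v := [:: true]) isT)).
have b0 w : 0 <= biasw r mur M (X w) m.
  by apply: sumr_ge0 => v _; rewrite !mulr_ge0 ?powR_ge0.
rewrite (_ : _ / _ = M `^ (1 - r) * (2 `^ (1 - r) * mur) *
  (2 `^ (1 - r) * mur) ^+ m / M).
  apply: markov_real => //; first exact: measurable_biasw.
  under eq_integral do rewrite biaswE EFinM.
  rewrite ge0_integralZl ?lee_fin ?mulr_ge0 ?powR_ge0//.
  - by rewrite [leRHS]EFinM lee_wpmul2l ?lee_fin ?mulr_ge0 ?powR_ge0 ?integral_moment_le.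
  - by apply/measurable_EFinP; exact: measurable_moment.
  - by move=> w _; rewrite lee_fin; apply: sumr_ge0 => v _; exact: powR_ge0.
rewrite exprS (@powRB _ M 1 r) ?(gt_eqF M0) ?implybT// powRr1 ?ltW//.
have Mr : M `^ r != 0 by rewrite lt0r_neq0 ?powR_gt0.
by field; rewrite Mr gt_eqF.
Qed.

End cascade_tails.

(** * Oscillation of the phase along the arc *)

Section calculus.
Context (R : realType).
Implicit Types (f df : R -> R) (a b x y : R).

(* Scalar version of [derivative01]. *)
Definition deriv01 f df : Prop := forall x, x \in `[0, 1] ->
  (y - x)^-1 * (f y - f x) @[y --> within `[0, 1] x^'] --> df x.

Lemma deriv01_is_derive f df x : deriv01 f df -> x \in `]0, 1[ ->
  is_derive x 1 f (df x).
Proof.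
move=> fdf x01; have x01' : x \in `[0, 1] by exact: subset_itv_oo_cc x01.
have /cvgrPdist_le H := fdf x x01'.
suff cv : h^-1 *: (f (h *: 1 + x) - f x) @[h --> 0^'] --> df x.
  by apply: DeriveDef; [exact: (cvgP _ cv)|exact: (cvg_lim _ cv)].
apply/cvgrPdist_le => e e0; have := H e e0.
rewrite near_withinE => /nbhs_ballP[d /= d0 Hd].
move: x01; rewrite in_itv/= => /andP[x0 x1].
near=> h; have h0 : h != 0 by near: h; exact: nbhs_dnbhs_neq.
have hd : `|h| < d by near: h; exact: dnbhs0_lt.
have hx : `|h| < x by near: h; exact: dnbhs0_lt.
have hx1 : `|h| < 1 - x by near: h; apply: dnbhs0_lt; rewrite subr_gt0.
have e1 : h *: 1 + x - x = h by rewrite scaler1 addrK.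
have bl : ball x d (h *: 1 + x) by rewrite /ball/= -normrN opprB e1.
have := Hd _ bl; rewrite e1; apply.
  by rewrite -subr_eq0 e1.
have -> : h *: 1 + x = h + x by rewrite scaler1.
have := ler_norm h; have := ler_norm (- h); rewrite normrN in_itv/= => *; lra.
Unshelve. all: by end_near. Qed.

Lemma deriv01_continuous f df : deriv01 f df -> {within `[0, 1], continuous f}.
Proof.
move=> fdf; apply/subspace_continuousP => x x01.
have /cvgrPdist_le H := fdf x x01.
have := H 1 ltr01; rewrite near_withinE => /nbhs_ballP[d /= d0 Hd].
apply/cvgrPdist_le => e e0.
rewrite near_withinE; set K := `|df x| + 1.
have K0 : 0 < K by rewrite ltr_wpDl.
have m0 : 0 < Num.min d (e / K) by rewrite lt_min d0 divr_gt0.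
apply/nbhs_ballP; exists (Num.min d (e / K)) => // y.
rewrite /ball/= lt_min => /andP[yd ye] y01.
have [->|yx] := eqVneq y x; first by rewrite subrr normr0 ltW.
have := Hd y yd yx y01; have yx0 : y - x != 0 by rewrite subr_eq0.
move=> h1; have : `|(y - x)^-1 * (f y - f x)| <= K.
  by rewrite /K -lerBlDl (le_trans (lerB_dist _ _))// distrC.
rewrite normrM normfV -ler_pdivlMl ?invr_gt0 ?normr_gt0// invrK distrC => h2.
apply: (le_trans h2); rewrite -ler_pdivlMr// distrC ltW//.
Qed.

Lemma unif_continuous01 f : {within `[0, 1], continuous f} -> forall e, 0 < e ->
  exists2 d, 0 < d & forall x y, x \in `[0, 1] -> y \in `[0, 1] ->
    `|x - y| <= d -> `|f x - f y| <= e.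
Proof.
move=> /subspace_continuousP cf e e0.
have cov x : `[0, 1]%classic x -> \forall x' \near x & d \near 0^'+,
    `[0, 1]%classic x' ->
    forall y, y \in `[0, 1] -> `|x' - y| <= d -> `|f x' - f y| <= e.
  move=> x01; have /cvgrPdist_le/(_ (e / 2)) := cf x x01.
  rewrite divr_gt0// => /(_ isT); rewrite near_withinE.
  move=> /nbhs_ballP[d /= d0 Hd].
  exists (ball x (d / 2), [set r | r < d / 2]).
    split => /=; first by apply: nbhsx_ballx; rewrite divr_gt0.
    by apply: nbhs_right_lt; rewrite divr_gt0.
  move=> [x' r]/= [xx' rd] x'01 y y01 xy.
  have h1 : `|f x - f x'| <= e / 2.
    apply: Hd => //; rewrite /ball/=; apply: lt_le_trans xx' _.
    by rewrite ler_pdivrMr// ler_peMr ?(ltW d0)// ler1n.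
  have h2 : `|f x - f y| <= e / 2.
    apply: Hd => //; rewrite /ball/=.
    rewrite -(subrKA x') (le_lt_trans (ler_normD _ _))//.
    by rewrite [d]splitr ltrD// (le_lt_trans xy).
  rewrite -(subrKA (f x)) [e]splitr (le_trans (ler_normD _ _))// lerD//.
  by rewrite distrC.
have /compact_near_coveringP/near_covering_withinP := @segment_compact R 0 1.
move=> /(_ R (0^'+) _ _ cov)[d /= d0 H].
exists (d / 2); first by rewrite divr_gt0.
move=> x y x01 y01 xy; apply: (H (d / 2)) => //=; last by rewrite divr_gt0.
rewrite sub0r normrN gtr0_norm ?divr_gt0// ltr_pdivrMr//.
by rewrite ltr_pMr// ltr1n.
Qed.

Lemma continuous01_bounded f : {within `[0, 1], continuous f} ->
  exists2 A, 0 < A & forall x, x \in `[0, 1] -> `|f x| <= A.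
Proof.
move=> cf; have [d d0 H] := unif_continuous01 cf ltr01.
have [c _ cmax] := EVT_max ler01 cf; have [c' _ cmin] := EVT_min ler01 cf.
exists (`|f c| + `|f c'| + 1); first by rewrite ltr_wpDl ?addr_ge0.
move=> x x01; rewrite ler_norml; have h1 := cmax x x01; have h2 := cmin x x01.
have := ler_norm (f c); have := ler_norm (- f c'); rewrite normrN.
have := normr_ge0 (f c); have := normr_ge0 (f c').
by move=> *; apply/andP; split; lra.
Qed.

(** Integration by parts in disguise: [F - sin psi / psi'] has derivative
    [sin psi * psi'' / psi'^2], to which the mean value theorem applies; the two boundary values of
    [sin psi / psi'] give [2 / rho]. *)
Lemma oscillation_bound (psi dpsi ddpsi F : R -> R) a b rho K :
  a < b -> 0 < rho -> 0 <= K ->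
  (forall x, x \in `]a, b[ -> is_derive x 1 psi (dpsi x)) ->
  (forall x, x \in `]a, b[ -> is_derive x 1 dpsi (ddpsi x)) ->
  (forall x, x \in `]a, b[ -> is_derive x 1 F (cos (psi x))) ->
  {within `[a, b], continuous psi} -> {within `[a, b], continuous dpsi} ->
  {within `[a, b], continuous F} ->
  (forall x, x \in `[a, b] -> rho <= `|dpsi x|) ->
  (forall x, x \in `[a, b] -> `|ddpsi x| <= K) ->
  `|F b - F a| <= 2 / rho + K * (b - a) / rho ^+ 2.
Proof.
move=> ab rho0 K0 dP ddP dF cP cdP cF hrho hK.
pose S x := sin (psi x) * (dpsi x)^-1.
have n0 x : x \in `[a, b] -> dpsi x != 0.
  by move=> /hrho; apply: contraTneq => ->; rewrite normr0 -ltNge.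
have Sle x : x \in `[a, b] -> `|S x| <= rho^-1.
  move=> xab; rewrite /S normrM normfV; apply: (@le_trans _ _ (1 * `|dpsi x|^-1)).
    by rewrite ler_wpM2r ?invr_ge0// ler_norml sin_geN1 sin_le1.
  by rewrite mul1r lef_pV2 ?posrE ?hrho// (lt_le_trans rho0) ?hrho.
have cS : {within `[a, b], continuous S}.
  move/subspace_continuousP: cP => cP; move/subspace_continuousP: cdP => cdP.
  apply/subspace_continuousP => x xab; apply: cvgM.
    by apply: (cvg_comp _ _ (cP x xab)); exact: continuous_sin.
  by apply: cvgV; [exact: n0|exact: cdP].
pose G := F - S.
have dG x : x \in `]a, b[ ->
    is_derive x 1 G (sin (psi x) * ddpsi x * (dpsi x ^- 2)).
  move=> xab; have xab' : x \in `[a, b] by exact: subset_itv_oo_cc xab.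
  have dS : is_derive x 1 S (sin (psi x) *: (- dpsi x ^- 2 *: ddpsi x) +
      (dpsi x)^-1 *: (cos (psi x) * dpsi x)).
    apply: (@is_deriveM _ _ (sin \o psi) (fun y => (dpsi y)^-1)).
      by apply: is_derive1_comp; exact: dP.
    by apply: is_deriveV; [exact: n0|exact: ddP].
  have := is_deriveB (dF x xab) dS; congr is_derive.
  have := n0 x xab'; set u := dpsi x => u0.
  by rewrite /GRing.scale/=; field.
have cG : {within `[a, b], continuous G}.
  by move=> x; apply: cvgB; [exact: cF|exact: cS].
have [c cab Gc] := MVT ab dG cG.
have cab' : c \in `[a, b] by exact: subset_itv_oo_cc cab.
have e1 : `|G b - G a| <= K * (b - a) / rho ^+ 2.
  rewrite Gc normrM [`|b - a|]gtr0_norm ?subr_gt0// [leRHS]mulrAC ler_wpM2r ?subr_ge0 ?(ltW ab)//.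
  rewrite !normrM normfV normrX  ler_pM ?mulr_ge0 ?invr_ge0 ?exprn_ge0//.
    rewrite -[leRHS]mul1r ler_pM// ?hK//.
    by rewrite ler_norml sin_geN1 sin_le1.
  by rewrite lef_pV2 ?posrE ?exprn_gt0 ?normr_gt0 ?n0// ler_pXn2r ?nnegrE ?hrho ?(ltW rho0).
have aab : a \in `[a, b] by rewrite in_itv/= lexx ltW.
have bab : b \in `[a, b] by rewrite in_itv/= lexx ltW.
have -> : F b - F a = (G b - G a) + (S b - S a).
  by rewrite /G !fctE; ring.
have e2 : `|S b - S a| <= 2 / rho.
  rewrite (le_trans (ler_normB _ _))//.
  by rewrite mulrDl mul1r lerD ?Sle.
apply: (le_trans (ler_normD _ _)); lra.
Qed.

End calculus.

Section arc.
Context (R : realType).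
Implicit Types (xi p q : R * R) (t : R).

Definition norm1 xi : R := `|xi.1| + `|xi.2|.

Lemma norm1_ge0 xi : 0 <= norm1 xi.
Proof. by rewrite addr_ge0. Qed.

Lemma dotp_le xi p (A : R) : `|p.1| <= A -> `|p.2| <= A ->
  `|dotp p xi| <= A * norm1 xi.
Proof.
move=> h1 h2; rewrite (le_trans (ler_normD _ _))// !normrM mulrDr.
by rewrite lerD// ler_wpM2r.
Qed.

(** Cramer's rule recovers [det2 p q * xi] from the two scalar products. Applied to the first two
    derivatives of the arc, it says that the first and second derivatives of the phase cannot both
    be small. *)
Lemma dotp_nondegenerate xi p q (A : R) : `|p.1| <= A -> `|p.2| <= A ->
  `|q.1| <= A -> `|q.2| <= A ->
  `|det2 p q| * norm1 xi <= 2 * A * (`|dotp p xi| + `|dotp q xi|).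
Proof.
move=> p1 p2 q1 q2.
have e1 : det2 p q * xi.1 = dotp p xi * q.2 - dotp q xi * p.2.
  by rewrite /det2 /dotp; ring.
have e2 : det2 p q * xi.2 = dotp q xi * p.1 - dotp p xi * q.1.
  by rewrite /det2 /dotp; ring.
have bound (a b c d : R) : `|b| <= A -> `|d| <= A ->
    `|a * b - c * d| <= A * (`|a| + `|c|).
  move=> hb hd; rewrite (le_trans (ler_normB _ _))// !normrM mulrDr.
  by rewrite ![A * _]mulrC lerD// ler_wpM2l.
rewrite mulrDr -!normrM e1 e2.
have := bound (dotp p xi) q.2 (dotp q xi) p.2 q2 p2.
have := bound (dotp q xi) p.1 (dotp p xi) q.1 p1 q1.
lra.
Qed.

Lemma deriv01_dotp (g g' : R -> R * R) xi : derivative01 g g' ->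
  deriv01 (fun t => dotp (g t) xi) (fun t => dotp (g' t) xi).
Proof.
move=> dg x x01; have cv := dg x x01.
have -> : (fun y => (y - x)^-1 * (dotp (g y) xi - dotp (g x) xi)) =
    (fun y => dotp ((y - x)^-1 *: (g y - g x)) xi).
  by apply/funext => y; rewrite /dotp/= /GRing.scale/=; ring.
apply: cvgD; apply: cvgMl.
  exact: (cvg_comp _ _ cv cvg_fst).
exact: (cvg_comp _ _ cv cvg_snd).
Qed.

Lemma continuous01_dotp (g : R -> R * R) xi : {within `[0, 1], continuous g} ->
  {within `[0, 1], continuous (fun t => dotp (g t) xi)}.
Proof.
move=> /subspace_continuousP cg; apply/subspace_continuousP => x x01.
have cv := cg x x01; apply: cvgD; apply: cvgMl.
  exact: (cvg_comp _ _ cv cvg_fst).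
exact: (cvg_comp _ _ cv cvg_snd).
Qed.

Lemma dotp10 p : dotp p (1, 0) = p.1.
Proof. by rewrite /dotp mulr1 mulr0 addr0. Qed.

Lemma dotp01 p : dotp p (0, 1) = p.2.
Proof. by rewrite /dotp mulr1 mulr0 add0r. Qed.

Definition arc_bounds (g g' g'' : R -> R * R) (A kap : R) : Prop :=
  [/\ derivative01 g g', derivative01 g' g'',
      {within `[0, 1], continuous g''}, 0 < kap &
      forall t, t \in `[0, 1] -> kap <= `|det2 (g' t) (g'' t)| /\
        forall f, f \in [:: g; g'; g''] -> `|(f t).1| <= A /\ `|(f t).2| <= A].

Lemma bounded01_fst_snd (g : R -> R * R) :
  (forall xi, {within `[0, 1], continuous (fun t => dotp (g t) xi)}) ->
  exists2 A, 0 < A & forall t, t \in `[0, 1] -> `|(g t).1| <= A /\ `|(g t).2| <= A.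
Proof.
move=> cg; have [A1 A10 H1] := continuous01_bounded (cg (1, 0)).
have [A2 A20 H2] := continuous01_bounded (cg (0, 1)).
exists (A1 + A2); first exact: addr_gt0.
move=> t t01; have := H1 t t01; have := H2 t t01.
by rewrite dotp10 dotp01 => h1 h2; split; lra.
Qed.

Lemma arc_bounds_exist g : nondegenerate_C2_arc g ->
  exists g' g'' A kap, 0 < A /\ arc_bounds g g' g'' A kap.
Proof.
move=> [_ [g' [g'' [dg dg' cg'' _ dt]]]].
have [A A0 HA] := bounded01_fst_snd (fun xi =>
  deriv01_continuous (deriv01_dotp (xi := xi) dg)).
have [A' A'0 HA'] := bounded01_fst_snd (fun xi =>
  deriv01_continuous (deriv01_dotp (xi := xi) dg')).
have [A'' A''0 HA''] := bounded01_fst_snd (fun xi => continuous01_dotp (xi := xi) cg'').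
exists g', g'', (A + A' + A''), (inf [set `|det2 (g' t) (g'' t)| | t in `[0, 1]]).
split; first by rewrite !addr_gt0.
split => // t t01; split.
  by apply: ge_inf; [exists 0 => _ [u _ <-]|exists t].
move=> f; rewrite !inE => /or3P[] /eqP ->.
- by have [h1 h2] := HA t t01; split; lra.
- by have [h1 h2] := HA' t t01; split; lra.
- by have [h1 h2] := HA'' t t01; split; lra.
Qed.

End arc.

Section oscillation.
Context (R : realType) (g g' g'' : R -> R * R) (A kap : R).
Hypotheses (A0 : 0 < A) (arc : arc_bounds g g' g'' A kap).

Let P xi t := dotp (g' t) xi.
Let Q xi t := dotp (g'' t) xi.

Let Qle xi t : t \in `[0, 1] -> `|Q xi t| <= A * norm1 xi.
Proof.
move=> t01; have [_ _ _ _ /(_ t t01)[_ /(_ g'')]] := arc.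
by rewrite !inE eqxx !orbT => /(_ isT)[h1 h2]; exact: dotp_le.
Qed.

Let c0 := kap / (2 * A).

Let c0_gt0 : 0 < c0.
Proof. by have [_ _ _ k0 _] := arc; rewrite divr_gt0// mulr_gt0. Qed.

Let PQ_ge xi t : t \in `[0, 1] -> c0 * norm1 xi <= `|P xi t| + `|Q xi t|.
Proof.
move=> t01; have [_ _ _ k0 /(_ t t01)[hk hA]] := arc.
have := hA g'; have := hA g''; rewrite !inE !eqxx !orbT.
move=> /(_ isT)[q1 q2] /(_ isT)[p1 p2].
have := @dotp_nondegenerate _ xi _ _ A p1 p2 q1 q2.
move=> H; rewrite /c0 mulrAC ler_pdivrMr ?mulr_gt0// [leRHS]mulrC.
by apply: le_trans H; rewrite ler_wpM2r// norm1_ge0.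
Qed.

Let Pderiv xi : deriv01 (P xi) (Q xi).
Proof. by have [_ dg' _ _ _] := arc; exact: deriv01_dotp. Qed.

Let subitv (a b x : R) : 0 <= a -> b <= 1 -> x \in `[a, b] -> x \in `[0, 1].
Proof.
by move=> a0 b1; rewrite !in_itv/= => /andP[ax xb]; apply/andP; split; lra.
Qed.

Let subitvo (a b x : R) : 0 <= a -> b <= 1 -> x \in `]a, b[ -> x \in `]0, 1[.
Proof.
by move=> a0 b1; rewrite !in_itv/= => /andP[ax xb]; apply/andP; split; lra.
Qed.

Let P_MVT xi s t : s \in `[0, 1] -> t \in `[0, 1] -> s <= t ->
  exists2 c, c \in `[s, t] & P xi t - P xi s = Q xi c * (t - s).
Proof.
rewrite !in_itv/= => /andP[s0 s1] /andP[t0 t1] st; apply: MVT_segment => //.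
  by move=> x xst; apply: deriv01_is_derive => //; exact: subitvo xst.
apply: continuous_subspaceW (deriv01_continuous (@Pderiv xi)).
by move=> x /=; exact: subitv.
Qed.

Let P_lip xi s t : s \in `[0, 1] -> t \in `[0, 1] ->
  `|P xi t - P xi s| <= A * norm1 xi * `|t - s|.
Proof.
wlog st : s t / s <= t.
  move=> H s01 t01; have [st|/ltW ts] := leP s t; first exact: H.
  by rewrite distrC [`|t - s|]distrC; exact: H.
move=> s01 t01; have [c cst ->] := P_MVT xi s01 t01 st.
rewrite normrM ler_wpM2r//; apply: Qle.
move: s01 t01; rewrite !in_itv/= => /andP[s0 s1] /andP[t0 t1].
by apply: subitv cst.
Qed.

(* Where [Q = P'] is large, [P] is strictly monotone with slope bounded below and
   grows linearly away from a minimiser of [|P|]; elsewhere [P] is itself large. *)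
Lemma phase_points : exists J : nat, exists2 c1, 0 < c1 &
  forall xi, exists tau : nat -> R, forall t, t \in `[0, 1] ->
    exists2 i, (i < J)%N & c1 * norm1 xi * `|t - tau i| <= `|P xi t|.
Proof.
have [_ _ cg'' _ _] := arc.
have c8 : 0 < c0 / 8 by rewrite divr_gt0.
have [d1 d10 H1] := unif_continuous01 (continuous01_dotp (xi := (1, 0)) cg'') c8.
have [d2 d20 H2] := unif_continuous01 (continuous01_dotp (xi := (0, 1)) cg'') c8.
(* Over a length [d] both [P] and [Q] vary by at most [c0 / 4 * norm1 xi]. As [d] does not depend on
   [xi], neither does the number of points. *)
pose d := Num.min (Num.min d1 d2) (c0 / (4 * A)).
have d0 : 0 < d by rewrite !lt_min d10 d20 divr_gt0// mulr_gt0.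
pose J := (Num.truncn d^-1).+1; have J0 : 0 < J%:R :> R by rewrite ltr0n.
have Jd : J%:R^-1 <= d.
  by rewrite -[d]invrK lef_pV2 ?posrE ?invr_gt0// ltW// truncnS_gt.
(* One point more than [J], because [t = 1] falls into the degenerate interval of index [J]. *)
exists J.+1, (c0 / 8) => // xi; pose N := norm1 xi; have N0 : 0 <= N := norm1_ge0 xi.
have Qd s t : s \in `[0, 1] -> t \in `[0, 1] -> `|s - t| <= d ->
    `|Q xi s - Q xi t| <= c0 / 4 * N.
  move=> s01 t01; rewrite !le_min -andbA => /and3P[h1 h2 _].
  have := H1 s t s01 t01 h1; have := H2 s t s01 t01 h2.
  rewrite !dotp10 !dotp01 => e2 e1.
  have -> : Q xi s - Q xi t = dotp (g'' s - g'' t) xi by rewrite /Q /dotp/=; ring.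
  apply: (le_trans (dotp_le (A := c0 / 8) _ _ _)) => //.
  by rewrite ler_wpM2r// ler_wpM2l ?(ltW c0_gt0)// lef_pV2 ?posrE ?ler_nat.
have Pd s t : s \in `[0, 1] -> t \in `[0, 1] -> `|s - t| <= d ->
    `|P xi s - P xi t| <= c0 / 4 * N.
  move=> s01 t01; rewrite !le_min => /andP[_ h]; apply: (le_trans (P_lip _ _ _)) => //.
  rewrite -/N mulrAC ler_wpM2r//.
  apply: (@le_trans _ _ (A * (c0 / (4 * A)))); first by rewrite ler_wpM2l// ltW.
  by rewrite le_eqVlt; apply/orP; left; apply/eqP; field; rewrite gt_eqF.
pose lo (i : nat) : R := i%:R / J%:R.
pose hi (i : nat) : R := Num.min 1 (i.+1%:R / J%:R).
have lo0 i : 0 <= lo i by rewrite divr_ge0.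
have hi1 i : hi i <= 1 by rewrite ge_min lexx.
have hilo i : hi i - lo i <= d.
  apply: le_trans Jd; rewrite lerBlDr; apply: (@le_trans _ _ (i.+1%:R / J%:R)).
    by rewrite /hi ge_min lexx orbT.
  by rewrite /lo -natr1 mulrDl mul1r addrC.
have lohi i : (i < J.+1)%N -> lo i <= hi i.
  rewrite ltnS => iJ; rewrite /hi le_min; apply/andP; split.
    by rewrite /lo ler_pdivrMr// mul1r ler_nat.
  by rewrite /lo ler_pM2r ?invr_gt0// ler_nat.
have tauP i : exists tau, (i < J.+1)%N -> tau \in `[lo i, hi i] /\
    forall t, t \in `[lo i, hi i] -> `|P xi tau| <= `|P xi t|.
  have [iJ|] := boolP (i < J.+1)%N; last by exists 0.
  have cP : {within `[lo i, hi i], continuous (fun t => `|P xi t|)}.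
    have cP0 : {within `[0, 1], continuous (fun t => `|P xi t|)}.
      by move=> x; apply: cvg_norm; exact: (deriv01_continuous (@Pderiv xi)).
    by apply: continuous_subspaceW cP0 => x /=; exact: subitv.
  by have [tau t1 t2] := EVT_min (lohi i iJ) cP; exists tau.
have [tau tauE] := choice tauP.
exists tau => t t01; have := t01; rewrite in_itv/= => /andP[t0 t1].
have tJ0 : 0 <= t * J%:R by rewrite mulr_ge0.
pose i := Num.truncn (t * J%:R).
have /andP[i1 i2] : i%:R <= t * J%:R < i.+1%:R by exact: truncn_itv.
have iJ : (i < J.+1)%N.
  rewrite ltnS -(ler_nat R) (le_trans i1)// -[leRHS]mul1r ler_wpM2r//.
have tin : t \in `[lo i, hi i].
  rewrite in_itv/= /lo ler_pdivrMr// i1 /hi le_min t1/=.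
  by rewrite ler_pdivlMr// ltW.
have [tauin taumin] := tauE i iJ.
exists i => //; rewrite -/N.
have tau01 : tau i \in `[0, 1] by apply: subitv tauin.
have lo01 : lo i \in `[0, 1].
  by rewrite in_itv/= lo0 (le_trans (lohi i iJ)).
have lod s : s \in `[lo i, hi i] -> `|lo i - s| <= d.
  rewrite in_itv/= => /andP[s1 s2]; rewrite distrC ger0_norm ?subr_ge0//.
  by apply: le_trans (hilo i); rewrite lerB.
have [hQ|hQ] := leP (c0 / 2 * N) `|Q xi (lo i)|.
  have key s u : s \in `[lo i, hi i] -> u \in `[lo i, hi i] -> s <= u ->
      c0 / 4 * N * `|u - s| <= `|P xi u - P xi s|.
    move=> sin uin su.
    have s01 : s \in `[0, 1] by apply: subitv sin.
    have u01 : u \in `[0, 1] by apply: subitv uin.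
    have [c csu ->] := P_MVT xi s01 u01 su.
    have cin : c \in `[lo i, hi i].
      move: csu sin uin; rewrite !in_itv/= => /andP[? ?] /andP[? ?] /andP[? ?].
      by apply/andP; split; lra.
    have c01 : c \in `[0, 1] by apply: subitv cin.
    rewrite normrM ler_wpM2r//.
    have := Qd _ _ lo01 c01 (lod c cin).
    have := ler_normD (Q xi (lo i) - Q xi c) (Q xi c); rewrite subrK.
    lra.
  have : c0 / 4 * N * `|t - tau i| <= `|P xi t| + `|P xi (tau i)|.
    have [st|/ltW ts] := leP (tau i) t.
      exact: (le_trans (key _ _ tauin tin st) (ler_normB _ _)).
    have := key _ _ tin tauin ts; have := ler_normB (P xi (tau i)) (P xi t).
    rewrite [`|t - tau i|]distrC; lra.
  (* By minimality the increment of [P] between [tau i] and [t] is at most [2 |P t|], which turns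
     the slope [c0 / 4] into [c0 / 8]. *)
  have := taumin t tin; lra.
have := PQ_ge xi lo01; rewrite -/N.
have := Pd _ _ lo01 t01 (lod t tin).
have := ler_normD (P xi (lo i) - P xi t) (P xi t); rewrite subrK.
have : c0 / 8 * N * `|t - tau i| <= c0 / 8 * N * 1.
  have cN : 0 <= c0 / 8 * N by rewrite mulr_ge0// ltW.
  rewrite ler_wpM2l//.
  move: tau01; rewrite in_itv/= => /andP[u0 u1].
  by rewrite ler_norml; apply/andP; split; lra.
have : 0 <= c0 * N by rewrite mulr_ge0 ?(ltW c0_gt0).
lra.
Qed.

End oscillation.

(** * Extension to the line, and primitives *)

Section clamp.
Context (R : realType).
Implicit Types (t : R) (h : R -> R).

(** Composition with it turns a function continuous on [[0, 1]] into a bounded continuous function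
    on the line, as the test functions of weak convergence must be. *)
Definition clamp t : R := Num.min 1 (Num.max 0 t).

Lemma clamp_in t : clamp t \in `[0, 1].
Proof.
rewrite in_itv/= /clamp ge_min lexx le_min ler01/= andbT.
by rewrite le_max lexx.
Qed.

Lemma clamp_id t : t \in `[0, 1] -> clamp t = t.
Proof.
by rewrite in_itv/= /clamp => /andP[t0 t1]; rewrite (max_idPr t0) (min_idPr t1).
Qed.

Lemma clampE t : clamp t = if t <= 0 then 0 else if t <= 1 then t else 1.
Proof.
rewrite /clamp; case: (leP t 0) => t0; first by rewrite (min_r ler01).
by case: (leP t 1).
Qed.

Lemma clamp_lip t u : `|clamp t - clamp u| <= `|t - u|.
Proof.
wlog tu : t u / t <= u.
  move=> H; have [|/ltW] := leP t u; first exact: H.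
  by move=> ut; rewrite distrC [`|t - u|]distrC H.
rewrite distrC [`|t - u|]distrC [leRHS]ger0_norm ?subr_ge0//.
rewrite ler_norml !clampE; apply/andP; split;
  case: (leP t 0) => ?; case: (leP u 0) => ?;
  case: (leP t 1) => ?; case: (leP u 1) => ?; lra.
Qed.

Lemma continuous_clamp h : {within `[0, 1], continuous h} ->
  continuous (h \o clamp).
Proof.
move=> ch x; apply/cvgrPdist_le => e e0.
have [d d0 H] := unif_continuous01 ch e0.
apply/nbhs_ballP; exists d => // y; rewrite /ball/= => xy.
by apply: H (clamp_in _) (clamp_in _) _; rewrite (le_trans (clamp_lip _ _))// ltW.
Qed.

End clamp.

Section primitive.
Context (R : realType) (f : R -> R).
Hypothesis cf : continuous f.
Local Notation mu := (@lebesgue_measure R).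

(** Based at [-1] so that it is differentiable on a neighbourhood of [[0, 1]]. *)
Definition prim (x : R) : R := (\int[mu]_(t in `[-1, x]) f t)%R.

Lemma continuous_integrable_itv (a b : R) : mu.-integrable `[a, b] (EFin \o f).
Proof.
apply: continuous_compact_integrable; first exact: segment_compact.
exact: continuous_subspaceT.
Qed.

Lemma prim_is_derive (x : R) : -1 < x -> is_derive x 1 prim (f x).
Proof.
move=> x1; have xx1 : x < x + 1 by rewrite ltrDl.
have [dF F'] := @continuous_FTC1_closed _ f (-1) x (x + 1) xx1
  (continuous_integrable_itv _ _) x1 (cf (x := x)).
by apply: DeriveDef; [exact: dF|rewrite -derive1E; exact: F'].
Qed.

Lemma prim_continuous_at (x : R) : -1 < x -> {for x, continuous prim}.
Proof.
move=> /prim_is_derive[dx _].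
by apply: differentiable_continuous; exact/derivable1_diffP.
Qed.

Lemma prim_continuous (a b : R) : -1 < a -> {within `[a, b], continuous prim}.
Proof.
move=> a1; apply: derivable_within_continuous => x; rewrite in_itv/= => /andP[ax _].
by have [] := prim_is_derive (lt_le_trans a1 ax).
Qed.

Lemma integral_prim (a b : R) : -1 < a -> a < b ->
  (\int[mu]_(x in `[a, b]) (f x)%:E = (prim b - prim a)%:E)%E.
Proof.
move=> a1 ab; apply: continuous_FTC2 => //.
- exact: continuous_subspaceT.
- split.
  + move=> x; rewrite in_itv/= => /andP[ax _].
    by have [] := prim_is_derive (lt_trans a1 ax).
  + exact/cvg_at_right_filter/prim_continuous_at.
  + exact/cvg_at_left_filter/prim_continuous_at/(lt_trans a1).
- move=> x; rewrite in_itv/= => /andP[ax _].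
  by rewrite derive1E; have [_] := prim_is_derive (lt_trans a1 ax).
Qed.

Lemma prim_le (a b M : R) : -1 < a -> a <= b -> (forall x, `|f x| <= M) ->
  `|prim b - prim a| <= M * (b - a).
Proof.
move=> a1 ab fM; have dp x : x \in `]a, b[ -> is_derive x 1 prim (f x).
  by rewrite in_itv/= => /andP[ax _]; exact: prim_is_derive (lt_trans a1 ax).
have [c _ ->] := MVT_segment ab dp (prim_continuous a1).
by rewrite normrM [`|b - a|]ger0_norm ?subr_ge0// ler_wpM2r ?subr_ge0.
Qed.

End primitive.

Section arc_oscillation.
Context (R : realType) (g : R -> R * R).

(** The shifts [th = 0] and [th = - (pi / 2)] give the real and the imaginary part of the Fourier
    kernel, so one family of cosines covers both. *)
Definition arc_phase (xi : R * R) (th t : R) : R :=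
  cos (- 2 * pi * dotp (g (clamp t)) xi + th).

Lemma arc_phase_le1 xi th t : `|arc_phase xi th t| <= 1.
Proof. by rewrite ler_norml cos_geN1 cos_le1. Qed.

Hypothesis arc : nondegenerate_C2_arc g.

Lemma continuous_arc_phase xi th : continuous (arc_phase xi th).
Proof.
have [g' [g'' [A [kap [_ [dg _ _ _ _]]]]]] := arc_bounds_exist arc.
have cg := continuous_clamp (deriv01_continuous (deriv01_dotp (xi := xi) dg)).
move=> x; apply: (continuous_comp
  (f := fun t => - 2 * pi * dotp (g (clamp t)) xi + th) (g := @cos R)).
  by apply: cvgD; [apply: cvgMr; exact: cg|exact: cvg_cst].
exact: continuous_cos.
Qed.

(** The number [mu] bounds the length of the interval from above and the distance to the points from
    below. Then the phase has slope at least of order [norm1 xi * mu] and its second derivative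
    times the length is at most of that order, so both terms of [oscillation_bound] are of order
    [1 / (norm1 xi * mu)]. *)
Lemma prim_phase_oscillation : exists J : nat, exists2 C, 0 < C &
  forall xi th, 0 < norm1 xi -> exists tau : nat -> R, forall a b mu : R,
    0 <= a -> a < b -> b <= 1 -> b - a <= mu ->
    (forall t i, t \in `[a, b] -> (i < J)%N -> mu <= `|t - tau i|) ->
    `|prim (arc_phase xi th) b - prim (arc_phase xi th) a| <= C / (norm1 xi * mu).
Proof.
have [g' [g'' [A [kap [A0 garc]]]]] := arc_bounds_exist arc.
have [J [c1 c10 H]] := phase_points A0 garc.
have [dg dg' cg'' _ hA] := garc.
have pi2 : 1 <= 2 * pi :> R by have := pi_ge2 R; lra.
have pi0 : 0 < 2 * pi :> R by apply: lt_le_trans pi2.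
exists J, (2 / c1 + 2 * pi * A / c1 ^+ 2).
  by rewrite addr_gt0// !divr_gt0 ?mulr_gt0 ?exprn_gt0 ?pi_gt0.
move=> xi th N0; have [tau htau] := H xi; exists tau => a b mu a0 ab b1 bamu hmu.
have mu0 : 0 < mu by apply: lt_le_trans bamu; rewrite subr_gt0.
set N := norm1 xi in N0 *.
have sub x : x \in `[a, b] -> x \in `[0, 1].
  by rewrite !in_itv/= => /andP[ax xb]; apply/andP; split; lra.
have subo x : x \in `]a, b[ -> x \in `]0, 1[.
  by rewrite !in_itv/= => /andP[ax xb]; apply/andP; split; lra.
pose psi t := - 2 * pi * dotp (g t) xi + th.
pose dpsi t := - 2 * pi * dotp (g' t) xi.
pose ddpsi t := - 2 * pi * dotp (g'' t) xi.
have dpsiP x : x \in `]a, b[ -> is_derive x 1 psi (dpsi x).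
  move=> xab; rewrite /dpsi -[_ * dotp (g' x) xi]addr0.
  have dx := deriv01_is_derive (deriv01_dotp (xi := xi) dg) (subo x xab).
  have dz := @is_deriveZ _ _ _ (fun t => dotp (g t) xi) (- 2 * pi) x 1 _ dx.
  exact: is_deriveD dz (is_derive_cst th x 1).
have ddpsiP x : x \in `]a, b[ -> is_derive x 1 dpsi (ddpsi x).
  move=> xab.
  have dx := deriv01_is_derive (deriv01_dotp (xi := xi) dg') (subo x xab).
  exact: (@is_deriveZ _ _ _ (fun t => dotp (g' t) xi) (- 2 * pi) x 1 _ dx).
have dF x : x \in `]a, b[ ->
    is_derive x 1 (prim (arc_phase xi th)) (cos (psi x)).
  move=> xab; have x01 := subset_itv_oo_cc (subo x xab).
  have -> : cos (psi x) = arc_phase xi th x by rewrite /arc_phase clamp_id.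
  apply: prim_is_derive; first exact: continuous_arc_phase.
  by move: x01; rewrite in_itv/= => /andP[x0 _]; lra.
have cW (h : R -> R) : {within `[0, 1], continuous h} ->
    {within `[a, b], continuous h}.
  by apply: continuous_subspaceW => x /=; exact: sub.
have cpsi : {within `[a, b], continuous psi}.
  have := cW _ (deriv01_continuous (deriv01_dotp (xi := xi) dg)).
  by move=> ch x; apply: cvgD; [apply: cvgMr; exact: ch|exact: cvg_cst].
have cdpsi : {within `[a, b], continuous dpsi}.
  have := cW _ (deriv01_continuous (deriv01_dotp (xi := xi) dg')).
  by move=> ch x; apply: cvgMr; exact: ch.
have cF : {within `[a, b], continuous (prim (arc_phase xi th))}.
  by apply: prim_continuous; [exact: continuous_arc_phase|lra].
have rho0 : 0 < c1 * N * mu by rewrite !mulr_gt0.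
have hd x : x \in `[a, b] -> c1 * N * mu <= `|dpsi x|.
  move=> xab; have [i iJ hi] := htau x (sub x xab).
  rewrite /dpsi mulNr mulNr normrN normrM (ger0_norm (ltW pi0)).
  apply: (@le_trans _ _ (1 * `|dotp (g' x) xi|)); last by rewrite ler_wpM2r.
  rewrite mul1r; apply: le_trans hi; rewrite ler_wpM2l ?mulr_ge0 ?(ltW c10) ?(ltW N0)//.
  exact: hmu.
have hdd x : x \in `[a, b] -> `|ddpsi x| <= 2 * pi * (A * N).
  move=> xab; have [_ /(_ g'')] := hA x (sub x xab).
  rewrite !inE eqxx !orbT => /(_ isT)[h1 h2].
  rewrite /ddpsi mulNr mulNr normrN normrM (ger0_norm (ltW pi0)).
  by rewrite ler_wpM2l ?(ltW pi0)// dotp_le.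
have K0 : 0 <= 2 * pi * (A * N) by rewrite !mulr_ge0 ?pi_ge0 ?(ltW A0) ?(ltW N0).
apply: (le_trans (oscillation_bound ab rho0 K0 dpsiP ddpsiP dF cpsi cdpsi cF hd hdd)).
apply: (@le_trans _ _ (2 / (c1 * N * mu) +
    2 * pi * (A * N) * mu / (c1 * N * mu) ^+ 2)).
  by rewrite lerD2l ler_wpM2r ?invr_ge0 ?exprn_ge0 ?(ltW rho0)// ler_wpM2l.
rewrite le_eqVlt; apply/orP; left; apply/eqP; field.
by rewrite !gt_eqF.
Qed.

End arc_oscillation.

(** * Deterministic bounds on cascade sums *)

Section word_geometry.
Context (R : realType).
Implicit Types (v u : seq bool).
Notation wp := (@word_point R).

Lemma word_point_rcons v b :
  wp (rcons v b) = wp v + (b : nat)%:R * 2^-1 ^+ (size v).+1.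
Proof.
rewrite /word_point size_rcons big_ord_recr/= nth_rcons ltnn eqxx exprVn.
congr (_ + _); apply: eq_bigr => i _.
by rewrite nth_rcons ltn_ord.
Qed.

Lemma word_point_nil : wp [::] = 0.
Proof. by rewrite /word_point big_ord0. Qed.

Lemma word_point_take v k : (k <= size v)%N ->
  wp (take k v) <= wp v /\
  wp v + 2^-1 ^+ size v <= wp (take k v) + 2^-1 ^+ k.
Proof.
elim/last_ind: v => [|v b IH]; first by case: k.
rewrite size_rcons leq_eqVlt => /predU1P[->|].
  by rewrite -(size_rcons v b) take_size.
rewrite ltnS => kv; have [h1 h2] := IH kv.
rewrite -cats1 takel_cat// cats1 word_point_rcons exprS.
have : 0 <= 2^-1 ^+ size v :> R by rewrite exprn_ge0.
by case: b => /=; split; lra.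
Qed.

Lemma word_point_itv v : 0 <= wp v /\ wp v + 2^-1 ^+ size v <= 1.
Proof.
have := @word_point_take v 0 (leq0n _).
by rewrite take0 word_point_nil expr0 add0r.
Qed.

Definition word_nat v : nat := foldl (fun n (b : bool) => (n.*2 + b)%N) 0%N v.

Lemma word_nat_rcons v b : word_nat (rcons v b) = ((word_nat v).*2 + b)%N.
Proof. by rewrite /word_nat foldl_rcons. Qed.

Lemma word_point_nat v : wp v = (word_nat v)%:R * 2^-1 ^+ size v.
Proof.
elim/last_ind: v => [|v b IH]; first by rewrite word_point_nil mul0r.
rewrite word_point_rcons size_rcons word_nat_rcons IH natrD -muln2 natrM exprS.
by rewrite mulrDl; congr (_ + _); field.
Qed.

Lemma word_nat_inj k : {in words k &, injective word_nat}.
Proof.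
elim: k => [|k IH] u v; first by rewrite !inE => /eqP -> /eqP ->.
rewrite !mem_words; case/lastP: u => // u b; case/lastP: v => // v c.
rewrite !size_rcons !eqSS !word_nat_rcons => su sv e.
have bc : b = c by have := congr1 odd e; rewrite !oddD !odd_double; case: b c {e} => -[].
rewrite bc (IH u v) ?mem_words//.
by apply: double_inj; apply: (@addIn c); rewrite -{1}bc.
Qed.

(** Multiplied by [2^k], the points are distinct integers at distance less than 2 from [y = 2^k x];
    they all lie among the five integers starting at the truncation of [y - 2], which is 0 when
    [y < 2]. *)
Lemma count_close_words k (x : R) :
  (count (fun u => `|wp u - x| < 2 * 2^-1 ^+ k)%R (words k) <= 5)%N.
Proof.
pose y := x * 2 ^+ k; pose N := Num.truncn (y - 2).
rewrite -size_filter -(size_map word_nat) -(size_iota N 5).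
apply: uniq_leq_size.
  rewrite map_inj_in_uniq ?filter_uniq ?uniq_words//.
  move=> u v; rewrite !mem_filter => /andP[_ uk] /andP[_ vk].
  exact: (word_nat_inj uk vk).
move=> n /mapP[u]; rewrite mem_filter => /andP[+ uk] ->.
have k0 : 0 < 2 ^+ k :> R by rewrite exprn_gt0.
rewrite word_point_nat (size_word uk) exprVn.
have -> : (word_nat u)%:R / 2 ^+ k - x = ((word_nat u)%:R - y) / 2 ^+ k.
  by rewrite mulrBl mulfK ?lt0r_neq0.
rewrite normrM normfV (gtr0_norm k0) ltr_pM2r ?invr_gt0//.
rewrite ltr_norml => /andP[h1 h2].
have N1 : y - 2 < N.+1%:R by exact: truncnS_gt.
rewrite mem_iota; apply/andP; split.
  rewrite leqNgt; apply/negP => nN.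
  have [y2|y2] := leP 0 (y - 2).
    have : N%:R <= y - 2 by rewrite truncn_le.
    have : (word_nat u).+1%:R <= N%:R :> R by rewrite ler_nat.
    by rewrite -natr1; lra.
  have : (0 < N)%N by apply: leq_ltn_trans nN.
  by rewrite truncn_gt0; lra.
rewrite -(ltr_nat R) natrD; move: N1; rewrite -natr1; lra.
Qed.

End word_geometry.

(** * Dyadic layers around the exceptional points *)

Section layers.
Context (R : realType) (J : nat) (tau : nat -> R).
Notation wp := (@word_point R).

(** The factor 2 allows for the length [2^-k] of the cell: if the left endpoint is not close, the
    whole cell is at distance at least [2^-k] from every [tau i]. *)
Definition close_word (k : nat) (u : seq bool) : bool :=
  [exists i : 'I_J, `|wp u - tau i| < 2 * 2^-1 ^+ k].

Lemma sum_close_words k :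
  \sum_(u <- words k) (close_word k u : nat)%:R <= (5 * J)%:R :> R.
Proof.
rewrite -natr_sum ler_nat.
apply: (@leq_trans (\sum_(u <- words k) \sum_(i < J)
    (`|wp u - tau i| < 2 * 2^-1 ^+ k)%R)%N).
  apply: leq_sum => u _; rewrite /close_word.
  by case: existsP => // -[i hi]; rewrite (bigD1 i)//= hi.
rewrite exchange_big/=; apply: (@leq_trans (\sum_(i < J) 5)).
  apply: leq_sum => i _; apply: leq_trans (@count_close_words R k (tau i)).
  by rewrite -sum1_count [in leqRHS]big_mkcond; apply: leq_sum => u _; case: ifP.
by rewrite sum_nat_const card_ord mulnC.
Qed.

(** Consider the first scale at which the ancestor of [v] is not close. If it is 0, the term [G 0]
    suffices; if it is [j + 1], the ancestor at scale [j] is close and [G (j + 1) <= 4 G j]. If all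
    ancestors are close, the last term is used. *)
Lemma layer_le (G : nat -> R) (y : R) v m : size v = m ->
  (forall k, 0 <= G k) -> (forall k, G k.+1 <= 4 * G k) ->
  (forall k, (k <= m)%N -> ~~ close_word k (take k v) -> y <= G k) ->
  y <= G m ->
  y <= 4 * (G 0%N + \sum_(k < m.+1) G k * (close_word k (take k v) : nat)%:R).
Proof.
move=> sv G0 G4 far near.
have S0 : 0 <= \sum_(k < m.+1) G k * (close_word k (take k v) : nat)%:R.
  by apply: sumr_ge0 => k _; rewrite mulr_ge0.
have term k : (k <= m)%N -> close_word k (take k v) ->
    G k <= \sum_(k < m.+1) G k * (close_word k (take k v) : nat)%:R.
  move=> km ck; rewrite (bigD1 (Ordinal (km : (k < m.+1)%N)))//= ck mulr1 lerDl.
  by apply: sumr_ge0 => j _; rewrite mulr_ge0.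
have G00 := G0 0%N.
have [ex|H] := pselect (exists k, (k <= m)%N && ~~ close_word k (take k v)).
  case: (ex_minnP ex) => -[|j] /andP[jm cj] jmin.
    by have := far _ jm cj; lra.
  have cj' : close_word j (take j v).
    apply: contraT => cj'; have := jmin j; rewrite (ltnW jm) cj' => /(_ isT).
    by rewrite ltnn.
  have := far _ jm cj; have := G4 j; have := term j (ltnW jm) cj'; lra.
have cm : close_word m (take m v).
  by apply: contraT => cm; case: H; exists m; rewrite leqnn.
by have := term m (leqnn m) cm; have := G0 m; lra.
Qed.

(** Sum [layer_le] over the words and exchange the sums: at scale [k] there are at most [5 J] close
    words, and the descendants of each have total weight at most [Y k]. *)
Lemma sum_layers m (G Y : nat -> R) (wt y : seq bool -> R) :
  (forall k, 0 <= G k) -> (forall k, G k.+1 <= 4 * G k) ->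
  (forall v, 0 <= wt v) ->
  (forall v k, v \in words m -> (k <= m)%N ->
     ~~ close_word k (take k v) -> y v <= G k) ->
  (forall v, v \in words m -> y v <= G m) ->
  (forall k u, (k <= m)%N -> u \in words k ->
     \sum_(v <- words m) wt v * (take k v == u : nat)%:R <= Y k) ->
  \sum_(v <- words m) wt v * y v <=
  4 * (G 0%N * Y 0%N + \sum_(k < m.+1) G k * ((5 * J)%:R * Y k)).
Proof.
move=> G0 G4 wt0 far near hY.
have Y0 : \sum_(v <- words m) wt v <= Y 0%N.
  rewrite (eq_bigr (fun v => wt v * (take 0 v == [::] : nat)%:R)); last first.
    by move=> v _; rewrite take0 mulr1.
  by apply: hY.
apply: (@le_trans _ _ (\sum_(v <- words m) wt v *
  (4 * (G 0%N + \sum_(k < m.+1) G k * (close_word k (take k v) : nat)%:R)))).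
  rewrite big_seq [leRHS]big_seq; apply: ler_sum => v vm.
  rewrite ler_wpM2l//; apply: (layer_le (size_word vm)) => //.
  - by move=> k; exact: far.
  - exact: near.
under eq_bigr do rewrite mulrCA mulrDr mulr_sumr.
rewrite -mulr_sumr ler_wpM2l// big_split/= lerD//.
  by rewrite -mulr_suml mulrC ler_wpM2l.
rewrite exchange_big/=; apply: ler_sum => k _.
under eq_bigr do rewrite mulrCA.
rewrite -mulr_sumr ler_wpM2l//.
have km : (k <= m)%N by rewrite -ltnS.
have close_sum v : v \in words m -> (close_word k (take k v) : nat)%:R =
    \sum_(u <- words k) (take k v == u : nat)%:R * (close_word k u : nat)%:R :> R.
  move=> vm; have tk : take k v \in words k.
    by rewrite mem_words size_takel// (size_word vm).
  rewrite (bigD1_seq _ tk (uniq_words k))/= eqxx mul1r big1 ?addr0// => u.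
  by rewrite eq_sym => /negbTE ->; rewrite mul0r.
rewrite big_seq; under eq_bigr => v vm do rewrite (close_sum v vm) mulr_sumr.
rewrite -big_seq exchange_big/=.
apply: (@le_trans _ _ (\sum_(u <- words k) (close_word k u : nat)%:R * Y k)).
  rewrite big_seq [leRHS]big_seq; apply: ler_sum => u uk.
  under eq_bigr do rewrite mulrA mulrC.
  by rewrite -mulr_sumr ler_wpM2l// hY.
rewrite -mulr_suml ler_wpM2r ?sum_close_words//.
have u0 : nseq k false \in words k by rewrite mem_words size_nseq.
apply: le_trans (hY _ _ km u0).
by apply: sumr_ge0 => v _; rewrite mulr_ge0.
Qed.

End layers.

(** * Cell averages and the martingale structure *)

Section cell_averages.
Context (R : realType).
Implicit Types (F : R -> R) (x : seq bool -> R) (u v : seq bool).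
Notation wp := (@word_point R).

(** With [F] a primitive, this is the mean of the integrand over [I_v], read off from the
    endpoints. *)
Definition cell_average F v : R :=
  2 ^+ size v * (F (wp v + 2^-1 ^+ size v) - F (wp v)).

Lemma cell_average_rcons F v : cell_average F v =
  2^-1 * (cell_average F (rcons v false) + cell_average F (rcons v true)).
Proof.
rewrite /cell_average !word_point_rcons !size_rcons/= mul0r addr0 mul1r.
have -> : wp v + 2^-1 ^+ (size v).+1 + 2^-1 ^+ (size v).+1 =
          wp v + 2^-1 ^+ size v.
  by rewrite -addrA; congr (_ + _); rewrite exprS; field.
by rewrite exprS; field.
Qed.

Definition cascade_value F x m : R :=
  \sum_(v <- words m) cellw x v * cell_average F v.

(** The indicator of the descendants of [u], real-valued so that it can be a coefficient family of
    [increment]. *)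
Definition in_word u v : R := (take (size u) v == u : nat)%:R.

Definition mass x m u : R := \sum_(v <- words m) cellw x v * in_word u v.

Lemma mass_ge0 x m u : 0 <= mass x m u.
Proof. by apply: sumr_ge0 => v _; rewrite mulr_ge0 ?cellw_ge0. Qed.

(** The martingale property: an average over a cell is the mean of those over its two children, so
    the value at level [m] is the compensator of the value at level [m + 1]. *)
Lemma cascade_value_parent F x m :
  cascade_value F x m = \sum_(v <- words m.+1) parentw x v * cell_average F v.
Proof.
rewrite sum_words_S; apply: eq_bigr => v _.
by rewrite !parentw_rcons cell_average_rcons; ring.
Qed.

Lemma in_word_rcons u v b : (size u <= size v)%N ->
  in_word u (rcons v b) = in_word u v.
Proof. by move=> uv; rewrite /in_word -cats1 takel_cat. Qed.

Lemma mass_parent x m u : (size u <= m)%N ->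
  mass x m u = \sum_(v <- words m.+1) parentw x v * in_word u v.
Proof.
move=> um; rewrite sum_words_S /mass big_seq [RHS]big_seq.
apply: eq_bigr => v /size_word sv.
by rewrite !parentw_rcons !in_word_rcons ?sv//; field.
Qed.

Lemma increment_capped (c : seq bool -> R) M x m :
  (forall v, v \in words m.+1 -> cellw x v <= M) ->
  increment M c x m = \sum_(v <- words m.+1) cellw x v * c v -
                      \sum_(v <- words m.+1) parentw x v * c v.
Proof.
move=> cap; rewrite -sumrB /increment big_seq [RHS]big_seq; apply: eq_bigr => v vm.
by rewrite /trunc cap//; ring.
Qed.

Lemma cascade_value_step F M x m :
  (forall v, v \in words m.+1 -> cellw x v <= M) ->
  cascade_value F x m.+1 - cascade_value F x m =
  increment M (cell_average F) x m.
Proof. by move=> cap; rewrite increment_capped// -cascade_value_parent. Qed.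

Lemma mass_step M x m u : (size u <= m)%N ->
  (forall v, v \in words m.+1 -> cellw x v <= M) ->
  mass x m.+1 u - mass x m u = increment M (in_word u) x m.
Proof. by move=> um cap; rewrite increment_capped// -mass_parent. Qed.

(** An indicator is its own square; this turns the exponential bound into a recursion for the mass
    itself. *)
Lemma qvar_in_word x m u : (size u <= m)%N -> qvar (in_word u) x m = mass x m u.
Proof.
move=> um; rewrite mass_parent//; apply: eq_bigr => v _.
by rewrite /in_word mulrC; case: eqP => _ /=; rewrite ?expr1n ?expr0n.
Qed.

Lemma mass_word x u : mass x (size u) u = cellw x u.
Proof.
have uu : u \in words (size u) by rewrite mem_words.
rewrite /mass (bigD1_seq u uu (uniq_words _))/= /in_word take_size eqxx mulr1.
rewrite big_seq_cond big1 ?addr0// => v /andP[/size_word sv vu].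
by rewrite -sv take_size (negbTE vu) mulr0.
Qed.

Lemma mass_le_total x m u : mass x m u <= mass x m [::].
Proof.
apply: ler_sum => v _; rewrite ler_wpM2l ?cellw_ge0//.
by rewrite /in_word take0 eqxx; case: eqP.
Qed.

Lemma mass_nil x m : mass x m [::] = \sum_(v <- words m) cellw x v.
Proof. by apply: eq_bigr => v _; rewrite /in_word take0 eqxx mulr1. Qed.

End cell_averages.

(** * Mass of a dyadic interval *)

Section mass_growth.
Context (R : realType) (r mur rho sigma : R) (x : seq bool -> R) (k0 : nat).
Hypotheses (rho0 : 0 < rho) (rho1 : rho < 1).
Hypotheses (sigma2 : 2^-1 <= sigma) (sigma1 : sigma < 1).

Definition cap j : R := sigma ^+ j * rho ^+ (5 * j).

(** The value of [l] for which the variance term is [rho^j] times the mass, a summable relative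
    error, while the deviation [rho^-j / l = 2 sigma^j rho^(3 j)] stays negligible. *)
Definition ball_scale j : R := rho ^+ j / (2 * cap j).

Let sigma0 : 0 < sigma. Proof. by apply: lt_le_trans sigma2. Qed.

Lemma cap_gt0 j : 0 < cap j.
Proof. by rewrite mulr_gt0 ?exprn_gt0. Qed.

Hypothesis capped : forall j v, (k0 <= j)%N -> v \in words j -> cellw x v <= cap j.
Hypothesis biased : forall j, (k0 <= j)%N ->
  biasw r mur (cap j.+1) x j <= cap j.+1.
Hypothesis balls : forall j u, (k0 <= j)%N -> (size u <= j)%N ->
  increment (cap j.+1) (in_word R u) x j <=
  biasw r mur (cap j.+1) x j +
  2 * ball_scale j.+1 * cap j.+1 * qvar (in_word R u) x j +
  rho ^- j.+1 / ball_scale j.+1.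
Hypothesis total : mass x k0 [::] <= 2 ^+ k0.

(** The bias is at most one cap and the deviation is [2 cap / rho^(2 (j + 1))]. The five powers of
    [rho] in the cap bound these by one and two times [sigma^(j+1) rho^(j+1)], whence the 3. *)
Lemma mass_next j u : (k0 <= j)%N -> (size u <= j)%N ->
  mass x j.+1 u <= mass x j u * (1 + rho ^+ j.+1) + 3 * (sigma ^+ j.+1 * rho ^+ j.+1).
Proof.
move=> kj uj; have := balls kj uj; have := biased kj.
have capj v : v \in words j.+1 -> cellw x v <= cap j.+1.
  by apply: capped; exact: leqW.
rewrite -(mass_step uj capj) qvar_in_word//.
have c0 := cap_gt0 j.+1; have r0 : 0 < rho ^+ j.+1 by rewrite exprn_gt0.
have -> : 2 * ball_scale j.+1 * cap j.+1 = rho ^+ j.+1.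
  by rewrite /ball_scale; field; rewrite gt_eqF.
have -> : rho ^- j.+1 / ball_scale j.+1 = 2 * (cap j.+1 / rho ^+ j.+1 ^+ 2).
  by rewrite /ball_scale; field; rewrite !gt_eqF.
have e1 : cap j.+1 / rho ^+ j.+1 ^+ 2 <= sigma ^+ j.+1 * rho ^+ j.+1.
  rewrite ler_pdivrMr ?exprn_gt0// /cap -mulrA ler_wpM2l ?exprn_ge0 ?(ltW sigma0)//.
  rewrite -exprM -exprD ler_wiXn2l ?(ltW rho0) ?(ltW rho1)//; lia.
have e2 : cap j.+1 <= sigma ^+ j.+1 * rho ^+ j.+1.
  rewrite /cap ler_wpM2l ?exprn_ge0 ?(ltW sigma0)//.
  by rewrite ler_wiXn2l ?(ltW rho0) ?(ltW rho1)//; lia.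
rewrite mulrDr mulr1; lra.
Qed.

(** Adding [3 sigma^|u|] makes the recursion purely multiplicative, with factors
    [1 + rho^(j+1) <= expR (rho^(j+1))]; the exponent is the bounded geometric sum. *)
Lemma mass_growth k j u : (k0 <= k)%N -> (k <= j)%N -> (size u <= k)%N ->
  mass x j u + 3 * sigma ^+ size u <=
  (mass x k u + 3 * sigma ^+ size u) * expR ((1 - rho ^+ j.+1) / (1 - rho)).
Proof.
move=> k0k kj uk; have r1 : 0 < 1 - rho by rewrite subr_gt0.
elim: j kj => [|j IH].
  rewrite leqn0 => /eqP k_eq; rewrite k_eq; rewrite ler_peMr//.
    by rewrite addr_ge0 ?mass_ge0// mulr_ge0// exprn_ge0// ltW.
  by rewrite -[leLHS]expR0 ler_expR divr_ge0 ?(ltW r1)// subr_ge0 exprn_ile1 ?(ltW rho0) ?(ltW rho1).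
rewrite leq_eqVlt => /predU1P[<-|].
  rewrite ler_peMr//.
    by rewrite addr_ge0 ?mass_ge0// mulr_ge0// exprn_ge0// ltW.
  rewrite -[leLHS]expR0 ler_expR divr_ge0 ?(ltW r1)// subr_ge0.
  by rewrite exprn_ile1// ltW.
rewrite ltnS => kj; have H := IH kj.
have k0j : (k0 <= j)%N := leq_trans k0k kj.
have uj : (size u <= j)%N := leq_trans uk kj.
have N := mass_next k0j uj.
have rj : 0 < rho ^+ j.+1 by rewrite exprn_gt0.
set e := rho ^+ j.+1 in H N rj *.
have sj : sigma ^+ j.+1 <= sigma ^+ size u.
  by rewrite ler_wiXn2l ?(ltW sigma0) ?(ltW sigma1)// leqW.
have m0 := mass_ge0 x j u.
apply: (@le_trans _ _ ((mass x j u + 3 * sigma ^+ size u) * (1 + e))).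
  have : sigma ^+ j.+1 * e <= sigma ^+ size u * e by rewrite ler_wpM2r// ltW.
  by move: N; lra.
apply: (@le_trans _ _ ((mass x j u + 3 * sigma ^+ size u) * expR e)).
  rewrite ler_wpM2l ?expR_ge1Dx//.
  by rewrite addr_ge0 ?mass_ge0// mulr_ge0// exprn_ge0// ltW.
apply: (le_trans (ler_wpM2r (expR_ge0 _) H)).
rewrite -mulrA -expRD exprS -/e.
rewrite (_ : (1 - e) / (1 - rho) + e = (1 - rho * e) / (1 - rho))//.
by field; rewrite gt_eqF.
Qed.

(** A word of length at least [k0] starts at its own level, where its mass is a capped cell. A
    shorter word is bounded by the total mass, which starts at [2^k0]; since [sigma^|u| >= 2^-k0],
    this costs [4^k0]. *)
Lemma mass_le m u : (k0 <= m)%N -> (size u <= m)%N ->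
  mass x m u <= 4 * expR (1 - rho)^-1 * 4 ^+ k0 * sigma ^+ size u.
Proof.
move=> k0m um; have r1 : 0 < 1 - rho by rewrite subr_gt0.
have e1 : expR ((1 - rho ^+ m.+1) / (1 - rho)) <= expR (1 - rho)^-1.
  rewrite ler_expR ler_pdivrMr// mulVf ?gt_eqF//.
  by rewrite lerBlDr lerDl exprn_ge0// ltW.
set Pi := expR (1 - rho)^-1 in e1 *.
have Pi0 : 0 < Pi by rewrite expR_gt0.
have s0 : 0 < sigma ^+ size u by rewrite exprn_gt0.
have four : 1 <= 4 ^+ k0 :> R by rewrite exprn_ege1// ler1n.
have [ku|uk] := leqP k0 (size u).
  have := mass_growth ku um (leqnn _); rewrite mass_word.
  have : cellw x u <= sigma ^+ size u.
    have uu : u \in words (size u) by rewrite mem_words.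
    apply: (le_trans (capped ku uu)).
    rewrite /cap ler_piMr ?(ltW s0)// exprn_ile1 ?(ltW rho0) ?(ltW rho1)//.
  have := cellw_ge0 x u; set q := cellw x u => q0 qs H.
  apply: (@le_trans _ _ ((q + 3 * sigma ^+ size u) * Pi)).
    apply: le_trans (ler_wpM2l _ e1); last by rewrite addr_ge0// mulr_ge0// ltW.
    by apply: le_trans H; rewrite lerDl mulr_ge0// ltW.
  apply: (@le_trans _ _ (4 * sigma ^+ size u * Pi)).
    by rewrite ler_wpM2r ?(ltW Pi0)//; lra.
  rewrite (_ : 4 * Pi * 4 ^+ k0 * sigma ^+ size u =
    4 ^+ k0 * (4 * sigma ^+ size u * Pi)); last by ring.
  by rewrite ler_peMl// !mulr_ge0// ltW.
apply: (le_trans (mass_le_total x m u)).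
have := mass_growth (leqnn k0) k0m (leq0n _ : (size (@nil bool) <= k0)%N).
rewrite expr0 mulr1 => H.
have two : 1 <= 2 ^+ k0 :> R by rewrite exprn_ege1// ler1n.
apply: (@le_trans _ _ (4 * 2 ^+ k0 * Pi)).
  apply: (@le_trans _ _ ((mass x k0 [::] + 3) * Pi)).
    apply: le_trans (ler_wpM2l _ e1); last by rewrite addr_ge0// mass_ge0.
    by apply: le_trans H; rewrite lerDl.
  by rewrite ler_wpM2r ?(ltW Pi0)//; move: total; lra.
have : 1 <= 2 ^+ k0 * sigma ^+ size u.
  apply: (@le_trans _ _ (2 ^+ k0 * 2^-1 ^+ k0)).
    by rewrite -exprMn divff ?expr1n// pnatr_eq0.
  rewrite ler_wpM2l ?exprn_ge0//.
  apply: (@le_trans _ _ (sigma ^+ k0)).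
    by rewrite lerXn2r ?nnegrE ?invr_ge0 ?(ltW sigma0).
  by rewrite ler_wiXn2l ?(ltW sigma0) ?(ltW sigma1)// ltnW.
move=> h; rewrite (_ : 4 * Pi * 4 ^+ k0 * sigma ^+ size u =
    4 * 2 ^+ k0 * Pi * (2 ^+ k0 * sigma ^+ size u)); last first.
  by rewrite (_ : 4 = 2 * 2 :> R) ?exprMn; ring.
by rewrite ler_peMr// !mulr_ge0// ?ltW// exprn_ge0.
Qed.

End mass_growth.

Local Arguments words : simpl never.

(** * Sums of averages that decay away from the exceptional points *)

Section decaying_averages.
Context (R : realType) (J : nat) (tau : nat -> R) (C : R) (n : nat).
Context (F : R -> R).
Hypothesis C1 : 1 <= C.
Hypothesis average_le1 : forall v, `|cell_average F v| <= 1.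
Hypothesis average_decay : forall v k, (k <= size v)%N ->
  ~~ close_word J tau k (take k v) ->
  `|cell_average F v| <= C * (2 ^+ (size v + k) / 2 ^+ n).

Let C0 : 0 < C. Proof. by apply: lt_le_trans C1. Qed.

(** At scale [k] a close word has [2^(m-k)] descendants and the averages are at most [C 2^(m+k-n)].
    As [2 m <= n + 1], the product is at most [2 C] at every scale, and the [m + 1] scales
    contribute alike. *)
Lemma sum_average_le m : (n <= 2 * m)%N -> (2 * m <= n.+1)%N ->
  \sum_(v <- words m) `|cell_average F v| <= 8 * C * (1 + (5 * J * m.+1)%:R).
Proof.
move=> nm mn.
pose G k : R := C * (2 ^+ (m + k) / 2 ^+ n).
pose Y k : R := 2 ^+ (m - k).
have n0 : 0 < 2 ^+ n :> R by rewrite exprn_gt0.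
have twom : 2 ^+ (m + m) / 2 ^+ n <= 2 :> R.
  by rewrite ler_pdivrMr// -exprS ler_eXn2l ?ltr1n//; lia.
have Gm k : (k <= m)%N -> G k * Y k <= 2 * C.
  move=> km; rewrite (_ : G k * Y k = C * (2 ^+ (m + k) * 2 ^+ (m - k) / 2 ^+ n)).
    rewrite [leRHS]mulrC ler_wpM2l ?(ltW C0)// -exprD; apply: le_trans twom.
    by rewrite ler_wpM2r ?invr_ge0 ?(ltW n0)// ler_weXn2l ?ler1n//; lia.
  by rewrite /G /Y; ring.
have := @sum_layers R J tau m G Y (fun=> 1) (fun v => `|cell_average F v|).
have G0 k : 0 <= G k by rewrite mulr_ge0 ?(ltW C0) ?divr_ge0 ?exprn_ge0.
move=> /(_ G0 _ _ _ _ _).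
under eq_bigr do rewrite mul1r.
move=> H; apply: (le_trans (H _ _ _ _ _)) => //.
- move=> k; rewrite /G addnS exprS.
  rewrite (_ : C * (2 * 2 ^+ (m + k) / 2 ^+ n) = 2 * G k); last by rewrite /G; ring.
  by rewrite ler_wpM2r// ler_nat.
- by move=> v k /size_word sv km ck; rewrite /G -sv; apply: average_decay; rewrite ?sv.
- move=> v /size_word sv; apply: (le_trans (average_le1 v)).
  rewrite /G; apply: (@le_trans _ _ C) => //; rewrite ler_peMr ?(ltW C0)//.
  by rewrite ler_pdivlMr// mul1r ler_weXn2l ?ler1n//; lia.
- move=> k u km uk; under eq_bigr do rewrite mul1r.
  rewrite -natr_sum /Y -natrX ler_nat.
  have := size_words (m - k) => <-.
  rewrite (_ : \sum_(v <- words m) _ = count (fun v => take k v == u) (words m)).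
    rewrite -size_filter -(size_map (drop k)).
    apply: uniq_leq_size.
      rewrite map_inj_in_uniq ?filter_uniq ?uniq_words// => a b.
      rewrite !mem_filter => /andP[/eqP ta _] /andP[/eqP tb _] dab.
      by rewrite -[a](cat_take_drop k) -[b](cat_take_drop k) ta tb dab.
    move=> a /mapP[b]; rewrite mem_filter => /andP[_ /size_word sb] ->.
    by rewrite mem_words size_drop sb.
  by rewrite -sum1_count [RHS]big_mkcond; apply: eq_bigr => v _; case: eqP.
rewrite (_ : 8 * C * _ = 4 * (2 * C + (2 * C) * (5 * J * m.+1)%:R)); last by ring.
rewrite ler_wpM2l// lerD ?Gm//.
apply: (@le_trans _ _ (\sum_(k < m.+1) 2 * C * (5 * J)%:R)).
  apply: ler_sum => k _; rewrite mulrCA mulrC ler_wpM2r// Gm//.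
  by rewrite -ltnS.
by rewrite sumr_const card_ord -[leLHS]mulr_natr -mulrA -natrM.
Qed.

(** Because [sigma >= 1/2], the squared average at scale [k] is at most [C^2 sigma^(n-(m+1)-k)],
    which exactly compensates the mass [Y sigma^k] of a close word; when the exponent is not
    positive the trivial bound 1 is enough. *)
Lemma qvar_average_le (x : seq bool -> R) (sigma Y : R) m :
  2^-1 <= sigma -> sigma < 1 -> (n <= 2 * m.+1)%N -> 0 <= Y ->
  (forall u, (size u <= m)%N -> mass x m u <= Y * sigma ^+ size u) ->
  qvar (cell_average F) x m <=
  4 * C ^+ 2 * (sigma ^+ n / sigma ^+ m.+1) * Y * (1 + (5 * J * m.+2)%:R).
Proof.
move=> s2 s1 nm Y0 hY; have s0 : 0 < sigma by apply: lt_le_trans s2.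
pose G k : R := C ^+ 2 * (sigma ^+ n / sigma ^+ (m.+1 + k)).
pose Z k : R := Y * sigma ^+ k.
have sp k : 0 < sigma ^+ k by rewrite exprn_gt0.
have C2 : 0 <= C ^+ 2 by rewrite sqr_ge0.
have G0 k : 0 <= G k by rewrite mulr_ge0// divr_ge0// ltW.
have GZ k : G k * Z k = C ^+ 2 * (sigma ^+ n / sigma ^+ m.+1) * Y.
  by rewrite /G /Z exprD; field; rewrite !gt_eqF.
have := @sum_layers R J tau m.+1 G Z (parentw x)
  (fun v => cell_average F v ^+ 2) G0 _ _ _ _ _.
rewrite /qvar; under [X in _ -> X <= _]eq_bigr do rewrite mulrC.
move=> H; apply: (le_trans (H _ _ _ _ _)) => //.
- move=> k; rewrite /G addnS exprS.
  apply: (@le_trans _ _ (2 * (C ^+ 2 * (sigma ^+ n / sigma ^+ (m.+1 + k))))).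
    rewrite (_ : C ^+ 2 * (sigma ^+ n / (sigma * sigma ^+ (m.+1 + k))) =
      sigma^-1 * (C ^+ 2 * (sigma ^+ n / sigma ^+ (m.+1 + k)))).
      by rewrite ler_wpM2r ?G0// -[leRHS]invrK lef_pV2 ?posrE.
    by field; rewrite !gt_eqF.
  by rewrite ler_wpM2r ?G0// ler_nat.
- exact: parentw_ge0.
- move=> v k /size_word sv km ck; have := average_decay (v := v) (k := k).
  rewrite sv => /(_ km ck) h.
  rewrite -real_normK ?num_real// /G.
  have [mn|nm'] := leqP n (m.+1 + k).
    apply: (@le_trans _ _ 1); first by rewrite exprn_ile1.
    rewrite -[leLHS]mulr1 ler_pM//; first by rewrite exprn_ege1.
    by rewrite ler_pdivlMr// mul1r ler_wiXn2l ?(ltW s0) ?(ltW s1).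
  apply: (@le_trans _ _ ((C * (2 ^+ (m.+1 + k) / 2 ^+ n)) ^+ 2)).
    by rewrite lerXn2r ?nnegrE// mulr_ge0 ?(ltW C0) ?divr_ge0 ?exprn_ge0.
  rewrite exprMn ler_wpM2l//.
  have e : n = (m.+1 + k + (n - (m.+1 + k)))%N by lia.
  rewrite {1 2}e !exprD; set a := (n - _)%N.
  have -> : 2 ^+ m.+1 * 2 ^+ k / (2 ^+ m.+1 * 2 ^+ k * 2 ^+ a) = 2^-1 ^+ a :> R.
    by rewrite exprVn; field; rewrite !expf_neq0 ?pnatr_eq0.
  have -> : sigma ^+ m.+1 * sigma ^+ k * sigma ^+ a / (sigma ^+ m.+1 * sigma ^+ k)
      = sigma ^+ a by field; rewrite !gt_eqF.
  apply: (@le_trans _ _ (2^-1 ^+ a)).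
    by rewrite expr2 ler_piMl ?exprn_ge0// exprn_ile1 ?invr_ge0 ?invf_le1 ?ler1n.
  by rewrite lerXn2r ?nnegrE ?invr_ge0 ?(ltW s0).
- move=> v /size_word sv; rewrite -real_normK ?num_real//.
  apply: (@le_trans _ _ 1); first by rewrite exprn_ile1.
  rewrite /G -[leLHS]mulr1 ler_pM//; first by rewrite exprn_ege1.
  rewrite ler_pdivlMr// mul1r ler_wiXn2l ?(ltW s0) ?(ltW s1)//; lia.
- move=> k u km uk; have su := size_word uk.
  move: km; rewrite leq_eqVlt => /predU1P[km|km]; last first.
    rewrite /Z -su; apply: le_trans (hY u _); last by rewrite su -ltnS.
    rewrite mass_parent ?su -1?ltnS//; apply: ler_sum => v _.
    by rewrite /in_word su.
  (* The mass bound covers lengths up to [m] only. For [|u| = m + 1] the sum reduces to half the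
     mass of the parent of [u], at most [Y sigma^(m+1)] since [sigma >= 1/2]. *)
  rewrite km in uk su *.
  rewrite (bigD1_seq u uk (uniq_words _))/= -[in take _ u]su take_size eqxx mulr1.
  rewrite big_seq_cond [X in _ + X]big1 ?addr0; last first.
    move=> v /andP[vm vu]; rewrite -(size_word vm) take_size (negbTE vu).
    by rewrite mulr0.
  case/lastP: u su {uk} => // u b; rewrite size_rcons => -[su].
  rewrite parentw_rcons -mass_word su.
  apply: (@le_trans _ _ (2^-1 * (Y * sigma ^+ m))).
    by rewrite ler_wpM2l// -[in leRHS]su hY ?su.
  rewrite /Z exprS mulrCA ler_wpM2l// ler_wpM2r// ltW//.
rewrite GZ.
rewrite (eq_bigr (fun=> (5 * J)%:R * (C ^+ 2 * (sigma ^+ n / sigma ^+ m.+1) * Y))).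
  rewrite sumr_const card_ord -[X in _ + X]mulr_natr.
  rewrite le_eqVlt; apply/orP; left; apply/eqP.
  by rewrite [in RHS]natrM; ring.
by move=> k _; rewrite mulrCA GZ.
Qed.

End decaying_averages.

(** This is [prim_phase_oscillation] with [mu = 2^-k]: the cell of [v] is no longer than that, and
    it keeps this distance from the points when its ancestor at scale [k] is not close. *)
Lemma arc_averages (R : realType) (g : R -> R * R) : nondegenerate_C2_arc g ->
  exists J : nat, exists2 C : R, 1 <= C &
  forall xi th n, 2 ^+ n <= norm1 xi -> exists tau : nat -> R,
    (forall v, `|cell_average (prim (arc_phase g xi th)) v| <= 1) /\
    (forall v k, (k <= size v)%N -> ~~ close_word J tau k (take k v) ->
      `|cell_average (prim (arc_phase g xi th)) v| <=
      C * (2 ^+ (size v + k) / 2 ^+ n)).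
Proof.
move=> garc; have [J [C C0 H]] := prim_phase_oscillation garc.
exists J, (C + 1); first by rewrite lerDr ltW.
move=> xi th n nxi; have n0 : 0 < 2 ^+ n :> R by rewrite exprn_gt0.
have N0 : 0 < norm1 xi by apply: lt_le_trans nxi.
have [tau htau] := H xi th N0; exists tau.
have h0 k : 0 < 2^-1 ^+ k :> R by rewrite exprn_gt0 ?invr_gt0.
split=> [v|v k kv ck].
  have [v0 v1] := @word_point_itv R v.
  rewrite /cell_average normrM ger0_norm ?exprn_ge0//.
  have := @prim_le R _ (continuous_arc_phase (xi := xi) (th := th) garc)
    (word_point R v) (word_point R v + 2^-1 ^+ size v) 1 _ _
    (arc_phase_le1 g xi th).
  rewrite addrAC subrr add0r mul1r => /(_ _ _) h.
  apply: (@le_trans _ _ (2 ^+ size v * 2^-1 ^+ size v)).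
    rewrite ler_wpM2l ?exprn_ge0// h//; first lra.
    by rewrite lerDl ltW.
  by rewrite -exprMn divff ?expr1n// pnatr_eq0.
have [v0 v1] := @word_point_itv R v.
have [t1 t2] := @word_point_take R v k kv.
rewrite /cell_average normrM ger0_norm ?exprn_ge0//.
have far t i : t \in `[word_point R v, word_point R v + 2^-1 ^+ size v] ->
    (i < J)%N -> 2^-1 ^+ k <= `|t - tau i|.
  rewrite in_itv/= => /andP[tv1 tv2] iJ.
  have : 2 * 2^-1 ^+ k <= `|word_point R (take k v) - tau i|.
    rewrite leNgt; apply: contra ck => h; apply/existsP.
    by exists (Ordinal iJ).
  have := ler_normD (word_point R (take k v) - t) (t - tau i).
  rewrite subrKA; have : `|word_point R (take k v) - t| <= 2^-1 ^+ k.
    by rewrite ler_norml; apply/andP; split; lra.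
  lra.
have sz : word_point R v + 2^-1 ^+ size v - word_point R v <= 2^-1 ^+ k.
  by rewrite addrAC subrr add0r ler_wiXn2l ?invr_ge0// invf_le1 ?ler1n.
have := htau _ _ _ v0 _ v1 sz far; rewrite ltrDl => /(_ (h0 _)) h.
apply: (@le_trans _ _ (2 ^+ size v * (C / (norm1 xi * 2^-1 ^+ k)))).
  by rewrite ler_wpM2l ?exprn_ge0.
rewrite (_ : 2 ^+ size v * (C / (norm1 xi * 2^-1 ^+ k)) =
   C * (2 ^+ (size v + k) / norm1 xi)); last first.
  by rewrite exprD exprVn; field; rewrite !gt_eqF ?exprn_gt0.
rewrite ler_pM ?(ltW C0) ?divr_ge0 ?exprn_ge0 ?(ltW N0)//.
  by rewrite lerDl.
by rewrite ler_wpM2l ?exprn_ge0// lef_pV2.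
Qed.

(** The invariant [j rho^j (1 - rho) + rho^j <= 1] is inductive and bounds [j rho^j] by
    [1 / (1 - rho)]. *)
Lemma poly_geom_bounded (R : realType) (rho N : R) : 0 < rho -> rho < 1 -> 0 <= N ->
  exists2 K, 0 < K & forall j : nat, rho ^+ j * (1 + N * j.+1%:R) <= K.
Proof.
move=> r0 r1 N0; have r1' : 0 < 1 - rho by rewrite subr_gt0.
have main j : j%:R * rho ^+ j * (1 - rho) + rho ^+ j <= 1.
  elim: j => [|j IH]; first by rewrite mul0r mul0r add0r expr0.
  have p1 : rho ^+ j <= 1 by rewrite exprn_ile1 ?(ltW r0) ?(ltW r1).
  have p0 : 0 <= rho ^+ j by rewrite exprn_ge0 ?(ltW r0).
  rewrite (_ : _ + _ = rho * (j%:R * rho ^+ j * (1 - rho) + rho ^+ j) +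
    rho * rho ^+ j * (1 - rho)); last by rewrite exprS -natr1; ring.
  apply: (@le_trans _ _ (rho * 1 + 1 * (1 - rho))); last lra.
  by rewrite lerD// ?ler_wpM2l ?ler_wpM2r ?(ltW r0) ?(ltW r1')// mulr_ile1 ?(ltW r0) ?(ltW r1).
exists (1 + N + N / (1 - rho)).
  by rewrite ltr_wpDr ?divr_ge0 ?(ltW r1')// ltr_wpDr.
move=> j.
have p1 : rho ^+ j <= 1 by rewrite exprn_ile1 ?(ltW r0) ?(ltW r1).
have p0 : 0 <= rho ^+ j by rewrite exprn_ge0 ?(ltW r0).
have e : j%:R * rho ^+ j <= (1 - rho)^-1.
  rewrite -[leRHS]mul1r ler_pdivlMr//; apply: le_trans (main j).
  by rewrite lerDl.
have -> : rho ^+ j * (1 + N * j.+1%:R) = rho ^+ j * (1 + N) + N * (j%:R * rho ^+ j).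
  by rewrite -natr1; ring.
rewrite lerD// ?ler_wpM2l//.
by rewrite ler_piMl// addr_ge0.
Qed.

Section value_bound.
Context (R : realType) (r mur rho q C : R) (J : nat).
Hypotheses (rho0 : 0 < rho) (rho1 : rho < 1).
Hypotheses (q0 : 0 < q) (q1 : q < 1) (q2 : 2^-1 <= q ^+ 2) (C1 : 1 <= C).

(** With [q^2 = 2^-s], the deviation [rho^-j / l] becomes [2 q^n rho^j]: the target rate times a
    summable factor. The constraint [l * cap <= 1/2] holds as soon as [n <= 2 j]. *)
Definition osc_scale (n j : nat) : R := (2 * q ^+ n * rho ^+ (2 * j))^-1.

Let Pi := expR (1 - rho)^-1.

(** At the level [m0], about [n / 2], the largest cell [q^(2 m0) rho^(5 m0)] times the sum of the
    averages is [O(q^n)]; every later level adds at most a multiple of [q^n rho^(j+1)]. *)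
Lemma cascade_value_bound : exists2 K, 0 < K &
  forall (x : seq bool -> R) (F : R -> R) (tau : nat -> R) (n k0 m0 : nat),
  (forall v, `|cell_average F v| <= 1) ->
  (forall v k, (k <= size v)%N -> ~~ close_word J tau k (take k v) ->
    `|cell_average F v| <= C * (2 ^+ (size v + k) / 2 ^+ n)) ->
  (n <= 2 * m0)%N -> (2 * m0 <= n.+1)%N -> (k0 <= m0)%N ->
  4 ^+ k0 * rho ^+ m0 <= 1 ->
  (forall j v, (k0 <= j)%N -> v \in words j -> cellw x v <= cap rho (q ^+ 2) j) ->
  (forall j, (k0 <= j)%N ->
    biasw r mur (cap rho (q ^+ 2) j.+1) x j <= cap rho (q ^+ 2) j.+1) ->
  (forall m u, (k0 <= m)%N -> (size u <= m)%N ->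
    mass x m u <= 4 * Pi * 4 ^+ k0 * (q ^+ 2) ^+ size u) ->
  (forall j, (m0 <= j)%N ->
    `|increment (cap rho (q ^+ 2) j.+1) (cell_average F) x j| <=
    biasw r mur (cap rho (q ^+ 2) j.+1) x j +
    2 * osc_scale n j.+1 * cap rho (q ^+ 2) j.+1 * qvar (cell_average F) x j +
    rho ^- j.+1 / osc_scale n j.+1) ->
  forall m, (m0 <= m)%N -> `|cascade_value F x m| <= K * q ^+ n.
Proof.
have [K1 K10 HK1] := poly_geom_bounded rho0 rho1 (ler0n R (5 * J)).
have C0 : 0 < C by apply: lt_le_trans C1.
have Pi0 : 0 < Pi by rewrite expR_gt0.
have r1 : 0 < 1 - rho by rewrite subr_gt0.
pose Ks := 3 + 16 * C ^+ 2 * Pi * K1.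
have Ks0 : 0 < Ks.
  have : 0 <= 16 * C ^+ 2 * Pi * K1 by apply: mulr_ge0 (ltW K10); apply: mulr_ge0 (ltW Pi0); apply: mulr_ge0 => //; exact: sqr_ge0.
  rewrite /Ks; lra.
exists (8 * C * K1 + Ks / (1 - rho)).
  by rewrite addr_gt0 ?divr_gt0// !mulr_gt0.
move=> x F tau n k0 m0 le1 decay nm mn k0m k4 capped biased masses osc.
have qn0 k : 0 < q ^+ k by rewrite exprn_gt0.
have rn0 k : 0 < rho ^+ k by rewrite exprn_gt0.
have qle a b : (a <= b)%N -> q ^+ b <= q ^+ a.
  by move=> ab; rewrite ler_wiXn2l ?(ltW q0) ?(ltW q1).
have rle a b : (a <= b)%N -> rho ^+ b <= rho ^+ a.
  by move=> ab; rewrite ler_wiXn2l ?(ltW rho0) ?(ltW rho1).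
have capE j : cap rho (q ^+ 2) j = q ^+ (2 * j) * rho ^+ (5 * j).
  by rewrite /cap -exprM.
have caple j : (m0 <= j)%N -> cap rho (q ^+ 2) j <= q ^+ n * rho ^+ j.
  move=> mj; rewrite capE ler_pM ?(ltW (qn0 _)) ?(ltW (rn0 _))//.
    by apply: qle; rewrite (leq_trans nm)// leq_mul2l.
  by apply: rle; rewrite leq_pmull.
have init : `|cascade_value F x m0| <= 8 * C * K1 * q ^+ n.
  apply: (le_trans (ler_norm_sum _ _ _)).
  apply: (@le_trans _ _ (\sum_(v <- words m0)
    cap rho (q ^+ 2) m0 * `|cell_average F v|)).
    rewrite big_seq [leRHS]big_seq; apply: ler_sum => v vm.
    by rewrite normrM (ger0_norm (cellw_ge0 _ _)) ler_wpM2r// capped.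
  rewrite -mulr_sumr.
  apply: (@le_trans _ _ (q ^+ n * rho ^+ m0 * (8 * C * (1 + (5 * J * m0.+1)%:R)))).
    rewrite ler_pM ?caple ?sumr_ge0//; first by rewrite capE mulr_ge0 ?ltW.
    exact: sum_average_le (le1) (decay) _ nm mn.
  rewrite (_ : _ * _ = 8 * C * q ^+ n * (rho ^+ m0 * (1 + (5 * J)%:R * m0.+1%:R))).
    rewrite [leRHS]mulrAC ler_wpM2l// !mulr_ge0 ?(ltW C0) ?(ltW (qn0 n))//.
  by rewrite natrM; ring.
have step j : (m0 <= j)%N ->
    `|cascade_value F x j.+1 - cascade_value F x j| <= Ks * q ^+ n * rho ^+ j.+1.
  move=> mj; have kj : (k0 <= j)%N by apply: leq_trans mj.
  rewrite (@cascade_value_step _ F (cap rho (q ^+ 2) j.+1)); last first.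
    by move=> v vj; apply: capped => //; exact: leqW.
  apply: (le_trans (osc j mj)).
  have b := le_trans (biased j kj) (caple j.+1 (leqW mj)).
  have t3 : rho ^- j.+1 / osc_scale n j.+1 = 2 * (q ^+ n * rho ^+ j.+1).
    rewrite /osc_scale invrK mulnC exprM; field; by rewrite gt_eqF.
  have Y0 : 0 <= 4 * Pi * 4 ^+ k0 by rewrite !mulr_ge0 ?exprn_ge0 ?(ltW Pi0).
  have q21 : q ^+ 2 < 1 by rewrite exprn_ilt1 ?(ltW q0).
  have nj : (n <= 2 * j.+1)%N by rewrite (leq_trans nm)// leq_mul2l leqW.
  have := qvar_average_le C1 le1 decay (x := x) q2 q21 nj Y0
    (fun u uj => masses j u kj uj).
  set V := qvar _ _ _; rewrite -!exprM => hV.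
  have t2 : 2 * osc_scale n j.+1 * cap rho (q ^+ 2) j.+1 * V <=
      16 * C ^+ 2 * Pi * K1 * (q ^+ n * rho ^+ j.+1).
    have a0 : 0 <= 2 * osc_scale n j.+1 * cap rho (q ^+ 2) j.+1.
      rewrite capE !mulr_ge0 ?(ltW (qn0 _)) ?(ltW (rn0 _))//.
      by rewrite /osc_scale invr_ge0 !mulr_ge0 ?(ltW (qn0 _)) ?(ltW (rn0 _)).
    apply: (le_trans (ler_wpM2l a0 hV)).
    rewrite capE /osc_scale.
    (* The five powers of [rho^(j+1)] in the cap are spent here: two cancel against [osc_scale], one
       absorbs [4^k0], one the number of layers, and one is left for the sum over levels. *)
    have -> : 2 * (2 * q ^+ n * rho ^+ (2 * j.+1))^-1 *
       (q ^+ (2 * j.+1) * rho ^+ (5 * j.+1)) *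
       (4 * C ^+ 2 * (q ^+ (2 * n) / q ^+ (2 * j.+1)) * (4 * Pi * 4 ^+ k0) *
         (1 + (5 * J * j.+2)%:R)) =
       (16 * C ^+ 2 * Pi) * (4 ^+ k0 * rho ^+ j.+1) *
        (rho ^+ j.+1 * (1 + (5 * J)%:R * j.+2%:R)) * (q ^+ n * rho ^+ j.+1).
      have -> : (5 * j.+1 = 2 * j.+1 + (j.+1 + (j.+1 + j.+1)))%N by clear; lia.
      have -> : (2 * n = n + n)%N by rewrite mul2n addnn.
      rewrite [(5 * J * j.+2)%:R]natrM !exprD.
      move: (qn0 n) (qn0 (2 * j.+1)%N) (rn0 (2 * j.+1)%N).
      move: (q ^+ n) (q ^+ (2 * j.+1)) (rho ^+ (2 * j.+1)) => u1 u2 u3 h1 h2 h3.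
      by field; rewrite !gt_eqF.
    rewrite ler_wpM2r ?mulr_ge0 ?(ltW (qn0 _)) ?(ltW (rn0 _))//.
    have CP : 0 <= 16 * C ^+ 2 * Pi.
      by apply: mulr_ge0 (ltW Pi0); apply: mulr_ge0 => //; exact: sqr_ge0.
    rewrite -mulrA ler_wpM2l//.
    rewrite -[leRHS]mul1r ler_pM ?HK1//.
    - by rewrite (mulr_ge0 _ (ltW (rn0 _)))// exprn_ge0.
    - by apply: (mulr_ge0 (ltW (rn0 _))); rewrite -natrM addr_ge0.
    - apply: le_trans k4; rewrite ler_wpM2l ?exprn_ge0//.
      by apply: rle; exact: leqW.
  rewrite t3; apply: (@le_trans _ _ (q ^+ n * rho ^+ j.+1 +
    16 * C ^+ 2 * Pi * K1 * (q ^+ n * rho ^+ j.+1) + 2 * (q ^+ n * rho ^+ j.+1))).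
    by rewrite lerD2r lerD.
  rewrite /Ks le_eqVlt; apply/orP; left; apply/eqP; ring.
have ind m : (m0 <= m)%N -> `|cascade_value F x m| <=
    8 * C * K1 * q ^+ n + Ks * q ^+ n * ((1 - rho ^+ m) / (1 - rho)).
  elim: m => [|m IH].
    rewrite leqn0 => /eqP m0E; move: init; rewrite m0E => /le_trans; apply.
    by rewrite lerDl expr0 subrr mul0r mulr0.
  rewrite leq_eqVlt => /predU1P[m0E|].
    move: init; rewrite m0E => /le_trans; apply.
    rewrite lerDl !mulr_ge0 ?(ltW Ks0) ?(ltW (qn0 _)) ?invr_ge0 ?(ltW r1)//.
    by rewrite subr_ge0 exprn_ile1 ?(ltW rho0) ?(ltW rho1).
  rewrite ltnS => mm; have h1 := IH mm; have h2 := step m mm.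
  have := ler_normD (cascade_value F x m.+1 - cascade_value F x m)
    (cascade_value F x m); rewrite subrK => /le_trans; apply.
  apply: (le_trans (lerD h2 h1)).
  rewrite addrCA lerD2l -mulrDr ler_wpM2l ?mulr_ge0 ?(ltW Ks0) ?(ltW (qn0 _))//.
  rewrite -(@ler_pM2r _ (1 - rho))// mulrDl !divfK ?gt_eqF//.
  rewrite exprS; have := rn0 m; have : rho ^+ m * rho * (1 - rho) <= rho ^+ m * 1 * (1 - rho).
    by rewrite ler_wpM2r ?(ltW r1)// ler_wpM2l ?(ltW (rn0 m)) ?(ltW rho1).
  lra.
move=> m mm; apply: (le_trans (ind m mm)).
rewrite [leRHS]mulrDl lerD2l (_ : Ks / (1 - rho) * q ^+ n =
  Ks * q ^+ n * (1 - rho)^-1); last by ring.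
rewrite ler_wpM2l// ?mulr_ge0 ?(ltW Ks0) ?(ltW (qn0 n))//.
by rewrite ler_piMl ?invr_ge0 ?(ltW r1)// lerBlDr lerDl ltW.
Qed.

End value_bound.

(** * The exceptional event *)

Section union_bounds.
Context d (T : measurableType d) (R : realType) (P : probability T R).

Lemma measure_seq_union_le (I : choiceType) (s : seq I) (E : I -> set T) (e : R) :
  (forall i, i \in s -> measurable (E i)) ->
  (forall i, i \in s -> (P (E i) <= e%:E)%E) ->
  (P (\bigcup_(i in [set` s]) E i) <= ((size s)%:R * e)%:E)%E.
Proof.
elim: s => [|i s IH] mE PE; first by rewrite bigcup_seq big_nil measure0 mul0r.
rewrite bigcup_seq big_cons -bigcup_seq.
have mE' j : j \in s -> measurable (E j).
  by move=> js; apply: mE; rewrite inE js orbT.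
have PE' j : j \in s -> (P (E j) <= e%:E)%E.
  by move=> js; apply: PE; rewrite inE js orbT.
have iis : i \in i :: s by rewrite inE eqxx.
apply: (le_trans (measureU2 _ _ _)).
- exact: mE.
- by apply: fin_bigcup_measurable => [|j /mE']; first exact: finite_seq.
rewrite -natr1 mulrDl mul1r addrC EFinD leeD ?PE//.
exact: IH.
Qed.

Lemma measure_geometric_union_le (E : nat -> set T) (K rho : R) (k : nat) :
  0 <= K -> 0 < rho -> rho < 1 -> (forall j, measurable (E j)) ->
  (forall j, (k <= j)%N -> (P (E j) <= (K * rho ^+ j)%:E)%E) ->
  (P (\bigcup_(j in [set j | (k <= j)%N]) E j) <=
   (K / (1 - rho) * rho ^+ k)%:E)%E.
Proof.
move=> K0 r0 r1 mE PE; have r1' : 0 < 1 - rho by rewrite subr_gt0.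
apply: (@le_trans _ _ (\sum_(i <oo) P (E (i + k)%N))%E).
  apply: measure_sigma_subadditive => //.
    by apply: bigcup_measurable => j _.
  move=> w [j /= kj Ew]; exists (j - k)%N => //=.
  by rewrite subnK.
apply: lime_le; first exact: is_cvg_nneseries.
near=> N.
apply: (@le_trans _ _ (\sum_(0 <= i < N) (K * rho ^+ (i + k))%:E)%E).
  by apply: lee_sum => i _; apply: PE; exact: leq_addl.
rewrite sumEFin lee_fin.
have -> : \sum_(0 <= i < N) K * rho ^+ (i + k) =
    K / (1 - rho) * rho ^+ k * (1 - rho ^+ N).
  elim: {+}N => [|M IH]; first by rewrite big_geq// expr0 subrr mulr0.
  rewrite big_nat_recr//= IH exprD exprS; field.
  by rewrite gt_eqF.
rewrite ler_piMr ?mulr_ge0 ?invr_ge0 ?(ltW r1') ?exprn_ge0 ?(ltW r0)//.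
by rewrite lerBlDr lerDl exprn_ge0 ?(ltW r0).
Unshelve. all: by end_near. Qed.

End union_bounds.

(** With [y = rho^-j], use [expR y >= y^(N+1) / (N+1)!] for an [N] such that
    [y^N = (rho^-N)^j >= D^j]; the remaining factor of [y] gives [rho^j]. It absorbs union bounds
    over [D^j] events. *)
Lemma expR_tail (R : realType) (rho D : R) : 0 < rho -> rho < 1 -> 1 <= D ->
  exists2 K, 0 < K & forall j : nat, D ^+ j * expR (- rho ^- j) <= K * rho ^+ j.
Proof.
move=> r0 r1 D1; have D0 : 0 < D by apply: lt_le_trans D1.
have [N _ /(_ N (leqnn N)) hN] : \forall N \near \oo, `|0 - rho ^+ N| < D^-1 * rho.
  have := cvg_expr (z := rho); rewrite ger0_norm ?(ltW r0)// => /(_ r1).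
  by move/cvgrPdist_lt; apply; rewrite mulr_gt0 ?invr_gt0.
move: hN; rewrite /= sub0r normrN ger0_norm ?exprn_ge0 ?(ltW r0)// => hN.
exists (N.+1`!%:R); first by rewrite ltr0n fact_gt0.
move=> j; set y : R := rho ^- j; have y0 : 0 < y by rewrite invr_gt0 exprn_gt0.
have f0 : 0 < N.+1`!%:R :> R by rewrite ltr0n fact_gt0.
have h : y ^+ N.+1 / N.+1`!%:R <= expR y.
  apply: le_trans (expR_ge1Dxn N (ltW y0)); by rewrite lerDr.
rewrite expRN ler_pdivrMr ?expR_gt0//.
apply: (@le_trans _ _ (N.+1`!%:R * rho ^+ j * (y ^+ N.+1 / N.+1`!%:R))); last first.
  by rewrite ler_wpM2l// mulr_ge0 ?(ltW f0) ?exprn_ge0 ?(ltW r0).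
rewrite (_ : _ * (y ^+ N.+1 / _) = rho ^+ j * y ^+ N.+1); last first.
  by field; rewrite gt_eqF.
rewrite exprS mulrA mulfV ?mul1r ?expf_neq0 ?gt_eqF//.
rewrite /y exprVn -exprM mulnC exprM -exprVn lerXn2r ?nnegrE ?invr_ge0 ?exprn_ge0
  ?(ltW r0) ?(ltW D0)//.
rewrite -[D]invrK lef_pV2 ?posrE ?invr_gt0 ?exprn_gt0//.
apply: (le_trans (ltW hN)); rewrite ler_piMr ?invr_ge0 ?(ltW D0) ?(ltW r1)//.
Qed.

Section bad_events.
Context d (T : measurableType d) (R : realType) (P : probability T R).
Context (W : seq bool -> {RV P >-> R}) (r mur : R).
Hypothesis indW : independent_RVs [set v | v != [::]] W.
Hypothesis r1 : 1 < r.
Hypothesis law1 : forall v, v != [::] ->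
  (\int[distribution P (W v)]_y (Num.max y 0)%:E = 1)%E.
Hypothesis lawr : forall v, v != [::] ->
  (\int[distribution P (W v)]_y (Num.max y 0 `^ r)%:E = mur%:E)%E.
Context (rho q : R).
Hypotheses (rho0 : 0 < rho) (rho1 : rho < 1) (rho2 : 2^-1 <= rho).
Hypotheses (q0 : 0 < q) (q1 : q < 1).
Hypothesis moment_small : 2 `^ (1 - r) * mur <= (q ^+ 2 * rho ^+ 10) `^ r.

Notation X w := (fun v : seq bool => W v w).
Notation M := (cap rho (q ^+ 2)).

Definition upto (j : nat) : seq (seq bool) :=
  flatten [seq words i | i <- iota 0 j.+1].

Lemma mem_upto j u : (u \in upto j) = (size u <= j)%N.
Proof.
apply/flatten_mapP/idP => [[k]|uj].
  by rewrite mem_iota add0n ltnS /= => kj; rewrite mem_words => /eqP ->.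
by exists (size u); rewrite ?mem_words// mem_iota add0n ltnS.
Qed.

Lemma size_upto j : (size (upto j) <= 2 ^ j.+1)%N.
Proof.
rewrite /upto size_flatten /shape -map_comp.
rewrite (eq_map (g := fun i => 2 ^ i)%N); last by move=> i /=; exact: size_words.
have H k : (\sum_(0 <= i < k) 2 ^ i <= 2 ^ k)%N.
  elim: k => [|k IH]; first by rewrite big_geq.
  by rewrite big_nat_recr//= expnS mul2n -addnn leq_add2r.
by rewrite sumnE big_map; have := H j.+1; rewrite /index_iota subn0.
Qed.

Definition cap_event j : set T :=
  \bigcup_(v in [set` words j]) [set w | (M j < cellw (X w) v)%R].

Definition bias_event j : set T :=
  [set w | (M j.+1 < biasw r mur (M j.+1) (X w) j)%R].

(* [l] is the inverse temperature of the exponential bound; the event has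
   probability at most [exp (- rho ^- j.+1)]. *)
Definition fluctuation (l : R) j (c : seq bool -> R) : set T :=
  [set w | (biasw r mur (M j.+1) (X w) j + 2 * l * M j.+1 * qvar c (X w) j +
            rho ^- j.+1 / l < increment (M j.+1) c (X w) j)%R].

Definition ball_event j : set T := \bigcup_(u in [set` upto j])
  fluctuation (ball_scale rho (q ^+ 2) j.+1) j (in_word R u).

Definition level_event j : set T := cap_event j `|` bias_event j `|` ball_event j.

Definition mass_event k : set T :=
  [set w | (2 ^+ k < \sum_(v <- words k) cellw (X w) v)%R].

Let s0 : 0 < q ^+ 2. Proof. by rewrite exprn_gt0. Qed.

Let M0 j : 0 < M j. Proof. by rewrite mulr_gt0 ?exprn_gt0. Qed.

Lemma measurable_cap_event j : measurable (cap_event j).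
Proof.
apply: fin_bigcup_measurable => [|v _]; first exact: finite_seq.
by apply: measurable_gt_set; exact: measurable_cellw.
Qed.

Lemma measurable_bias_event j : measurable (bias_event j).
Proof. by apply: measurable_gt_set; exact: measurable_biasw. Qed.

Lemma measurable_fluctuation l j c : measurable (fluctuation l j c).
Proof.
rewrite /fluctuation; under eq_set do rewrite -subr_gt0.
apply: measurable_gt_set; apply: measurable_funB.
  exact: measurable_increment.
apply: measurable_funD => //; apply: measurable_funD.
  exact: measurable_biasw.
by apply: measurable_funM => //; exact: measurable_qvar.
Qed.

Lemma measurable_level_event j : measurable (level_event j).
Proof.
apply: measurableU; first apply: measurableU.
- exact: measurable_cap_event.
- exact: measurable_bias_event.
- apply: fin_bigcup_measurable => [|v _]; first exact: finite_seq.
  exact: measurable_fluctuation.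
Qed.

Lemma measurable_mass_event k : measurable (mass_event k).
Proof.
by apply: measurable_gt_set; apply: measurable_sum => v; exact: measurable_cellw.
Qed.

Lemma fluctuation_tail l j c : (forall v, `|c v| <= 1) -> 0 < l ->
  l * M j.+1 <= 2^-1 -> (P (fluctuation l j c) <= (expR (- rho ^- j.+1))%:E)%E.
Proof. by move=> c1 l0 lM; exact: increment_tail. Qed.

(** The numerator is at most [(rho^(5 j) M j)^r]: ten powers of [rho] in the moment hypothesis
    against five in the cap leave [rho^(5 j r)]. *)
Let moment_ratio j : (2 `^ (1 - r) * mur) ^+ j / M j `^ r <= rho ^+ j.
Proof.
have r0 : 0 < r by apply: lt_trans r1.
have mur0 : 0 <= mur by exact: (mur_ge0 (lawr (v := [:: true]) isT)).
rewrite ler_pdivrMr ?powR_gt0//.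
apply: (@le_trans _ _ (((q ^+ 2 * rho ^+ 10) `^ r) ^+ j)).
  by rewrite lerXn2r ?nnegrE ?mulr_ge0 ?powR_ge0.
rewrite -powR_mulrn ?powR_ge0// -powRrM [r * _]mulrC powRrM powR_mulrn; last first.
  by rewrite mulr_ge0 ?exprn_ge0 ?(ltW q0) ?(ltW rho0).
rewrite (_ : (q ^+ 2 * rho ^+ 10) ^+ j = rho ^+ (5 * j) * M j); last first.
  by rewrite /cap exprMn -!exprM mulrCA -exprD; congr (_ * _ ^+ _); lia.
rewrite powRM ?exprn_ge0 ?(ltW rho0) ?(ltW (M0 j))// ler_wpM2r ?powR_ge0//.
apply: (@le_trans _ _ ((rho ^+ j) `^ r)).
  rewrite ge0_ler_powR ?nnegrE ?exprn_ge0 ?(ltW r0) ?(ltW rho0)//.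
  by rewrite ler_wiXn2l ?(ltW rho0) ?(ltW rho1)//; lia.
have [->|j0] := eqVneq (rho ^+ j) 1; first by rewrite powR1.
rewrite -[leRHS]powRr1 ?exprn_ge0 ?(ltW rho0)//.
by rewrite ger_powR ?(ltW r1)// exprn_gt0//= exprn_ile1 ?(ltW rho0) ?(ltW rho1).
Qed.

Lemma level_event_tail (K : R) : 0 < K ->
  (forall j : nat, 2 ^+ j * expR (- rho ^- j) <= K * rho ^+ j) ->
  forall j, (P (level_event j) <= ((2 + 2 * K) * rho ^+ j)%:E)%E.
Proof.
move=> K0 HK j.
have h1 : (P (cap_event j) <= (rho ^+ j)%:E)%E.
  apply: (le_trans (cellw_tail indW r1 lawr j (M0 j))).
  by rewrite lee_fin.
have h2 : (P (bias_event j) <= (rho ^+ j)%:E)%E.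
  apply: (le_trans (biasw_tail indW lawr j (M0 j.+1))).
  rewrite lee_fin (le_trans (moment_ratio j.+1))//.
  by rewrite ler_wiXn2l ?(ltW rho0) ?(ltW rho1).
have h3 : (P (ball_event j) <= (2 * K * rho ^+ j)%:E)%E.
  apply: (@le_trans _ _ (((size (upto j))%:R * expR (- rho ^- j.+1))%:E)).
    apply: measure_seq_union_le => u _; first exact: measurable_fluctuation.
    apply: fluctuation_tail.
    - by move=> v; rewrite /in_word; case: eqP; rewrite ?normr1 ?normr0.
    - by rewrite /ball_scale divr_gt0 ?exprn_gt0// mulr_gt0.
    - have := M0 j.+1; rewrite /ball_scale; move: (M j.+1) => y y0.
      rewrite (_ : rho ^+ j.+1 / (2 * y) * y = rho ^+ j.+1 * 2^-1); last by field; rewrite gt_eqF.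
      by rewrite ler_piMl// exprn_ile1 ?(ltW rho0) ?(ltW rho1).
  rewrite lee_fin; apply: (@le_trans _ _ (2 ^+ j.+1 * expR (- rho ^- j.+1))).
    by rewrite ler_wpM2r ?expR_ge0// -natrX ler_nat size_upto.
  apply: (le_trans (HK j.+1)); rewrite exprS mulrA.
  rewrite ler_wpM2r ?exprn_ge0 ?(ltW rho0)// mulrC ler_wpM2r ?(ltW K0)//.
  by rewrite (le_trans (ltW rho1))// ler1n.
rewrite /level_event (le_trans (measureU2 _ _ _))//.
- by apply: measurableU; [exact: measurable_cap_event|exact: measurable_bias_event].
- apply: fin_bigcup_measurable => [|v _]; first exact: finite_seq.
  exact: measurable_fluctuation.
rewrite (_ : (2 + 2 * K) * rho ^+ j = rho ^+ j + rho ^+ j + 2 * K * rho ^+ j); last by ring.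
rewrite [leRHS]EFinD leeD//.
rewrite (le_trans (measureU2 _ _ _))//.
- exact: measurable_cap_event.
- exact: measurable_bias_event.
- by rewrite EFinD leeD.
Qed.

Lemma mass_event_tail k : (P (mass_event k) <= (rho ^+ k)%:E)%E.
Proof.
apply: (le_trans (mass_tail indW law1 k (exprn_gt0 k (ltr0n R 2)))).
by rewrite lee_fin -exprVn lerXn2r ?nnegrE ?invr_ge0 ?(ltW rho0).
Qed.

End bad_events.

(** * Finite nets of the dyadic annuli *)

Section nets.
Context (R : realType).
Implicit Types (xi : R * R) (n l : nat).

Definition annulus n : set (R * R) := [set xi | 2 ^+ n <= enorm xi <= 2 ^+ n.+1].

Lemma enorm_le_norm1 xi : enorm xi <= norm1 xi.
Proof.
rewrite /enorm /norm1 -[leRHS]ger0_norm ?addr_ge0// -sqrtr_sqr ler_sqrt ?sqr_ge0//.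
rewrite sqrrD -(real_normK (num_real xi.1)) -(real_normK (num_real xi.2)).
by rewrite lerD2r lerDl mulrn_wge0// mulr_ge0.
Qed.

Lemma fst_le_enorm xi : `|xi.1| <= enorm xi.
Proof. by rewrite -sqrtr_sqr ler_sqrt ?lerDl ?sqr_ge0// addr_ge0 ?sqr_ge0. Qed.

Lemma snd_le_enorm xi : `|xi.2| <= enorm xi.
Proof. by rewrite -sqrtr_sqr ler_sqrt ?lerDr ?sqr_ge0// addr_ge0 ?sqr_ge0. Qed.

Definition grid_cell n l (i j : nat) : set (R * R) :=
  [set xi | annulus n xi /\
    Num.truncn ((xi.1 + 2 ^+ n.+1) * 2 ^+ l) = i /\
    Num.truncn ((xi.2 + 2 ^+ n.+1) * 2 ^+ l) = j].

(** A representative inside the annulus, where the lower bound on the frequency holds. The default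
    [(2^n, 0)] also lies in the annulus, so empty grid cells do no harm. *)
Definition grid_point n l (i j : nat) : R * R :=
  xget (2 ^+ n, 0) (grid_cell n l i j).

Definition net n l : seq (R * R) :=
  [seq grid_point n l i j | i <- iota 0 (2 ^ (n.+2 + l)).+1,
                            j <- iota 0 (2 ^ (n.+2 + l)).+1].

Lemma size_net n l : size (net n l) = ((2 ^ (n.+2 + l)).+1 ^ 2)%N.
Proof. by rewrite size_allpairs size_iota expnS expn1. Qed.

Lemma net_annulus n l xi : xi \in net n l -> annulus n xi.
Proof.
move=> /allpairsP[[i j] /= [_ _ ->]]; rewrite /grid_point.
case: xgetP => [y _ []//|_].
rewrite /annulus/= /enorm/= expr0n addr0 sqrtr_sqr ger0_norm ?exprn_ge0// lexx/=.
by rewrite ler_weXn2l// ler1n.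
Qed.

Lemma truncn_close (a b : R) : 0 <= a -> 0 <= b ->
  Num.truncn a = Num.truncn b -> `|a - b| <= 1.
Proof.
move=> /truncn_itv/andP[a1 a2] /truncn_itv/andP[b1 b2] ab.
rewrite ab in a1 a2; move: a2 b2; rewrite -natr1 => a2 b2.
by rewrite ler_norml; apply/andP; split; lra.
Qed.

Lemma net_dense n l xi : annulus n xi ->
  exists2 xi', xi' \in net n l & norm1 (xi - xi') <= 2 * 2^-1 ^+ l.
Proof.
move=> axi; have /andP[_ hi] := axi.
have l0 : 0 < 2 ^+ l :> R by rewrite exprn_gt0.
have coord (a : R) : `|a| <= 2 ^+ n.+1 -> 0 <= (a + 2 ^+ n.+1) * 2 ^+ l /\
    (Num.truncn ((a + 2 ^+ n.+1) * 2 ^+ l)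
      \in iota 0 (2 ^ (n.+2 + l)).+1).
  rewrite ler_norml => /andP[a1 a2].
  have p0 : 0 <= (a + 2 ^+ n.+1) * 2 ^+ l by rewrite mulr_ge0 ?(ltW l0)//; lra.
  split => //; rewrite mem_iota add0n ltnS /=.
  rewrite -(ler_nat R) (le_trans (_ : _ <= (a + 2 ^+ n.+1) * 2 ^+ l)) ?truncn_le//.
  by rewrite natrX exprD ler_wpM2r ?(ltW l0)// [leRHS]exprS; lra.
have [p1 i1] := coord _ (le_trans (fst_le_enorm xi) hi).
have [p2 i2] := coord _ (le_trans (snd_le_enorm xi) hi).
set i := Num.truncn _ in i1; set j := Num.truncn _ in i2.
exists (grid_point n l i j); first by apply: allpairs_f.
have : grid_cell n l i j (grid_point n l i j).
  by apply: xgetPex; exists xi.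
set eta := grid_point n l i j => -[aeta [ei ej]].
have /andP[_ hie] := aeta.
have [p1' _] := coord _ (le_trans (fst_le_enorm eta) hie).
have [p2' _] := coord _ (le_trans (snd_le_enorm eta) hie).
have c1 := truncn_close p1' p1 ei; have c2 := truncn_close p2' p2 ej.
have close (a b : R) : `|(a + 2 ^+ n.+1) * 2 ^+ l - (b + 2 ^+ n.+1) * 2 ^+ l| <= 1 ->
    `|b - a| <= 2^-1 ^+ l.
  rewrite -mulrBl opprD addrACA subrr addr0 normrM (gtr0_norm l0) distrC => h.
  by rewrite exprVn -[leRHS]mul1r ler_pdivlMr.
by rewrite /norm1/= mulr2n mulrDl mul1r lerD ?close.
Qed.

End nets.

Section bad_event.
Context d (T : measurableType d) (R : realType) (P : probability T R).
Context (W : seq bool -> {RV P >-> R}) (r mur : R).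
Hypothesis indW : independent_RVs [set v | v != [::]] W.
Hypothesis r1 : 1 < r.
Hypothesis law1 : forall v, v != [::] ->
  (\int[distribution P (W v)]_y (Num.max y 0)%:E = 1)%E.
Hypothesis lawr : forall v, v != [::] ->
  (\int[distribution P (W v)]_y (Num.max y 0 `^ r)%:E = mur%:E)%E.
Context (rho q : R).
Hypotheses (rho0 : 0 < rho) (rho1 : rho < 1) (rho2 : 2^-1 <= rho).
Hypotheses (q0 : 0 < q) (q1 : q < 1).
Hypothesis moment_small : 2 `^ (1 - r) * mur <= (q ^+ 2 * rho ^+ 10) `^ r.
Context (g : R -> R * R) (arc : nondegenerate_C2_arc g) (L : nat).

Notation X w := (fun v : seq bool => W v w).
Notation M := (cap rho (q ^+ 2)).

(** Two shifts for the real and imaginary parts, and two signs because [fluctuation] is a one-sided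
    event. *)
Definition osc_index n : seq ((R * R) * (R * bool)) :=
  [seq (xi, tb) | xi <- net R n (2 * n),
                  tb <- [seq (th, b) | th <- [:: 0; - (pi / 2)], b <- [:: true; false]]].

Definition signed_average (i : (R * R) * (R * bool)) (v : seq bool) : R :=
  (if i.2.2 then 1 else -1) * cell_average (prim (arc_phase g i.1 i.2.1)) v.

Definition osc_event n j : set T := \bigcup_(i in [set` osc_index n])
  fluctuation W r mur rho q (osc_scale rho q n j.+1) j (signed_average i).

(** Proportional to [n], so that the caps fail with probability geometric in [n]; yet with
    [4 * rho^L <= 1] the factor [4^k] it costs in the mass bound is absorbed by [rho^(uphalf n)]. *)
Definition start_level n : nat := uphalf n %/ L.

Definition bad_event n : set T :=
  \bigcup_(j in [set j | (start_level n <= j)%N]) level_event W r mur rho q j `|`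
  \bigcup_(j in [set j | (uphalf n <= j)%N]) osc_event n j `|`
  mass_event W (start_level n).

Lemma measurable_osc_event n j : measurable (osc_event n j).
Proof.
apply: fin_bigcup_measurable => [|i _]; first exact: finite_seq.
exact: measurable_fluctuation.
Qed.

Lemma measurable_bad_event n : measurable (bad_event n).
Proof.
apply: measurableU; first apply: measurableU.
- by apply: bigcup_measurable => j _; exact: measurable_level_event.
- by apply: bigcup_measurable => j _; exact: measurable_osc_event.
- exact: measurable_mass_event.
Qed.

(** At most [(2^(3 n + 3))^2] frequencies and 4 choices of shift and sign give [2^(6 n + 8)]. It is
    expressed through [uphalf n] because the oscillation events begin at that level. *)
Lemma size_osc_index n : (size (osc_index n) <= 2 ^ 8 * (2 ^ 12) ^ uphalf n)%N.
Proof.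
rewrite size_allpairs size_net /=.
have n2 : (n <= 2 * uphalf n)%N by rewrite mul2n uphalfK leq_addl.
have two a : ((2 ^ a).+1 <= 2 ^ a.+1)%N.
  by rewrite expnS mul2n -addnn -addn1 leq_add2l expn_gt0.
apply: (@leq_trans ((2 ^ (n.+2 + 2 * n).+1) ^ 2 * 2 ^ 2)).
  by rewrite leq_mul2r/= leq_sqr two.
rewrite -!expnM -!expnD leq_exp2l//.
by move: n2; clear; lia.
Qed.

Lemma signed_average_le1 n i v : i \in osc_index n -> `|signed_average i v| <= 1.
Proof.
move=> /allpairsP[[xi [th b]] /= [xin _ ->]]; rewrite /signed_average/=.
have [J [C C1 H]] := arc_averages arc.
have /andP[axi _] := net_annulus xin.
have [tau [h _]] := H xi th n (le_trans axi (enorm_le_norm1 xi)).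
by rewrite normrM; case: b; rewrite ?normrN normr1 mul1r.
Qed.

Lemma osc_event_tail (K : R) : 0 < K ->
  (forall j : nat, (2 ^+ 12) ^+ j * expR (- rho ^- j) <= K * rho ^+ j) ->
  forall n j, (uphalf n <= j)%N -> (P (osc_event n j) <= (2 ^+ 8 * K * rho ^+ j)%:E)%E.
Proof.
move=> K0 HK n j nj.
apply: (@le_trans _ _ (((size (osc_index n))%:R * expR (- rho ^- j.+1))%:E)).
  apply: measure_seq_union_le => i iin; first exact: measurable_fluctuation.
  have qn k : 0 < q ^+ k by rewrite exprn_gt0.
  have rn k : 0 < rho ^+ k by rewrite exprn_gt0.
  apply: (fluctuation_tail indW r1 law1 lawr) => //.
  - by move=> v; exact: signed_average_le1 iin.
  - by rewrite /osc_scale invr_gt0 !mulr_gt0.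
  rewrite /osc_scale /cap -exprM.
  have n2 : (n <= 2 * j.+1)%N.
    move: nj; rewrite -(leq_pmul2l (isT : 0 < 2)%N) => h.
    rewrite (leq_trans _ (leq_trans h _))//; last by rewrite leq_mul2l leqW.
    by rewrite mul2n uphalfK leq_addl.
  rewrite ler_pdivrMl ?mulr_gt0// [leRHS](_ : _ = q ^+ n * rho ^+ (2 * j.+1)).
    rewrite ler_pM ?(ltW (qn _)) ?(ltW (rn _))//.
      by rewrite ler_wiXn2l ?(ltW q0) ?(ltW q1).
    by rewrite ler_wiXn2l ?(ltW rho0) ?(ltW rho1)// leq_mul2r orbT.
  by field.
rewrite lee_fin.
apply: (@le_trans _ _ (2 ^+ 8 * ((2 ^+ 12) ^+ j.+1 * expR (- rho ^- j.+1)))).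
  rewrite mulrA ler_wpM2r ?expR_ge0//.
  rewrite -!natrX -natrM ler_nat (leq_trans (size_osc_index n))//.
  by rewrite leq_mul2l; apply/orP; right; rewrite leq_exp2l; [exact: leqW|].
rewrite -mulrA ler_wpM2l// (le_trans (HK _))// ler_wpM2l ?(ltW K0)//.
by rewrite ler_wiXn2l ?(ltW rho0) ?(ltW rho1).
Qed.

Lemma bad_event_tail (K1 K2 : R) : 0 < K1 -> 0 < K2 ->
  (forall j : nat, 2 ^+ j * expR (- rho ^- j) <= K1 * rho ^+ j) ->
  (forall j : nat, (2 ^+ 12) ^+ j * expR (- rho ^- j) <= K2 * rho ^+ j) ->
  forall n, (P (bad_event n) <=
    (((2 + 2 * K1) / (1 - rho) + 2 ^+ 8 * K2 / (1 - rho) + 1) *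
     rho ^+ start_level n)%:E)%E.
Proof.
move=> K10 K20 H1 H2 n.
have kL : (start_level n <= uphalf n)%N by exact: leq_div.
have m1 : measurable (\bigcup_(j in [set j | (start_level n <= j)%N])
    level_event W r mur rho q j).
  by apply: bigcup_measurable => j _; exact: measurable_level_event.
have m2 : measurable (\bigcup_(j in [set j | (uphalf n <= j)%N]) osc_event n j).
  by apply: bigcup_measurable => j _; exact: measurable_osc_event.
set a := (2 + 2 * K1) / (1 - rho); set b := 2 ^+ 8 * K2 / (1 - rho).
rewrite [(a + b + 1) * _]mulrDl [(a + b) * _]mulrDl mul1r !EFinD.
apply: (le_trans (measureU2 _ _ _)) => //.
- exact: measurableU.
- exact: measurable_mass_event.
apply: leeD; last exact: (mass_event_tail indW law1 rho0 rho2).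
apply: (le_trans (measureU2 _ _ _)) => //; apply: leeD.
  apply: measure_geometric_union_le => //.
  - by rewrite addr_ge0// mulr_ge0// ltW.
  - by move=> j; exact: measurable_level_event.
  - move=> j _; exact: (level_event_tail indW r1 law1 lawr).
apply: (@le_trans _ _ ((b * rho ^+ uphalf n)%:E)).
  apply: measure_geometric_union_le => //.
  - by rewrite mulr_ge0 ?exprn_ge0// ltW.
  - by move=> j; exact: measurable_osc_event.
  - by move=> j nj; exact: osc_event_tail.
rewrite lee_fin ler_wpM2l//.
  by rewrite divr_ge0 ?subr_ge0 ?(ltW rho1)// mulr_ge0 ?exprn_ge0// ltW.
by rewrite ler_wiXn2l ?(ltW rho0) ?(ltW rho1).
Qed.

End bad_event.

Section off_bad_event.
Context (R : realType) (r mur rho q : R) (g : R -> R * R) (L : nat).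
Hypotheses (rho0 : 0 < rho) (rho1 : rho < 1).
Hypotheses (q0 : 0 < q) (q1 : q < 1) (q2 : 2^-1 <= q ^+ 2).
Hypotheses (arc : nondegenerate_C2_arc g) (rhoL : 4 * rho ^+ L <= 1).
Notation M := (cap rho (q ^+ 2)).

Lemma increment_opp (c : seq bool -> R) N x m :
  increment N (fun v => -1 * c v) x m = - increment N c x m.
Proof.
by rewrite /increment -sumrN; apply: eq_bigr => v _; rewrite mulN1r mulNr.
Qed.

Lemma qvar_opp (c : seq bool -> R) x m : qvar (fun v => -1 * c v) x m = qvar c x m.
Proof. by apply: eq_bigr => v _; rewrite mulN1r sqrrN. Qed.

Lemma start_level_small n : 4 ^+ start_level L n * rho ^+ uphalf n <= 1.
Proof.
rewrite /start_level; set k := (_ %/ _)%N.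
apply: (@le_trans _ _ ((4 * rho ^+ L) ^+ k)).
  rewrite exprMn ler_wpM2l ?exprn_ge0// -exprM.
  by rewrite ler_wiXn2l ?(ltW rho0) ?(ltW rho1)// mulnC leq_trunc_div.
by rewrite exprn_ile1// mulr_ge0// exprn_ge0// ltW.
Qed.

(** The negations of the events are, at the given sample point, the hypotheses of [mass_le] and
    [cascade_value_bound]; the two signs in [osc_index] give the absolute value. *)
Lemma off_bad_event : exists2 K, 0 < K &
  forall d (T : measurableType d) (P : probability T R)
    (W : seq bool -> {RV P >-> R}) n w,
  ~ bad_event W r mur rho q g L n w ->
  (forall xi th m, xi \in net R n (2 * n) -> th \in [:: 0; - (pi / 2)] ->
    (uphalf n <= m)%N ->
    `|cascade_value (prim (arc_phase g xi th)) (fun v => W v w) m| <= K * q ^+ n) /\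
  (forall m, (uphalf n <= m)%N ->
    mass (fun v => W v w) m [::] <= 4 * expR (1 - rho)^-1 * 4 ^+ start_level L n).
Proof.
have [J [C C1 H]] := arc_averages arc.
have [K K0 HK] := cascade_value_bound r mur J rho0 rho1 q0 q1 q2 C1.
exists K => // d T P W n w; set x := fun v => W v w => nbad.
have q21 : q ^+ 2 < 1 by rewrite exprn_ilt1 ?(ltW q0).
have kL : (start_level L n <= uphalf n)%N by exact: leq_div.
have nlev j : (start_level L n <= j)%N -> ~ level_event W r mur rho q j w.
  by move=> kj lj; apply: nbad; left; left; exists j.
have nosc j : (uphalf n <= j)%N -> ~ osc_event W r mur rho q g n j w.
  by move=> kj lj; apply: nbad; left; right; exists j.
have capped j v : (start_level L n <= j)%N -> v \in words j -> cellw x v <= M j.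
  move=> kj vj; rewrite leNgt; apply/negP => h; apply: (nlev j kj).
  by left; left; exists v.
have biased j : (start_level L n <= j)%N -> biasw r mur (M j.+1) x j <= M j.+1.
  move=> kj; rewrite leNgt; apply/negP => h; apply: (nlev j kj).
  by left; right.
have balls j u : (start_level L n <= j)%N -> (size u <= j)%N ->
    increment (M j.+1) (in_word R u) x j <=
    biasw r mur (M j.+1) x j +
    2 * ball_scale rho (q ^+ 2) j.+1 * M j.+1 * qvar (in_word R u) x j +
    rho ^- j.+1 / ball_scale rho (q ^+ 2) j.+1.
  move=> kj uj; rewrite leNgt; apply/negP => h; apply: (nlev j kj).
  by right; exists u => //=; rewrite mem_upto.
have total : mass x (start_level L n) [::] <= 2 ^+ start_level L n.
  by rewrite mass_nil leNgt; apply/negP => h; apply: nbad; right.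
have masses := mass_le rho0 rho1 q2 q21 capped biased balls total.
split; last first.
  move=> m nm; have := masses m [::] (leq_trans kL nm) (leq0n _).
  by rewrite expr0 mulr1.
move=> xi th m xin thin nm.
have /andP[axi _] := net_annulus xin.
have [tau [av1 av2]] := H xi th n (le_trans axi (enorm_le_norm1 xi)).
apply: (HK x _ tau n (start_level L n) (uphalf n)) => //.
- by rewrite mul2n uphalfK leq_addl.
- by rewrite mul2n uphalfK; case: (odd n).
- exact: start_level_small.
move=> j nj.
have bd b : (xi, (th, b)) \in osc_index R n ->
    increment (M j.+1) (signed_average g (xi, (th, b))) x j <=
    biasw r mur (M j.+1) x j + 2 * osc_scale rho q n j.+1 * M j.+1 *
      qvar (signed_average g (xi, (th, b))) x j + rho ^- j.+1 / osc_scale rho q n j.+1.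
  move=> iin; rewrite leNgt; apply/negP => h; apply: (nosc j nj).
  by exists (xi, (th, b)).
have inb b : (xi, (th, b)) \in osc_index R n.
  apply: allpairs_f => //; apply: allpairs_f => //.
  by case: b; rewrite !inE.
set c := cell_average _.
have e1 : signed_average g (xi, (th, true)) = c.
  by apply/funext => v; rewrite /signed_average/= mul1r.
have e2 : signed_average g (xi, (th, false)) = (fun v => -1 * c v) by [].
have := bd _ (inb true); have := bd _ (inb false).
rewrite e1 e2 increment_opp qvar_opp => h1 h2.
by rewrite ler_norml; apply/andP; split => //; rewrite lerNl.
Qed.

End off_bad_event.

(** * The limit measure and its Fourier transform *)

Section restricted_measures.
Context d (T : measurableType d) (R : realType) (mu : {measure set T -> \bar R}).
Local Open Scope ereal_scope.

Lemma ge0_integral_mrestr (D : set T) (mD : measurable D) (f : T -> \bar R) :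
  measurable_fun setT f -> (forall x, 0 <= f x) ->
  \int[mrestr mu mD]_x f x = \int[mu]_(x in D) f x.
Proof.
move=> mf f0; rewrite -(setUv D) ge0_integral_setU//.
- rewrite [X in _ + X](eq_measure_integral mzero); last first.
    move=> A mA AD; rewrite /= /mrestr /mzero (_ : A `&` D = set0) ?measure0//.
    by apply/seteqP; split => // x [/AD].
  rewrite integral_measure_zero adde0; apply: eq_measure_integral => A mA AD.
  by rewrite /= /mrestr setIidl.
- exact: measurableC.
- exact: measurable_funTS.
- by rewrite disj_set2E setICr.
Qed.

Variables (I : Type) (a : I -> {nonneg R}) (D : I -> set T).
Hypothesis mD : forall i, measurable (D i).

(** [cascade_measure] is a bare set function; this genuine measure agrees with it on measurable
    sets, which gives access to the integration lemmas. *)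
Fixpoint mixture (s : seq I) : {measure set T -> \bar R} :=
  if s is i :: s' then measure_add (mscale (a i) (mrestr mu (mD i))) (mixture s')
  else mzero.

Lemma mixtureE s A :
  mixture s A = \sum_(i <- s) (a i)%:num%:E * mu (A `&` D i).
Proof.
elim: s => [|i s IH]; first by rewrite big_nil.
by rewrite big_cons -IH; exact: measure_addE.
Qed.

Lemma ge0_integral_mixture s (f : T -> \bar R) :
  measurable_fun setT f -> (forall x, 0 <= f x) ->
  \int[mixture s]_x f x = \sum_(i <- s) (a i)%:num%:E * \int[mu]_(x in D i) f x.
Proof.
move=> mf f0; elim: s => [|i s IH]; first by rewrite big_nil integral_measure_zero.
rewrite big_cons /= ge0_integral_measure_add// IH ge0_integral_mscale//.
by rewrite ge0_integral_mrestr.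
Qed.

End restricted_measures.

Section set_function_integral.
Import HBNNSimple.

(** The integral is built from suprema over simple functions, so it reads a set function on
    measurable sets only. *)
Lemma eq_set_function_integral d (T : measurableType d) (R : realType)
    (m1 m2 : set T -> \bar R) (f : T -> \bar R) :
  (forall A, measurable A -> m1 A = m2 A) ->
  (\int[m1]_x f x = \int[m2]_x f x)%E.
Proof.
move=> m12; rewrite /integral.
have eqs (h : {nnsfun T >-> R}) : sintegral m1 h = sintegral m2 h.
  by apply: eq_fsbigr => x _; rewrite m12.
by congr (ereal_sup _ - ereal_sup _)%E; apply/seteqP; split => _ [h hf <-];
  exists h => //; rewrite eqs.
Qed.

End set_function_integral.

(* The display of the Borel sets on which [lebesgue_measure] is defined differs
   from the one of [R]; [borel_lebesgue] is the same set function on [R]. *)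
Section borel_lebesgue.
Context (R : realType).

Lemma measurable_to_R : measurable_fun [set: measurableTypeR R]
  (idfun : measurableTypeR R -> R).
Proof. by move=> _ A mA; rewrite setTI. Qed.

Definition borel_lebesgue : {measure set R -> \bar R} :=
  measure_function_pushforward__canonical__measure_function_Measure
    lebesgue_measure measurable_to_R.

Lemma ge0_integral_borel_lebesgue (D : set R) (f : R -> \bar R) :
  measurable D -> measurable_fun [set: R] f -> (forall x, 0 <= f x)%E ->
  (\int[borel_lebesgue]_(x in D) f x = \int[lebesgue_measure]_(x in D) f x)%E.
Proof.
move=> mD mf f0.
exact: (@ge0_integral_pushforward _ _ _ _ _ _ measurable_to_R lebesgue_measure
  D f mD (measurable_funTS mf) (fun x _ => f0 x)).
Qed.

End borel_lebesgue.

Section cascade_integral.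
Context (R : realType).
Local Notation leb := (@lebesgue_measure R).
Notation wp := (@word_point R).

Lemma word_point_nseq n : wp (nseq n true) = 1 - 2^-1 ^+ n.
Proof.
elim: n => [|n IH]; first by rewrite word_point_nil expr0 subrr.
have -> : nseq n.+1 true = rcons (nseq n true) true.
  by rewrite -cats1 -(nseqD n 1) addn1.
rewrite word_point_rcons IH size_nseq exprS /= mul1r; lra.
Qed.

Lemma measurable_word_itv v : measurable (@word_itv R v).
Proof. by rewrite /word_itv; case: ifP. Qed.

Lemma integral_word_itv (f : R -> R) v : continuous f ->
  (\int[leb]_(x in @word_itv R v) (f x)%:E =
   (prim f (wp v + 2^-1 ^+ size v) - prim f (wp v))%:E)%E.
Proof.
move=> cf; have [v0 v1] := @word_point_itv R v.
have h0 : 0 < 2^-1 ^+ size v :> R by rewrite exprn_gt0 ?invr_gt0.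
have a1 : -1 < wp v by lra.
have lt : wp v < wp v + 2^-1 ^+ size v by rewrite ltrDl.
rewrite -(integral_prim cf a1 lt) /word_itv.
(* The all-ones word has the closed interval ending at 1; the others are half-open, which does not
   change the integral. *)
case: ifPn => [/eqP ve|_].
  have -> // : wp v + 2^-1 ^+ size v = 1.
  by rewrite ve word_point_nseq size_nseq subrK.
rewrite -exprVn integral_itv_bndo_bndc//.
apply: measurable_funTS; apply/measurable_EFinP.
exact: continuous_measurable_fun.
Qed.

Context d (T : measurableType d) (P : probability T R).
Variable W : seq bool -> {RV P >-> R}.
Notation X w := (fun v : seq bool => W v w).

Lemma cascade_weightE v w : (forall u, u != [::] -> 0 <= W u w) ->
  cascade_weight W v w = weightp (X w) v.
Proof.
move=> W0; apply: eq_big_nat => j /andP[j0 jv].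
rewrite max_l// W0//; case: j j0 jv => // j _; by case: (v).
Qed.

Lemma cascade_measureE n w A : (forall u, u != [::] -> 0 <= W u w) ->
  measurable A ->
  cascade_measure W n w A =
  mixture (borel_lebesgue R) (fun v => NngNum (weightp_ge0 (X w) v))
    measurable_word_itv (words n) A.
Proof.
move=> W0 mA; rewrite mixtureE /cascade_measure.
under eq_integral => t _.
  rewrite /cascade_density (sum_words_tuple n (fun v => cascade_weight W v w *
    \1_(@word_itv R v) t)) -sumEFin.
  under eq_bigr do rewrite (cascade_weightE _ W0) EFinM.
  over.
rewrite ge0_integral_sum//.
- apply: eq_bigr => v _; rewrite ge0_integralZl//.
  + by rewrite integral_indic//= 1?setIC//; exact: measurable_word_itv.
  + apply/measurable_EFinP; apply: measurable_funTS; apply: measurable_indic.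
    exact: measurable_word_itv.
  + by rewrite lee_fin weightp_ge0.
- move=> v; apply: measurable_funeM; apply/measurable_EFinP.
  by apply: measurable_funTS; apply: measurable_indic; exact: measurable_word_itv.
- by move=> v t _; rewrite -EFinM lee_fin mulr_ge0 ?weightp_ge0.
Qed.

Lemma integral_cascade_measure n w (f : R -> R) :
  (forall u, u != [::] -> 0 <= W u w) -> continuous f -> (forall x, 0 <= f x) ->
  (\int[cascade_measure W n w]_x (f x)%:E = (cascade_value (prim f) (X w) n)%:E)%E.
Proof.
move=> W0 cf f0.
transitivity (\int[mixture (borel_lebesgue R)
    (fun v => NngNum (weightp_ge0 (X w) v)) measurable_word_itv (words n)]_x
    (f x)%:E)%E.
  by apply: eq_set_function_integral => A mA; exact: cascade_measureE.
have mf : measurable_fun [set: R] (fun x => (f x)%:E).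
  by apply/measurable_EFinP; exact: continuous_measurable_fun.
have f0' x : (0 <= (f x)%:E)%E by rewrite lee_fin.
rewrite ge0_integral_mixture//.
rewrite /cascade_value -sumEFin; apply: eq_bigr => v _ /=.
rewrite (ge0_integral_borel_lebesgue (measurable_word_itv v) mf f0').
rewrite integral_word_itv// -EFinM; congr EFin.
rewrite /cellw /cell_average mulrACA -exprMn mulVf ?expr1n ?mul1r//.
Qed.

End cascade_integral.

Lemma cos_lip (R : realType) (a b : R) : `|cos a - cos b| <= `|a - b|.
Proof.
wlog ab : a b / a <= b.
  move=> H; have [|/ltW] := leP a b; first exact: H.
  by move=> ba; rewrite distrC [leRHS]distrC H.
have dc x : x \in `]a, b[ -> is_derive x 1 (@cos R) (- sin x).
  by move=> _; exact: is_derive_cos.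
have [c _] := MVT_segment ab dc (continuous_subspaceT (@continuous_cos R)).
rewrite distrC [leRHS]distrC => ->; rewrite normrM ler_piMl//.
by rewrite normrN ler_norml sin_geN1 sin_le1.
Qed.

Section arc_integral.
Context (R : realType) (g : R -> R * R) (arc : nondegenerate_C2_arc g).
Context (nu : {measure set R -> \bar R}) (nu_fin : (nu setT < +oo)%E).
Notation nu01 := (mrestr nu (measurable_itv `[0%R, 1%R])).

Lemma nu01_fin : (nu01 setT < +oo)%E.
Proof.
rewrite /mrestr setTI; apply: le_lt_trans nu_fin.
by apply: le_measure; rewrite ?inE.
Qed.

Lemma bounded_integrable (f : R -> R) (M : R) : measurable_fun setT f ->
  (forall x, `|f x| <= M) -> nu01.-integrable setT (EFin \o f).
Proof.
move=> mf fM; apply: measurable_bounded_integrable => //.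
  exact: nu01_fin.
by exists M; split; rewrite ?num_real// => N MN x _; exact: le_trans (ltW MN).
Qed.

Lemma measurable_arc_phase xi th : measurable_fun setT (arc_phase g xi th).
Proof. by apply: continuous_measurable_fun; exact: continuous_arc_phase. Qed.

Lemma arc_phase_integrable xi th :
  nu01.-integrable setT (EFin \o arc_phase g xi th).
Proof.
by apply: (@bounded_integrable _ 1); [exact: measurable_arc_phase|exact: arc_phase_le1].
Qed.

Definition arcint xi th : R := (\int[nu01]_x arc_phase g xi th x)%R.

Lemma measurable_arc_clamp : measurable_fun setT (g \o (@clamp R)).
Proof.
have [g' [g'' [A [kap [_ [dg _ _ _ _]]]]]] := arc_bounds_exist arc.
rewrite (_ : g \o _ = fun t => ((g (clamp t)).1, (g (clamp t)).2)); last first.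
  by apply/funext => t /=; case: (g _).
apply: measurable_fun_pair; apply: continuous_measurable_fun.
  rewrite (_ : (fun t => _) = (fun t => dotp (g t) (1, 0)) \o (@clamp R)).
    exact: continuous_clamp (deriv01_continuous (deriv01_dotp dg)).
  by apply/funext => t /=; rewrite dotp10.
rewrite (_ : (fun t => _) = (fun t => dotp (g t) (0, 1)) \o (@clamp R)).
  exact: continuous_clamp (deriv01_continuous (deriv01_dotp dg)).
by apply/funext => t /=; rewrite dotp01.
Qed.

(** Nothing is known about [g] off [[0, 1]]. Replacing it by [g \o clamp] gives a measurable map and
    leaves the image of the restricted measure unchanged. *)
Lemma integral_arc_image (h : R * R -> R) (f : R -> R) (M : R) :
  measurable_fun setT h -> (forall z, `|h z| <= M) ->
  (forall t, h (g (clamp t)) = f t) ->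
  fine (\int[arc_image g nu]_x (h x)%:E)%E = (\int[nu01]_x f x)%R.
Proof.
move=> mh hM hf; rewrite /Rintegral; congr fine.
transitivity (\int[pushforward nu01 (g \o (@clamp R))]_x (h x)%:E)%E.
  apply: eq_set_function_integral => A mA.
  rewrite /arc_image /pushforward /mrestr; congr (nu _).
  by apply/seteqP; split => t /= [gA t01]; split => //; move: gA; rewrite clamp_id.
rewrite (integral_pushforward measurable_arc_clamp)//.
- by rewrite preimage_setT; apply: eq_integral => t _ /=; rewrite hf.
- exact/measurable_EFinP.
- rewrite preimage_setT; apply: (@bounded_integrable (h \o (g \o (@clamp R))) M).
    exact: measurableT_comp mh measurable_arc_clamp.
  by move=> t; exact: hM.
Qed.

Lemma measurable_dotp (xi : R * R) : measurable_fun setT (fun z : R * R => dotp z xi).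
Proof.
by apply: measurable_funD; apply: measurable_funM.
Qed.

Lemma fourier_absE xi : fourier_abs (arc_image g nu) xi =
  Num.sqrt (arcint xi 0 ^+ 2 + arcint xi (- (pi / 2)) ^+ 2).
Proof.
rewrite /fourier_abs /fourier /arcint.
rewrite (@integral_arc_image _ (arc_phase g xi 0) 1); last 3 first.
- apply: measurableT_comp; first by apply: continuous_measurable_fun; exact: continuous_cos.
  by apply: measurable_funM => //; exact: measurable_dotp.
- by move=> z; rewrite ler_norml cos_geN1 cos_le1.
- by move=> t; rewrite /arc_phase addr0.
rewrite (@integral_arc_image _ (arc_phase g xi (- (pi / 2))) 1)//.
- apply: measurableT_comp; first by apply: continuous_measurable_fun; exact: continuous_sin.
  by apply: measurable_funM => //; exact: measurable_dotp.
- by move=> z; rewrite ler_norml sin_geN1 sin_le1.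
- by move=> t; rewrite /arc_phase cosBpihalf.
Qed.

End arc_integral.

Section prim_arith.
Context (R : realType).
Implicit Types (f : R -> R) (v : seq bool).
Notation leb := (@lebesgue_measure R).
Notation wp := (@word_point R).

Lemma primD f1 f2 x : continuous f1 -> continuous f2 ->
  prim (fun t => f1 t + f2 t) x = prim f1 x + prim f2 x.
Proof.
by move=> c1 c2; rewrite /prim RintegralD//; exact: continuous_integrable_itv.
Qed.

Lemma cell_average_cst1 v : cell_average (prim (fun=> 1 : R)) v = 1.
Proof.
have [v0 v1] := @word_point_itv R v.
have h0 : 0 < 2^-1 ^+ size v :> R by rewrite exprn_gt0 ?invr_gt0.
have a1 : -1 < wp v by lra.
have lt : wp v < wp v + 2^-1 ^+ size v by rewrite ltrDl.
have := integral_prim (@cst_continuous R R 1) a1 lt; rewrite /cell_average.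
rewrite integral_cst//= lebesgue_measure_itv/= lte_fin lt -EFinD mul1e => -[<-].
rewrite addrAC subrr add0r -exprMn divff ?expr1n//.
Qed.

Lemma cell_average_support f v : continuous f -> {in `[0, 1], f =1 fun=> 0} ->
  cell_average (prim f) v = 0.
Proof.
move=> cf f0; have [v0 v1] := @word_point_itv R v.
have h0 : 0 < 2^-1 ^+ size v :> R by rewrite exprn_gt0 ?invr_gt0.
have a1 : -1 < wp v by lra.
have lt : wp v < wp v + 2^-1 ^+ size v by rewrite ltrDl.
have := integral_prim cf a1 lt; rewrite /cell_average.
rewrite (eq_integral (cst 0%E)) => [|x]; last first.
  rewrite inE/= in_itv/= => /andP[x1 x2]; rewrite f0// in_itv/=.
  by rewrite (le_trans v0 x1) (le_trans x2 v1).
by rewrite integral0 => -[<-]; rewrite mulr0.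
Qed.

(** The shift by 1 makes a phase nonnegative, the setting of [integral_cascade_measure]; the total
    mass is subtracted afterwards. *)
Lemma cascade_value_1D f x m : continuous f ->
  cascade_value (prim (fun t => 1 + f t)) x m =
  mass x m [::] + cascade_value (prim f) x m.
Proof.
move=> cf; rewrite mass_nil -big_split; apply: eq_bigr => v _ /=.
rewrite -[X in _ = X + _]mulr1 -mulrDr; congr (_ * _).
rewrite -[X in X + _](cell_average_cst1 v) /cell_average.
rewrite !(primD _ (@cst_continuous R R 1) cf); ring.
Qed.

End prim_arith.

(** * Passage to the weak limit *)

Section weak_limit.
Context d (T : measurableType d) (R : realType) (P : probability T R).
Context (W : seq bool -> {RV P >-> R}) (w : T) (nu : {measure set R -> \bar R}).
Hypothesis W0 : forall u, u != [::] -> 0 <= W u w.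
Hypothesis nu_fin : (nu setT < +oo)%E.
Hypothesis wc : weak_cvg (cascade_measure W ^~ w) nu.
Notation x := (fun v : seq bool => W v w).
Notation nu01 := (mrestr nu (measurable_itv `[0%R, 1%R])).

Lemma bounded_integral_fin_num (f : R -> R) (M : R) : continuous f ->
  (forall t, `|f t| <= M) -> (\int[nu]_t (f t)%:E)%E \is a fin_num.
Proof.
move=> cf fM; apply: integrable_fin_num => //.
apply: measurable_bounded_integrable => //.
  exact: continuous_measurable_fun.
by exists M; split; rewrite ?num_real// => N MN t _; exact: le_trans (ltW MN).
Qed.

Lemma cascade_value_cvg (f : R -> R) (M : R) : continuous f ->
  (forall t, 0 <= f t) -> (forall t, f t <= M) ->
  cascade_value (prim f) x n @[n --> \oo] --> (\int[nu]_t f t)%R.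
Proof.
move=> cf f0 fM.
have fM' t : `|f t| <= M by rewrite ger0_norm.
have := wc cf (ex_intro _ M fM').
under eq_cvg => n do rewrite (integral_cascade_measure n W0 cf f0).
by rewrite -(fineK (bounded_integral_fin_num cf fM')) => /fine_cvgP[].
Qed.

(** The test function [min(1, |t - clamp t|)] vanishes exactly on [[0, 1]]. Every cascade measure
    gives it integral 0, hence so does the limit. *)
Lemma limit_support : nu (~` `[0, 1]) = 0%E.
Proof.
pose f (t : R) := Num.min 1 `|t - clamp t|.
have cf : continuous f.
  move=> t; apply: (@continuous_min _ _ (fun=> 1) (fun t => `|t - clamp t|)).
    exact: cvg_cst.
  apply: (continuous_comp (f := fun t : R => t - clamp t) (g := fun y : R => `|y|)).
    apply: cvgB; first exact: cvg_id.
    by apply: (@continuous_clamp R idfun); apply: continuous_subspaceT => y; exact: cvg_id.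
  exact: norm_continuous.
have f0 t : 0 <= f t by rewrite /f le_min ler01 normr_ge0.
have f1 t : f t <= 1 by rewrite /f ge_min lexx.
have vf : \forall n \near \oo, cascade_value (prim f) x n = 0.
  apply: nearW => n; rewrite /cascade_value big1// => v _.
  rewrite (cell_average_support v cf) ?mulr0// => t t01.
  by rewrite /f clamp_id// subrr normr0 min_r.
have i0 : (\int[nu]_t f t)%R = 0.
  apply: (cvg_unique _ (cascade_value_cvg cf f0 f1)) => //.
  exact: cvg_near_cst.
have mf : measurable_fun setT (EFin \o f).
  by apply/measurable_EFinP; exact: continuous_measurable_fun.
have : (\int[nu]_t `|(f t)%:E| = 0)%E.
  under eq_integral => t _ do rewrite gee0_abs ?lee_fin//.
  rewrite -[LHS]fineK; first by congr EFin; exact: i0.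
  by apply: (bounded_integral_fin_num (M := 1) cf) => t; rewrite ger0_norm.
move=> /(ae_eq_integral_abs nu measurableT mf) ae0.
apply/negligibleP; first exact: measurableC.
apply: negligibleS ae0 => t /= t01 /(_ I)[] /eqP.
rewrite /f; case: (leP 1 `|t - clamp t|) => h; first by rewrite oner_eq0.
rewrite normr_eq0 subr_eq0 => /eqP e; apply: t01; rewrite e; exact: clamp_in.
Qed.

Lemma limit_restrict A : measurable A -> nu A = nu01 A.
Proof.
move=> mA; have m01 : measurable (`[0, 1] : set R) by [].
rewrite [LHS](measureDI nu mA m01) /mrestr [X in (X + _)%E](_ : _ = 0%E) ?add0e//.
apply/eqP; rewrite eq_le measure_ge0 andbT -limit_support.
apply: le_measure; rewrite ?inE; last by move=> t [].
  exact: measurableD.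
exact: measurableC.
Qed.

Lemma mass_cvg : mass x n [::] @[n --> \oo] --> fine (nu setT).
Proof.
have c1 : continuous (fun _ : R => 1 : R) by exact: cst_continuous.
have := cascade_value_cvg c1 (fun=> ler01) (fun=> lexx 1).
rewrite Rintegral_cst// mul1r.
suff e n : cascade_value (prim (fun=> 1)) x n = mass x n [::].
  by under eq_cvg => n do rewrite e.
by rewrite mass_nil; apply: eq_bigr => v _; rewrite cell_average_cst1 mulr1.
Qed.

Lemma arcint_cvg g (arc : nondegenerate_C2_arc g) xi th :
  cascade_value (prim (arc_phase g xi th)) x n @[n --> \oo] --> arcint g nu xi th.
Proof.
set f := arc_phase g xi th; have cf : continuous f by exact: continuous_arc_phase.
have f1 t : `|f t| <= 1 by exact: arc_phase_le1.
have c1f : continuous (fun t => 1 + f t).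
  by move=> t; apply: cvgD; [exact: cvg_cst|exact: cf].
have h := cascade_value_cvg (M := 2) c1f _ _.
have {}h : cascade_value (prim (fun t => 1 + f t)) x n @[n --> \oo] -->
    (\int[nu]_t (1 + f t))%R.
  by apply: h => t; have := f1 t; rewrite ler_norml => /andP[? ?]; lra.
have -> : arcint g nu xi th = (\int[nu]_t (1 + f t))%R - fine (nu setT).
  rewrite /arcint /Rintegral.
  rewrite -(eq_set_function_integral _ limit_restrict) -/(Rintegral _ _ _).
  rewrite RintegralD// ?Rintegral_cst//.
  - by rewrite mul1r addrAC subrr add0r.
  - apply: measurable_bounded_integrable => //.
    by exists 1; split; rewrite ?num_real// => N MN t _; rewrite /= normr1 ltW.
  - apply: measurable_bounded_integrable => //.
      exact: continuous_measurable_fun.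
    by exists 1; split; rewrite ?num_real// => N MN t _; exact: le_trans (ltW MN).
have e n : cascade_value (prim f) x n =
    cascade_value (prim (fun t => 1 + f t)) x n - mass x n [::].
  by rewrite cascade_value_1D// [mass _ _ _ + _]addrC addrK.
by under eq_cvg => n do rewrite e; exact: cvgB h mass_cvg.
Qed.

Lemma arcint_le g (arc : nondegenerate_C2_arc g) xi th (B : R) m0 :
  (forall m, (m0 <= m)%N -> `|cascade_value (prim (arc_phase g xi th)) x m| <= B) ->
  `|arcint g nu xi th| <= B.
Proof.
move=> h; apply: (cvgr_to_le (cvg_norm (arcint_cvg arc (xi := xi) (th := th)))).
by exists m0 => // m /= ?; exact: h.
Qed.

Lemma limit_mass_le (B : R) m0 :
  (forall m, (m0 <= m)%N -> mass x m [::] <= B) -> fine (nu setT) <= B.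
Proof.
move=> h; apply: (cvgr_to_le mass_cvg).
by exists m0 => // m /= ?; exact: h.
Qed.

End weak_limit.

(** * Lipschitz bounds and measurability of the supremum *)

Section fourier_sup.
Context (R : realType).
Implicit Types (xi : R * R) (n l : nat).

Lemma enormD_le xi eta : enorm (xi + eta) <= enorm xi + norm1 eta.
Proof.
have h0 : 0 <= enorm xi by exact: sqrtr_ge0.
rewrite -[leRHS]ger0_norm ?addr_ge0// -sqrtr_sqr ler_sqrt ?sqr_ge0//.
have sq : enorm xi ^+ 2 = xi.1 ^+ 2 + xi.2 ^+ 2.
  by rewrite sqr_sqrtr// addr_ge0 ?sqr_ge0.
rewrite [leRHS]sqrrD sq /norm1 /= !sqrrD.
have b1 : xi.1 * eta.1 <= enorm xi * `|eta.1|.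
  by rewrite (le_trans (ler_norm _))// normrM ler_wpM2r// fst_le_enorm.
have b2 : xi.2 * eta.2 <= enorm xi * `|eta.2|.
  by rewrite (le_trans (ler_norm _))// normrM ler_wpM2r// snd_le_enorm.
rewrite !real_normK ?num_real//.
have : 0 <= `|eta.1| * `|eta.2| by rewrite mulr_ge0.
lra.
Qed.

Section lipschitz.
Context (g : R -> R * R) (arc : nondegenerate_C2_arc g).

Lemma arcint_lipschitz : exists2 Lam, 0 < Lam &
  forall (nu : {measure set R -> \bar R}), (nu setT < +oo)%E ->
  forall xi xi' th,
  `|arcint g nu xi th - arcint g nu xi' th| <= Lam * norm1 (xi - xi') * fine (nu setT).
Proof.
have [g' [g'' [A [kap [A0 [_ _ _ _ bd]]]]]] := arc_bounds_exist arc.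
have pi0 := pi_gt0 R.
exists (2 * pi * A); first by rewrite !mulr_gt0.
move=> nu nufin xi xi' th.
have i1 := arc_phase_integrable arc nufin.
rewrite /arcint -RintegralB//.
set K := _ * norm1 _; set nu01 := mrestr _ _.
have K0 : 0 <= K by rewrite !mulr_ge0 ?norm1_ge0// ltW.
have bK t : `|arc_phase g xi th t - arc_phase g xi' th t| <= K.
  rewrite /arc_phase (le_trans (cos_lip _ _))//.
  rewrite (_ : _ - _ = - (2 * pi * dotp (g (clamp t)) (xi - xi'))); last first.
    by rewrite /dotp/=; ring.
  rewrite normrN normrM ger0_norm ?mulr_ge0 ?(ltW pi0)// /K -[leRHS]mulrA.
  rewrite ler_wpM2l ?mulr_ge0 ?(ltW pi0)//.
  have [_ /(_ g)] := bd _ (clamp_in t); rewrite inE eqxx => /(_ isT)[b1 b2].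
  exact: dotp_le.
have icst : nu01.-integrable setT (EFin \o fun=> K).
  by apply: (bounded_integrable nufin (M := K)) => // t; rewrite ger0_norm.
have idiff : nu01.-integrable setT
    (EFin \o (fun t => arc_phase g xi th t - arc_phase g xi' th t)).
  apply: (bounded_integrable nufin (M := K)) => //.
  by apply: measurable_funB; exact: measurable_arc_phase.
rewrite (le_trans (le_normr_Rintegral measurableT idiff))//.
apply: (le_trans (le_Rintegral measurableT _ icst (fun t _ => bK t))).
  apply: (bounded_integrable nufin (M := K)).
    by apply: measurableT_comp => //; apply: measurable_funB; exact: measurable_arc_phase.
  by move=> t; rewrite normr_id.
rewrite Rintegral_cst// ler_wpM2l//.
apply: fine_le.
- by rewrite ge0_fin_numE// nu01_fin.
- by rewrite ge0_fin_numE.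
- by rewrite /nu01 /= /mrestr setTI le_measure ?inE.
Qed.

Definition arcvec (nu : {measure set R -> \bar R}) xi : R * R :=
  (arcint g nu xi 0, arcint g nu xi (- (pi / 2))).

Lemma fourier_abs_enorm (nu : {measure set R -> \bar R}) xi : (nu setT < +oo)%E ->
  fourier_abs (arc_image g nu) xi = enorm (arcvec nu xi).
Proof. by move=> nufin; rewrite fourier_absE. Qed.

Lemma fourier_abs_lipschitz : exists2 Lam, 0 < Lam &
  forall (nu : {measure set R -> \bar R}), (nu setT < +oo)%E -> forall xi xi',
  fourier_abs (arc_image g nu) xi <= fourier_abs (arc_image g nu) xi' +
    Lam * norm1 (xi - xi') * fine (nu setT).
Proof.
have [Lam Lam0 H] := arcint_lipschitz.
exists (2 * Lam) => [|nu nufin xi xi']; first by rewrite mulr_gt0.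
rewrite !fourier_abs_enorm// -[arcvec nu xi](subrK (arcvec nu xi')) addrC.
rewrite (le_trans (enormD_le _ _))// lerD2l -!mulrA mulr2n mulrDl mul1r !mulrA.
by rewrite /norm1/= lerD ?H.
Qed.

Lemma fourier_abs_annulus (Lam B M : R) (nu : {measure set R -> \bar R}) n l xi :
  (forall xi xi', fourier_abs (arc_image g nu) xi <= fourier_abs (arc_image g nu) xi' +
    Lam * norm1 (xi - xi') * fine (nu setT)) -> 0 <= Lam ->
  (nu setT < +oo)%E -> fine (nu setT) <= M ->
  (forall xi' th, xi' \in net R n l -> th \in [:: 0; - (pi / 2)] ->
     `|arcint g nu xi' th| <= B) ->
  annulus n xi ->
  fourier_abs (arc_image g nu) xi <= 2 * B + 2 * Lam * M * 2^-1 ^+ l.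
Proof.
move=> lip Lam0 nufin nuM bd axi; have [xi' xin dist] := net_dense l axi.
rewrite (le_trans (lip _ xi'))// lerD//.
  rewrite fourier_abs_enorm// (le_trans (enorm_le_norm1 _))// mulr2n mulrDl mul1r.
  by rewrite /norm1 lerD// bd// !inE eqxx ?orbT.
rewrite -mulrA [leRHS](_ : _ = Lam * (2 * 2^-1 ^+ l * M)); last by ring.
rewrite ler_wpM2l// ler_pM ?norm1_ge0 ?fine_ge0//.
Qed.

End lipschitz.

Section measurability.
Context d (T : measurableType d) (g : R -> R * R) (arc : nondegenerate_C2_arc g).
Context (nu : R.-ker T ~> R) (nu_fin : forall w, fin_num_fun (nu w)).

Lemma kernel_total_fin w : (nu w setT < +oo)%E.
Proof. by rewrite ltey_eq nu_fin. Qed.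

Lemma measurable_fine_integral_restrict (f : R -> R) : continuous f ->
  (forall t, 0 <= f t) ->
  measurable_fun setT
    (fun w => (\int[mrestr (nu w) (measurable_itv `[0%R, 1%R])]_t f t)%R).
Proof.
move=> cf f0; apply: measurableT_comp => //.
apply: (measurable_fun_integral_kernel
  (l := fun w => mrestr (nu w) (measurable_itv `[0%R, 1%R]))).
- move=> A mA; rewrite /mrestr; apply: measurable_kernel; exact: measurableI.
- by move=> t; rewrite lee_fin.
- by apply/measurable_EFinP; exact: continuous_measurable_fun.
Qed.

(** Kernel integrals are measurable in [w] for nonnegative integrands, hence the shift by 1 and the
    subtraction of the mass. *)
Lemma measurable_arcint xi th : measurable_fun setT (fun w => arcint g (nu w) xi th).
Proof.
have c1 : continuous (fun _ : R => 1 : R) by exact: cst_continuous.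
have cf : continuous (fun t => 1 + arc_phase g xi th t).
  by move=> t; apply: cvgD; [exact: cvg_cst|exact: continuous_arc_phase].
rewrite (_ : (fun w => _) = fun w =>
    (\int[mrestr (nu w) (measurable_itv `[0%R, 1%R])]_t (1 + arc_phase g xi th t))%R -
    (\int[mrestr (nu w) (measurable_itv `[0%R, 1%R])]_t 1)%R).
  apply: measurable_funB; apply: measurable_fine_integral_restrict => // t.
  by have := arc_phase_le1 g xi th t; rewrite ler_norml => /andP[? ?]; lra.
apply/funext => w; have nufin := kernel_total_fin w.
rewrite RintegralD//; first by rewrite addrAC subrr add0r.
  by apply: (bounded_integrable nufin (M := 1)) => // t; rewrite normr1.
exact: arc_phase_integrable.
Qed.

Lemma measurable_fourier_abs xi :
  measurable_fun setT (fun w => fourier_abs (arc_image g (nu w)) xi).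
Proof.
under eq_fun => w do rewrite (fourier_absE arc (kernel_total_fin w)).
apply: measurableT_comp.
  by apply: continuous_measurable_fun; exact: sqrt_continuous.
by apply: measurable_funD; apply: measurable_funX; exact: measurable_arcint.
Qed.

(** By Lipschitz continuity, the supremum exceeds [c] exactly when the transform does so at a point
    of some net, and the nets have countably many points in all. *)
Lemma measurable_fourier_sup n (c : R) :
  measurable [set w | (c%:E < fourier_sup (arc_image g (nu w)) n)%E].
Proof.
rewrite (_ : [set w | _] = \bigcup_l \bigcup_(xi in [set` net R n l])
    [set w | c < fourier_abs (arc_image g (nu w)) xi]).
  apply: bigcup_measurable => l _.
  apply: fin_bigcup_measurable => [|xi _]; first exact: finite_seq.
  have := measurable_fourier_abs xi measurableT (measurable_itv `]c, +oo[).
  rewrite setTI; congr measurable; apply/seteqP.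
  by split => w; rewrite /= in_itv/= andbT.
have [Lam Lam0 lip] := fourier_abs_lipschitz arc.
apply/seteqP; split => w /=.
  move=> /ereal_sup_gt[_ [xi axi <-]]; rewrite lte_fin => cxi.
  have nufin := kernel_total_fin w.
  pose e := fourier_abs (arc_image g (nu w)) xi - c.
  have e0 : 0 < e by rewrite subr_gt0.
  pose K := 2 * Lam * fine (nu w setT) + 1.
  have K0 : 0 < K.
    by rewrite ltr_wpDl// mulr_ge0 ?fine_ge0// mulr_ge0// ltW.
  have [l le] : exists l, 2^-1 ^+ l < e / K.
    have ek : 0 < e / K by rewrite divr_gt0.
    have h2 : `|2^-1| < 1 :> R by rewrite ger0_norm ?invr_ge0// invf_lt1 ?ltr1n.
    have [l _ /(_ l (leqnn l))/=] := cvgr0_norm_lt _ (cvg_expr h2) _ ek.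
    by rewrite ger0_norm ?exprn_ge0 ?invr_ge0//; exists l.
  exists l => //; have [xi' xin dist] := net_dense l axi.
  exists xi' => //=.
  have := lip _ nufin xi xi'; rewrite -lerBlDr.
  apply: lt_le_trans; rewrite ltrBrDl -ltrBrDr -/e.
  apply: (@le_lt_trans _ _ (2^-1 ^+ l * (K - 1))).
    rewrite /K addrK mulrAC [leRHS](_ : _ = Lam * fine (nu w setT) * (2 * 2^-1 ^+ l)); last by ring.
    by rewrite ler_wpM2l// mulr_ge0 ?fine_ge0// ltW.
  apply: (@le_lt_trans _ _ (2^-1 ^+ l * K)).
    by rewrite ler_wpM2l ?exprn_ge0 ?invr_ge0// gerBl.
  by rewrite -ltr_pdivlMr.
move=> [l _ [xi xin cxi]].
apply: (@lt_le_trans _ _ (fourier_abs (arc_image g (nu w)) xi)%:E); first by rewrite lte_fin.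
by apply: ereal_sup_ubound; exists xi => //; exact: net_annulus xin.
Qed.

End measurability.

End fourier_sup.

(** * Decay of the Fourier transform *)

Section exponents.
Context (R : realType) (s r delta m : R).
Hypotheses (s0 : 0 < s) (s1 : s < 1) (r1 : 1 < r) (delta0 : 0 < delta).
Hypothesis moment : 2 `^ (1 - r) * m <= 2 `^ (- r * (s + delta)).

Lemma powR2_opp_lt1 (a : R) : 0 < a -> 2 `^ (- a) < 1 :> R.
Proof.
move=> a0; rewrite powRN invf_lt1 ?powR_gt0//.
have := gt0_ltr_powR a0 _ _ (ltr1n R 2); rewrite powR1.
by apply; rewrite nnegrE.
Qed.

(** With [e = min(delta, 1) / 10], the bound [10 e <= delta] lets [rho^10] fit into the moment
    hypothesis and [10 e <= 1] keeps [rho >= 1/2]; [q] is the rate of the theorem and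
    [q^2 = 2^-s]. *)
Lemma rates : exists2 e, 0 < e & let rho := 2 `^ (- e) in let q := 2 `^ (- (s / 2)) in
  [/\ rho < 1, 2^-1 <= rho, q < 1, 2^-1 <= q ^+ 2 &
      2 `^ (1 - r) * m <= (q ^+ 2 * rho ^+ 10) `^ r].
Proof.
pose e := Num.min delta 1 / 10.
have e0 : 0 < e by rewrite divr_gt0// lt_min delta0 ltr01.
have e1 : 10 * e <= 1 by rewrite /e mulrC divfK// ge_min lexx orbT.
have ed : 10 * e <= delta by rewrite /e mulrC divfK// ge_min lexx.
have half (a : R) : a <= 1 -> 2^-1 <= 2 `^ (- a) :> R.
  by move=> a1; rewrite -[leLHS]powR_inv1// ?ler_powR ?ler1n ?lerN2.
have qq : (2 `^ (- (s / 2))) ^+ 2 = 2 `^ (- s) :> R.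
  by rewrite -powR_mulrn ?powR_ge0// -powRrM; congr (_ `^ _); field.
exists e => //=; split.
- exact: powR2_opp_lt1.
- by apply: half; lra.
- by apply: powR2_opp_lt1; rewrite divr_gt0.
- by rewrite qq half// ltW.
rewrite (le_trans moment)// qq -(powR_mulrn 10) ?powR_ge0// -powRrM.
rewrite -powRD ?(@pnatr_eq0 R 2) ?implybT// -powRrM ler_powR ?ler1n//.
rewrite mulNr lerNl -mulNr mulrC ler_pM2l; last by rewrite (lt_trans ltr01).
lra.
Qed.

End exponents.

Lemma geometric_small (R : realType) (rho e : R) : 0 < rho -> rho < 1 -> 0 < e ->
  exists2 L, (2 <= L)%N & rho ^+ L <= e.
Proof.
move=> rho0 rho1 e0.
have h : `|rho| < 1 by rewrite ger0_norm// ltW.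
have [L _ HL] := cvgr0_norm_lt _ (cvg_expr h) _ e0.
exists (maxn 2 L); first exact: leq_maxl.
have := HL (maxn 2 L) (leq_maxr _ _); rewrite /= ger0_norm ?exprn_ge0 ?(ltW rho0)//.
exact: ltW.
Qed.

Section laws.
Context (R : realType) d0 (T0 : measurableType d0) (P0 : probability T0 R).
Context (U : {RV P0 >-> R}) d (T : measurableType d) (P : probability T R).
Context (W : seq bool -> {RV P >-> R}).
Hypothesis U0 : forall x, 0 <= U x.
Hypothesis iid : iid_copies U W.

Lemma integral_copy (f : R -> R) v : v != [::] -> measurable_fun setT f ->
  (forall y, 0 <= y -> 0 <= f y) ->
  (\int[distribution P (W v)]_y (f (Num.max y 0))%:E = 'E_P0[f \o U])%E.
Proof.
move=> v0 mf f0.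
have mfm : measurable_fun setT (fun y : R => f (Num.max y 0)).
  by apply: (measurableT_comp mf (g := fun y : R => Num.max y 0)); exact: measurable_maxr.
rewrite (eq_set_function_integral _ (iid.2 v v0)).
rewrite ge0_integral_distribution.
- by rewrite unlock; apply: eq_integral => x _ /=; rewrite max_l.
- exact/measurable_EFinP.
- by move=> y; rewrite lee_fin f0// le_max lexx orbT.
Qed.

Lemma ae_weights_ge0 : {ae P, forall w, forall v, v != [::] -> 0 <= W v w}.
Proof.
have [f fsurj] : exists f : nat -> seq bool, forall v, exists n, f n = v.
  exists (fun n => odflt [::] (unpickle n)) => v.
  by exists (pickle v); rewrite pickleK.
have : {ae P, forall w, forall n, f n != [::] -> 0 <= W (f n) w}.
  apply: ae_foralln => n; move: (f n) => v.
  have [->|v0] := eqVneq v [::]; first exact/nearW.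
  have mN : measurable (W v @^-1` `]-oo, 0[).
    by rewrite -[_ @^-1` _]setTI; exact: measurable_funP.
  exists (W v @^-1` `]-oo, 0[); split => //.
    have := iid.2 v v0 _ (measurable_itv `]-oo, 0[).
    rewrite /distribution /pushforward /= => ->.
    rewrite (_ : _ @^-1` _ = set0) ?measure0//.
    by apply/seteqP; split => // x /=; rewrite in_itv/= ltNge U0.
  by move=> w /= Ww; rewrite in_itv/= ltNge; apply/negP => W0; apply: Ww.
by apply: filterS => w H v; have [n <-] := fsurj v; exact: H.
Qed.

End laws.

Lemma le_geometric_eq0 (R : realType) (a K rho : R) : 0 <= a -> 0 < rho -> rho < 1 ->
  (forall k : nat, a <= K * rho ^+ k) -> a = 0.
Proof.
move=> a0 rho0 rho1 H; apply/eqP; rewrite eq_le a0 andbT.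
have h : `|rho| < 1 by rewrite ger0_norm// ltW.
have c : K * rho ^+ k @[k --> \oo] --> K * 0 by apply: cvgMr; exact: cvg_expr.
by rewrite -(mulr0 K); apply: (cvgr_to_ge c); exact: nearW.
Qed.

Lemma borel_cantelli_geometric d (T : measurableType d) (R : realType)
    (P : probability T R) (E : nat -> set T) (K rho : R) :
  0 <= K -> 0 < rho -> rho < 1 -> (forall n, measurable (E n)) ->
  (forall n, (P (E n) <= (K * rho ^+ n)%:E)%E) ->
  {ae P, forall w, exists N, forall n, (N <= n)%N -> ~ E n w}.
Proof.
move=> K0 rho0 rho1 mE PE.
pose F k := \bigcup_(j in [set j | (k <= j)%N]) E j.
have mF k : measurable (F k) by exact: bigcup_measurable.
exists (\bigcap_k F k); split; first exact: bigcap_measurable.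
  have mI : measurable (\bigcap_k F k) by exact: bigcap_measurable.
  have fin : P (\bigcap_k F k) \is a fin_num by exact: fin_num_measure.
  rewrite -(fineK fin); congr EFin.
  apply: (le_geometric_eq0 (K := K / (1 - rho)) _ rho0 rho1) => [|k].
    exact: fine_ge0.
  rewrite -lee_fin fineK//.
  apply: le_trans (measure_geometric_union_le (k := k) K0 rho0 rho1 mE (fun j _ => PE j)).
  by apply: le_measure; rewrite ?inE//; [exact: mF|move=> w; exact].
move=> w /= H k _; apply: contrapT => nF; apply: H.
by exists k => n kn En; apply: nF; exists n.
Qed.

Section cascade_decay.
Context (R : realType) (r mur rho q : R) (g : R -> R * R) (L : nat).
Hypotheses (rho0 : 0 < rho) (rho1 : rho < 1).
Hypotheses (q0 : 0 < q) (q1 : q < 1) (q2 : 2^-1 <= q ^+ 2).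
Hypotheses (arc : nondegenerate_C2_arc g) (rhoL : 4 * rho ^+ L <= 1) (L2 : (2 <= L)%N).

(** The error of the net is its mesh [4^-n] times a total mass of order [4^k]. As [L >= 2] gives
    [2 k <= n], this is at most [2^-n <= q^(2 n)]. *)
Lemma mesh_start_level n : 2^-1 ^+ (2 * n) * 4 ^+ start_level L n <= q ^+ n.
Proof.
have kn : (2 * start_level L n <= n)%N.
  apply: (@leq_trans (uphalf n)).
    apply: (@leq_trans (L * start_level L n)); first by rewrite leq_mul2r L2 orbT.
    by rewrite mulnC leq_divM.
  by rewrite leq_uphalf_double -addnn leq_addr.
apply: (@le_trans _ _ (2^-1 ^+ n)).
  rewrite (_ : 4 = 2 ^+ 2); last by rewrite expr2; lra.
  rewrite -exprM mul2n -addnn exprD -mulrA ler_piMr ?exprn_ge0 ?invr_ge0//.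
  apply: (@le_trans _ _ (2^-1 ^+ n * 2 ^+ n)).
    by rewrite ler_wpM2l ?exprn_ge0 ?invr_ge0// ler_weXn2l ?ler1n.
  by rewrite -exprMn mulVf ?expr1n.
apply: (@le_trans _ _ ((q ^+ 2) ^+ n)); first by rewrite lerXn2r ?nnegrE ?invr_ge0 ?sqr_ge0.
by rewrite -exprM ler_wiXn2l ?(ltW q0) ?(ltW q1)// mul2n -addnn leq_addr.
Qed.

Lemma fourier_decay_off_bad_event : exists2 C, 0 < C &
  forall d (T : measurableType d) (P : probability T R)
    (W : seq bool -> {RV P >-> R}) (nu : {measure set R -> \bar R}) n w xi,
  (forall v, v != [::] -> 0 <= W v w) -> (nu setT < +oo)%E ->
  weak_cvg (cascade_measure W ^~ w) nu ->
  ~ bad_event W r mur rho q g L n w -> annulus n xi ->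
  fourier_abs (arc_image g nu) xi <= C * q ^+ n.
Proof.
have [K K0 HK] := off_bad_event r mur rho0 rho1 q0 q1 q2 arc rhoL.
have [Lam Lam0 lip] := fourier_abs_lipschitz arc.
pose E := expR (1 - rho)^-1.
have E0 : 0 < E by exact: expR_gt0.
exists (2 * K + 8 * Lam * E) => [|d T P W nu n w xi W0 nufin wc nbad axi].
  by rewrite addr_gt0 ?mulr_gt0.
have [osc mass] := HK _ _ _ _ _ _ nbad.
have massnu := limit_mass_le W0 nufin wc mass.
rewrite (le_trans (fourier_abs_annulus arc (B := K * q ^+ n) (l := 2 * n) (lip nu nufin)
  (ltW Lam0) nufin massnu _ axi))//.
  move=> xi' th xin thin; apply: (arcint_le W0 nufin wc arc (m0 := uphalf n)).
  by move=> m nm; exact: osc.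
rewrite [leRHS]mulrDl -[2 * K * _]mulrA lerD2l -/E.
rewrite [leLHS](_ : _ = 8 * Lam * E * (2^-1 ^+ (2 * n) * 4 ^+ start_level L n)); last by ring.
by rewrite ler_wpM2l ?mesh_start_level// ?mulr_ge0// ltW.
Qed.

End cascade_decay.

(** The divisions give [n <= 2 L (k + 1)]; the prefactor [2^e] pays for the [+ 1]. *)
Lemma start_level_geometric (R : realType) (e : R) L n : 0 < e -> (0 < L)%N ->
  (2 `^ (- e)) ^+ start_level L n <=
  2 `^ e * (2 `^ (- (e / (2 * L%:R)))) ^+ n.
Proof.
move=> e0 L0; rewrite -!powR_mulrn ?powR_ge0// -!powRrM.
rewrite -powRD ?(@pnatr_eq0 R 2) ?implybT// ler_powR ?ler1n//.
have LR : 0 < L%:R :> R by rewrite ltr0n.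
have : (n <= 2 * (L * (start_level L n).+1))%N.
  have h : (uphalf n <= L * (start_level L n).+1)%N.
    by rewrite ltnW// mulnC ltn_ceil.
  by rewrite (leq_trans _ (leq_mul (leqnn 2) h))// mul2n uphalfK leq_addl.
rewrite -(ler_nat R) !natrM -[(start_level L n).+1%:R]natr1; set k := (start_level L n)%:R => h.
suff : e / (2 * L%:R) * n%:R <= e * (k + 1) by lra.
rewrite mulrAC ler_pdivrMr ?mulr_gt0//.
rewrite [leRHS](_ : _ = e * (2 * (L%:R * (k + 1)))); last by ring.
by rewrite ler_wpM2l// ltW.
Qed.

Lemma dyadic_annulus (R : realType) (xi : R * R) N : 2 ^+ N <= enorm xi ->
  exists2 n, (N <= n)%N & annulus n xi.
Proof.
move=> Nxi.
have [m0 Hm0] : exists m, enorm xi < 2 ^+ m.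
  exists (Num.bound (enorm xi)); apply: lt_trans (archi_boundP (sqrtr_ge0 _)) _.
  by rewrite -natrX ltr_nat ltn_expl.
have [m xm mmin] := ex_minnP (ex_intro (fun m => enorm xi < 2 ^+ m) _ Hm0).
have Nm : (N < m)%N.
  rewrite ltnNge; apply/negP => mN; have := lt_le_trans xm (_ : _ <= 2 ^+ N).
  by rewrite ltNge Nxi ler_weXn2l ?ler1n// => /(_ isT).
case: m xm mmin Nm => // m xm mmin Nm; exists m => //.
rewrite /annulus/= (ltW xm) andbT leNgt; apply/negP => /mmin.
by rewrite ltnn.
Qed.

Section decay.
Context (R : realType) (s r delta : R).
Context d0 (T0 : measurableType d0) (P0 : probability T0 R).
Context (U : {RV P0 >-> R}) (g : R -> R * R).
Hypotheses (s0 : 0 < s) (s1 : s < 1).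
Hypotheses (U0 : forall x, 0 <= U x) (EU : ('E_P0[U] = 1)%E).
Hypotheses (r1 : 1 < r) (delta0 : 0 < delta).
Hypothesis EUr_fin : ('E_P0[(fun x => U x `^ r)%R] < +oo)%E.
Hypothesis EUr_le : ((2 `^ (1 - r))%:E * 'E_P0[(fun x => U x `^ r)%R] <=
  (2 `^ (- r * (s + delta)))%:E)%E.
Hypothesis arc : nondegenerate_C2_arc g.
Notation q := (2 `^ (- (s / 2))).

(** One statement behind both conclusions: the tail at a fixed [n] and, by Borel-Cantelli, the
    almost sure decay. *)
Lemma exceptional_events : exists C K rho' : R,
  [/\ 0 < C, 0 < K, 0 < rho', rho' < 1 &
  forall d (T : measurableType d) (P : probability T R)
    (W : seq bool -> {RV P >-> R}) (nu : R.-ker T ~> R),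
    iid_copies U W -> cascade_limit W nu ->
    exists E : nat -> set T,
    [/\ forall n, measurable (E n),
        forall n, (P (E n) <= (K * rho' ^+ n)%:E)%E &
        {ae P, forall w, forall n, ~ E n w -> forall xi, annulus n xi ->
          fourier_abs (arc_image g (nu w)) xi <= C * q ^+ n}]].
Proof.
pose mur := fine 'E_P0[(fun x => U x `^ r)%R]%E.
have murE : ('E_P0[(fun x => U x `^ r)%R] = mur%:E)%E.
  rewrite /mur fineK// ge0_fin_numE//.
  by apply: expectation_ge0 => x; exact: powR_ge0.
have moment : 2 `^ (1 - r) * mur <= 2 `^ (- r * (s + delta)).
  by rewrite -lee_fin EFinM -murE.
have [e e0 [rho1 rho2 q1 q2 msmall]] := rates s0 s1 r1 delta0 moment.
set rho := 2 `^ (- e) in rho1 rho2 msmall; have rho0 : 0 < rho by rewrite powR_gt0.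
have q0 : 0 < q by rewrite powR_gt0.
have [L L2 rhoL] : exists2 L, (2 <= L)%N & rho ^+ L <= 4^-1.
  by apply: geometric_small; rewrite ?invr_gt0.
have {}rhoL : 4 * rho ^+ L <= 1 by rewrite mulrC -ler_pdivlMr ?mul1r.
have L0 : (0 < L)%N by exact: leq_trans L2.
have [C C0 HC] := fourier_decay_off_bad_event r mur rho0 rho1 q0 q1 q2 arc rhoL L2.
have [K1 K10 HK1] := expR_tail rho0 rho1 (ler1n R 2).
have D1 : 1 <= 2 ^+ 12 :> R by rewrite -natrX ler1n.
have [K2 K20 HK2] := expR_tail rho0 rho1 D1.
set K := (2 + 2 * K1) / (1 - rho) + 2 ^+ 8 * K2 / (1 - rho) + 1.
have K0 : 0 < K.
  have r0 : 0 < 1 - rho by rewrite subr_gt0.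
  by rewrite !addr_gt0// divr_gt0// ?addr_gt0 ?mulr_gt0// exprn_gt0.
pose rho' : R := 2 `^ (- (e / (2 * L%:R))).
exists C, (K * 2 `^ e), rho'; split => //.
- by rewrite mulr_gt0// powR_gt0.
- exact: powR_gt0.
- by apply: powR2_opp_lt1; rewrite divr_gt0// mulr_gt0// ltr0n.
move=> d T P W nu iid [nufin wc].
exists (bad_event W r mur rho q g L); split.
- by move=> n; exact: measurable_bad_event.
- move=> n.
  have law1 v : v != [::] -> (\int[distribution P (W v)]_y (Num.max y 0)%:E = 1)%E.
    move=> v0; rewrite -EU; apply: (integral_copy U0 iid (f := idfun)) => //.
    exact: measurable_id.
  have lawr v : v != [::] ->
      (\int[distribution P (W v)]_y (Num.max y 0 `^ r)%:E = mur%:E)%E.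
    move=> v0; rewrite -murE; apply: (integral_copy U0 iid (f := fun y => y `^ r)) => //.
    by move=> y _; exact: powR_ge0.
  apply: (le_trans (bad_event_tail iid.1 r1 law1 lawr rho0 rho1 rho2 q0 q1 msmall
    arc L K10 K20 HK1 HK2 n)).
  rewrite lee_fin -/K -mulrA ler_wpM2l ?(ltW K0)//.
  exact: start_level_geometric.
apply: filterS2 (ae_weights_ge0 U0 iid) wc => w W0 wcw n nbad xi axi.
have nuw : (nu w setT < +oo)%E by rewrite ltey_eq nufin.
exact: HC W0 nuw wcw nbad axi.
Qed.

Lemma powR2_half_rate n : q ^+ n = 2 `^ (- (s * n%:R) / 2) :> R.
Proof. by rewrite -powR_mulrn ?powR_ge0// -powRrM; congr (_ `^ _); field. Qed.

(** The upper radius gives [q^(n+1) = (2^(n+1))^(-s/2) <= |xi|^(-s/2)], one power of [q] too many,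
    hence the factor [q^-1]. *)
Lemma annulus_rate n (xi : R * R) : annulus n xi ->
  q ^+ n <= q^-1 * enorm xi `^ (- s / 2).
Proof.
move=> /andP[lo hi]; have q0 : 0 < q by rewrite powR_gt0.
have x0 : 0 < enorm xi by apply: lt_le_trans lo; rewrite exprn_gt0.
have -> : enorm xi `^ (- s / 2) = (enorm xi `^ (s / 2))^-1 by rewrite mulNr powRN.
rewrite ler_pdivlMl// -exprS.
have -> : q ^+ n.+1 = ((2 ^+ n.+1) `^ (s / 2))^-1 :> R.
  rewrite powRN exprVn -(powR_mulrn n.+1 (powR_ge0 2 (s / 2))).
  by rewrite -(powR_mulrn n.+1 (ler0n R 2)) powRAC.
rewrite lef_pV2 ?posrE ?powR_gt0 ?exprn_gt0//.
by apply: ge0_ler_powR => //; rewrite ?nnegrE ?exprn_ge0 ?(ltW x0)// divr_ge0 ?(ltW s0).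
Qed.

End decay.

(* The constants are chosen before the probability space carrying the cascade,
   and what follows them involves U only through its law. *)
Theorem theorem1p5 (R : realType) (s r delta : R)
    (d0 : measure_display) (T0 : measurableType d0) (P0 : probability T0 R)
    (U : {RV P0 >-> R}) (gamma : R -> R * R)
    (s_gt0 : 0 < s) (s_lt1 : s < 1)
    (U_ge0 : forall x, 0 <= U x) (EU : ('E_P0[U] = 1)%E)
    (r_gt1 : 1 < r) (delta_gt0 : 0 < delta)
    (EUr_fin : ('E_P0[(fun x => U x `^ r)%R] < +oo)%E)
    (EUr_le : ((2 `^ (1 - r))%:E * 'E_P0[(fun x => U x `^ r)%R] <=
               (2 `^ (- r * (s + delta)))%:E)%E)
    (gamma_arc : nondegenerate_C2_arc gamma) :
  exists C c eta : R, 0 < c /\ 0 < eta /\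
    forall (d : measure_display) (T : measurableType d) (P : probability T R)
      (W : seq bool -> {RV P >-> R}) (nu : R.-ker T ~> R),
      iid_copies U W -> cascade_limit W nu ->
      (forall n : nat, (1 <= n)%N ->
        (P [set w | ((C * 2 `^ (- (s * n%:R) / 2))%:E <
                     fourier_sup (arc_image gamma (nu w)) n)%E] <=
         (C * expR (- c * 2 `^ (eta * n%:R)) + C * 2 `^ (- c * n%:R))%:E)%E) /\
      {ae P, forall w, exists K M : R, forall xi : R * R, M <= enorm xi ->
        fourier_abs (arc_image gamma (nu w)) xi <= K * enorm xi `^ (- s / 2)}.
Proof.
have [C [K [rho [C0 K0 rho0 rho1 H]]]] :=
  exceptional_events s_gt0 s_lt1 U_ge0 EU r_gt1 delta_gt0 EUr_fin EUr_le gamma_arc.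
have ln2 : 0 < ln (2 : R) by rewrite ln_gt0// ltr1n.
pose c := - ln rho / ln 2.
have rhoE n : rho ^+ n = 2 `^ (- c * n%:R).
  rewrite powRrM powR_mulrn ?powR_ge0//; congr (_ ^+ n).
  by rewrite /powR pnatr_eq0/= /c -mulNr opprK divfK ?gt_eqF// lnK// posrE.
(* The geometric term carries the whole probability bound, so the exponential term is bounded below
   by 0 and [eta = 1] serves; [C + K] covers both the threshold and the probability, and [c] is
   chosen so that [2^-c = rho]. *)
exists (C + K), c, 1; split.
  by rewrite divr_gt0// oppr_gt0 ln_lt0// rho0.
split=> [|d T P W nu iid lim]; first exact: ltr01.
have [E [mE PE aeE]] := H d T P W nu iid lim.
have CK0 : 0 < C + K by rewrite addr_gt0.
split=> [n _|].
  have [N [mN N0 subN]] := aeE.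
  apply: (@le_trans _ _ (P (E n `|` N))).
    apply: le_measure; rewrite ?inE.
    - exact: (measurable_fourier_sup gamma_arc lim.1).
    - exact: measurableU.
    move=> w /= sup_gt; have [Nw|nNw] := pselect (N w); [by right|left].
    have {}nNw : forall n, ~ E n w -> forall xi, annulus n xi ->
        fourier_abs (arc_image gamma (nu w)) xi <= C * 2 `^ (- (s / 2)) ^+ n.
      by apply: contrapT => h; apply: nNw; exact: subN.
    apply: contrapT => nE; move: sup_gt; apply/negP; rewrite -leNgt.
    apply: ge_ereal_sup => _ [xi axi <-]; rewrite lee_fin -powR2_half_rate.
    by rewrite (le_trans (nNw n nE xi axi))// ler_wpM2r ?exprn_ge0 ?powR_ge0// lerDl ltW.
  apply: (le_trans (measureU2 _ _ _)) => //.
  rewrite [X in (_ + X)%E]N0 adde0 (le_trans (PE n))// lee_fin -rhoE.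
  rewrite ler_wpDl ?mulr_ge0 ?expR_ge0 ?(ltW CK0)//.
  by rewrite ler_wpM2r ?exprn_ge0 ?(ltW rho0)// lerDr ltW.
have := borel_cantelli_geometric (ltW K0) rho0 rho1 mE PE.
apply: filterS2 aeE => w Ew [N HN].
exists (C * (2 `^ (- (s / 2)))^-1), (2 ^+ N) => xi /dyadic_annulus[n Nn axi].
rewrite (le_trans (Ew n (HN n Nn) xi axi))// -mulrA ler_wpM2l ?(ltW C0)//.
exact: annulus_rate.
Qed.
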